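(* Let $d\ge1$, let $T$ be an exact transformation of $(X,\mathcal F,\mu)$ and let $f\in L_2^{sym}(\mu^d)$ be a real-valued kernel. Assume that for every $m=1,\dots,d$ we have $R_mf\in L_{2m,\pi}^{sym}(\mu^m)$ and that the series $$\sum_{\mathbf k\in\mathbb Z_+^m}V^{*\mathbf k}R_mf\;:=\;\lim_{n_1,\dots,n_m\to\infty}\ \sum_{0\le k_1<n_1,\dots,0\le k_m<n_m}V^{*(k_1,\dots,k_m)}R_mf$$ converges in $L_{2m,\pi}(\mu^m)$. Then $$V_n^{(d)}f:=\frac1{n^{d-1/2}}\sum_{0\le k_1,\dots,k_d\le n-1}D_dV^{(k_1,\dots,k_d)}(f-R_0f)$$ converges in distribution, as $n\to\infty$, to a centered Gaussian random variable with variance $d^2\sigma^2(f)\ge0$ (the Dirac measure at $0$ if the variance is $0$), where $$\sigma^2(f)=\Bigl|\sum_{k=0}^\infty V^{*k}R_1f\Bigr|_2^2-\Bigl|\sum_{k=1}^\infty V^{*k}R_1f\Bigr|_2^2\ge0.$$ The convergence of the second moments $E(V_n^{(d)}f)^2\to d^2\sigma^2(f)$ as $n\to\infty$ holds as well.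
   Context: $(X,\mathcal F,\mu)$ is a standard (Lebesgue) probability space, $L_p(\mu)$ has norm $|\cdot|_p$, and $E$ is the expectation with respect to $\mu$; $\mathbb Z_+=\{0,1,2,\dots\}$. A measure preserving $T$ is exact if $\bigcap_{n\ge1}T^{-n}\mathcal F$ is the trivial $\sigma$-field. $Vf=f\circ T$ on the spaces $L_p(\mu)$ and $V^*$ is its (pre)adjoint, so $\int (V^*f)h\,d\mu=\int f\,(h\circ T)\,d\mu$. $L_{p,\pi}(\mu^m)$ is the projective tensor product of $m$ copies of $L_p(\mu)$ (completion of the algebraic tensor product in the largest cross norm), identified with a subspace of $L_p(\mu^m)=L_p(X^m,\mathcal F^{\otimes m},\mu^m)$ via $f_1\otimes\cdots\otimes f_m\mapsto f_1(x_1)\cdots f_m(x_m)$. The superscript $sym$ denotes the subspace of functions invariant under permutations of coordinates. $V^{(k_1,\dots,k_m)}f(x_1,\dots,x_m)=f(T^{k_1}x_1,\dots,T^{k_m}x_m)$, and $V^{*(k_1,\dots,k_m)}$ is its (pre)adjoint, i.e. $V^{*k_1}\otimes\cdots\otimes V^{*k_m}$; both act on $L_{p,\pi}(\mu^m)$. For $p\ge m$, $D_m:L_{p,\pi}(\mu^m)\to L_{p/m}(\mu)$ is the norm one linear map determined by $D_m(f_1\otimes\cdots\otimes f_m)(x)=f_1(x)\cdots f_m(x)$. Symmetric Hoeffding decomposition: let $\check E^l$ be integration over the $l$-th variable, $\mathcal S_d^m$ the family of $m$-element subsets of $\{1,\dots,d\}$, and for $S=\{i_1<\dots<i_m\}$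 let $\pi_S(x_1,\dots,x_d)=(x_{i_1},\dots,x_{i_m})$. For symmetric $f$, $R_mf$ is the symmetric function on $X^m$ such that $(R_mf)\circ\pi_S=\prod_{l\notin S}\check E^l\prod_{l\in S}(I-\check E^l)f$ for every $S\in\mathcal S_d^m$; then $f=\sum_{m=0}^d\sum_{S\in\mathcal S_d^m}(R_mf)\circ\pi_S$, and $R_0f=\int f\,d\mu^d$. The restriction $D_dV^{(k_1,\dots,k_d)}(f-R_0f)$ is computed termwise by $D_dV^{(k_1,\dots,k_d)}((R_mf)\circ\pi_S)=D_mV^{(k_{i_1},\dots,k_{i_m})}R_mf$ for $S=\{i_1<\dots<i_m\}$, $1\le m\le d$. *)

(* Defs.v *)
From HB Require Import structures.
From mathcomp Require Import all_boot all_order all_algebra all_fingroup.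
From mathcomp Require Import all_classical all_reals all_analysis.

Set Implicit Arguments.
Unset Strict Implicit.
Unset Printing Implicit Defensive.

Import Order.TTheory GRing.Theory Num.Theory.
Import numFieldNormedType.Exports.

Local Open Scope classical_set_scope.
Local Open Scope ring_scope.

(* Points of X^m are m-tuples; functions represent their
   a.e. classes.  Objects that only exist as classes (V^*, R_m f, D_m, sums of
   series) are chosen representatives, selected by [xget] among the functions
   with the defining property. *)

Section power.
Context {disp : measure_display} {R : realType} {X : measurableType disp}.

Definition tcons (m : nat) (p : X * m.-tuple X) : m.+1.-tuple X :=
  [the m.+1.-tuple X of p.1 :: p.2].

Lemma measurable_tcons (m : nat) : measurable_fun setT (@tcons m).
Proof. exact: measurable_cons. Qed.

HB.instance Definition _ (m : nat) :=
  isMeasurableFun.Build _ _ _ _ (@tcons m) (@measurable_tcons m).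

Fixpoint power_prob (mu : probability X R) (m : nat) :
    probability (m.-tuple X) R :=
  match m with
  | 0 => \d_[tuple]
  | k.+1 => distribution (mu \x power_prob mu k)%E (@tcons k)
  end.

End power.

Notation "mu \^ m" := (power_prob mu m) (at level 40, m at level 9).

Section standard_and_exact.
Context {disp : measure_display} {R : realType} {X : measurableType disp}.
Variable mu : probability X R.

(* (X, mu) is isomorphic mod 0 to (R, image of mu): phi is injective on a set
   of full measure and maps its measurable subsets to sets that are measurable
   for the completed image measure.  Both standard Borel spaces and their
   completions (Lebesgue-Rokhlin spaces) are covered. *)
Definition standard_space : Prop :=
  exists (phi : X -> R) (X0 : set X),
    [/\ measurable_fun setT phi, measurable X0, mu X0 = 1%E,
        {in X0 &, injective phi} &
        forall A : set X, measurable A -> A `<=` X0 ->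
          exists B1 B2 : set R,
            [/\ measurable B1, measurable B2, B1 `<=` phi @` A,
                phi @` A `<=` B2 & mu (phi @^-1` (B2 `\` B1)) = 0%E]].

Definition measure_preserving (T : X -> X) : Prop :=
  measurable_fun setT T /\
  forall A : set X, measurable A -> mu (T @^-1` A) = mu A.

Definition exact_map (T : X -> X) : Prop :=
  measure_preserving T /\
  forall A : set X, measurable A ->
    (forall n : nat, (0 < n)%N ->
       exists2 B : set X, measurable B & A = iter n T @^-1` B) ->
    mu A = 0%E \/ mu A = 1%E.

End standard_and_exact.

Section projective.
Context {disp : measure_display} {R : realType} {X : measurableType disp}.
Variable mu : probability X R.

Definition tensor (m : nat) (g : 'I_m -> X -> R) (x : m.-tuple X) : R :=
  \prod_(i < m) g i (tnth x i).

(* The projective (largest cross) norm on the algebraic tensor product of m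
   copies of L_p(mu); it is +oo outside the algebraic tensor product. *)
Definition alg_proj_norm (p : R) (m : nat) (u : m.-tuple X -> R) : \bar R :=
  ereal_inf [set s | exists (N : nat) (g : 'I_N -> 'I_m -> X -> R),
    [/\ forall j i, g j i \in Lfun mu p%:E,
        u = (fun x => \sum_(j < N) tensor (g j) x) %[ae mu \^ m] &
        s = (\sum_(j < N) \prod_(i < m)
               fine ('N[mu]_(p%:E)[EFin \o g j i])%E)%:E]].

Definition alg_proj_cauchy (p : R) (m : nat)
    (u : nat -> m.-tuple X -> R) : Prop :=
  (forall n, alg_proj_norm p (u n) < +oo)%E /\
  forall eps : R, 0 < eps -> exists N : nat, forall i j : nat,
    (N <= i)%N -> (N <= j)%N ->
    (alg_proj_norm p (fun x => u i x - u j x)%R < eps%:E)%E.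

(* The norm of the completion L_{p,pi}(mu^m), seen inside L_p(mu^m): f is in
   the completion iff it is the L_p-limit of a sequence that is Cauchy for the
   projective norm, and its norm is the limit of the norms.  That limit does
   not depend on the sequence because the completion injects into L_p(mu^m);
   the norm is +oo outside L_{p,pi}. *)
Definition proj_norm (p : R) (m : nat) (f : m.-tuple X -> R) : \bar R :=
  ereal_inf [set l | f \in Lfun (mu \^ m) p%:E /\
    exists u : nat -> m.-tuple X -> R,
      [/\ alg_proj_cauchy p u,
          'N[mu \^ m]_(p%:E)[EFin \o (fun x => u n x - f x)%R]%E
            @[n --> \oo] --> 0%E &
          alg_proj_norm p (u n) @[n --> \oo] --> l]].

Definition Lproj (p : R) (m : nat) (f : m.-tuple X -> R) : Prop :=
  (proj_norm p f < +oo)%E.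

Definition symmetric_fun (m : nat) (f : m.-tuple X -> R) : Prop :=
  forall s : 'S_m,
    (fun x : m.-tuple X => f [tuple tnth x (s i) | i < m]) = f
      %[ae mu \^ m].

(* "Norm one": the bound below is attained at the constant function 1. *)
Definition is_diag_map (p : R) (m : nat)
    (D : (m.-tuple X -> R) -> X -> R) : Prop :=
  [/\ forall f, Lproj p f -> D f \in Lfun mu (p / m%:R)%:E,
      forall (a : R) f g, Lproj p f -> Lproj p g ->
        D (fun x => a * f x + g x) = (fun x => a * D f x + D g x) %[ae mu],
      forall f, Lproj p f ->
        ('N[mu]_((p / m%:R)%:E)[EFin \o D f] <= proj_norm p f)%E &
      forall g : 'I_m -> X -> R, (forall i, g i \in Lfun mu p%:E) ->
        D (tensor g) = (fun x => \prod_(i < m) g i x) %[ae mu]].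

Definition diag_map (p : R) (m : nat) : (m.-tuple X -> R) -> X -> R :=
  xget (fun _ _ => 0) [set D | is_diag_map p D].

Definition integrate_coord (d : nat) (l : 'I_d) (f : d.-tuple X -> R)
    (x : d.-tuple X) : R :=
  \int[mu]_y f [tuple if i == l then y else tnth x i | i < d].

Definition hoeffding_term (d : nat) (f : d.-tuple X -> R)
    (S : {set 'I_d}) : d.-tuple X -> R :=
  foldr (fun l g => integrate_coord l g)
    (foldr (fun l g x => g x - integrate_coord l g x) f (enum S))
    (enum (~: S)).

(* [enum S] lists S in increasing order. *)
Definition proj_coords (d m : nat) (S : {set 'I_d}) (hS : #|S| = m)
    (x : d.-tuple X) : m.-tuple X :=
  [tuple tnth x (enum_val (cast_ord (esym hS) i)) | i < m].

Definition is_hoeffding (d m : nat) (f : d.-tuple X -> R)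
    (g : m.-tuple X -> R) : Prop :=
  [/\ g \in Lfun (mu \^ m) 2%:E, symmetric_fun g &
      forall (S : {set 'I_d}) (hS : #|S| = m),
        (fun x => g (proj_coords hS x)) = hoeffding_term f S %[ae mu \^ d]].

Definition hoeffding (d m : nat) (f : d.-tuple X -> R) : m.-tuple X -> R :=
  xget (fun _ => 0) [set g | is_hoeffding f g].

End projective.

Arguments hoeffding {disp R X} mu {d} m f x.

Section dynamics.
Context {disp : measure_display} {R : realType} {X : measurableType disp}.
Variables (mu : probability X R) (T : X -> X).

Definition koopman (m : nat) (k : 'I_m -> nat) (f : m.-tuple X -> R)
    (x : m.-tuple X) : R :=
  f [tuple iter (k i) T (tnth x i) | i < m].

(* The preadjoint of V^(k_1,...,k_m) : L_oo(mu^m) -> L_oo(mu^m); it acts on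
   L_1(mu^m), hence on every L_p(mu^m). *)
Definition is_koopman_preadjoint (m : nat) (k : 'I_m -> nat)
    (f g : m.-tuple X -> R) : Prop :=
  g \in Lfun (mu \^ m) 1%E /\
  forall h : m.-tuple X -> R, h \in Lfun (mu \^ m) +oo%E ->
    \int[mu \^ m]_x (g x * h x) = \int[mu \^ m]_x (f x * koopman k h x).

Definition koopman_preadjoint (m : nat) (k : 'I_m -> nat)
    (f : m.-tuple X -> R) : m.-tuple X -> R :=
  xget (fun _ => 0) [set g | is_koopman_preadjoint k f g].

Definition box_sum (m : nat) (n : 'I_m -> nat) (f : m.-tuple X -> R)
    (x : m.-tuple X) : R :=
  \sum_(k : {dffun forall i : 'I_m, 'I_(n i)})
    koopman_preadjoint (fun i => k i : nat) f x.

Definition box_series_cvg (p : R) (m : nat) (f : m.-tuple X -> R) : Prop :=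
  exists s : m.-tuple X -> R, Lproj mu p s /\
    forall eps : R, 0 < eps -> exists N : nat,
      forall n : 'I_m -> nat, (forall i, (N <= n i)%N) ->
        (proj_norm mu p (fun x => box_sum n f x - s x)%R < eps%:E)%E.

Definition L2_series (m : nat) (u : nat -> m.-tuple X -> R) :
    m.-tuple X -> R :=
  xget (fun _ => 0) [set s | s \in Lfun (mu \^ m) 2%:E /\
    'N[mu \^ m]_(2%:E)[EFin \o (fun x => \sum_(0 <= k < n) u k x - s x)%R]%E
      @[n --> \oo] --> 0%E].

(* L_2(mu) is realized as L_2 of the space of 1-tuples, where R_1 f lives. *)
Definition sigma2 (d : nat) (f : d.-tuple X -> R) : R :=
  let W (k : nat) : 1.-tuple X -> R :=
    koopman_preadjoint (fun=> k) (hoeffding mu 1 f) in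
  fine ('N[mu \^ 1]_(2%:E)[EFin \o L2_series W])%E ^+ 2 -
  fine ('N[mu \^ 1]_(2%:E)[EFin \o L2_series (fun k => W k.+1)])%E ^+ 2.

(* D_d V^(k_1,...,k_d) (f - R_0 f), termwise over the nonempty S. *)
Definition diag_centered (d : nat) (f : d.-tuple X -> R) (k : 'I_d -> nat)
    (x : X) : R :=
  \sum_(S : {set 'I_d} | (0 < #|S|)%N)
    diag_map mu (2 * #|S|)%:R
      (koopman (fun i : 'I_#|S| => k (enum_val i)) (hoeffding mu #|S| f)) x.

Definition von_mises (d : nat) (f : d.-tuple X -> R) (n : nat) (x : X) : R :=
  (n%:R `^ (d%:R - 2^-1))^-1 *
  \sum_(k : {ffun 'I_d -> 'I_n}) diag_centered f (fun i => k i : nat) x.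

End dynamics.

(* [normal_prob m s] has standard deviation s, and is not a Dirac measure
   for s = 0. *)
Definition centered_gaussian {R : realType} (v : R) :
    probability (measurableTypeR R) R :=
  if v == 0
  then (\d_(0 : measurableTypeR R) : probability (measurableTypeR R) R)
  else (normal_prob 0 (Num.sqrt v) : probability (measurableTypeR R) R).

Definition cvg_in_distribution {disp : measure_display} {R : realType}
    {X : measurableType disp} (mu : probability X R) (Z : nat -> X -> R)
    (nu : probability (measurableTypeR R) R) : Prop :=
  (forall n, measurable_fun setT (Z n)) /\
  forall phi : R -> R, continuous phi ->
    (exists M : R, forall y, `|phi y| <= M) ->
    \int[mu]_x phi (Z n x) @[n --> \oo] --> \int[nu]_y phi y.

(* Main.v *)
Require Import Defs.
From HB Require Import structures.
From mathcomp Require Import all_boot all_order all_algebra all_fingroup.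
From mathcomp Require Import all_classical all_reals all_analysis.
From mathcomp Require Import measurable_realfun ess_sup_inf.
From mathcomp Require Import ring lra.

Set Implicit Arguments.
Unset Strict Implicit.
Unset Printing Implicit Defensive.

Import Order.TTheory GRing.Theory Num.Theory.
Import numFieldNormedType.Exports.

Local Open Scope classical_set_scope.
Local Open Scope ring_scope.

(** Write [s] for the sum of the series of [V^{*k} R_m f]. Then [R_m f] is the product over the
    coordinates of the operators [I - V_i^*], applied to [s]; expanding [s] into an absolutely
    convergent series of elementary tensors turns the von Mises sum of [R_m f] into a series of
    products of one-dimensional Birkhoff sums of functions [u - V^* u].

    Up to the coboundary [V V^* u - V^* u], such a function is [e = u - V V^* u], which satisfies
    [V^* e = 0]: its Birkhoff sums are reversed martingales, and their norm in [L_{2m}] is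
    [O(sqrt n)]. By Hoelder's inequality the von Mises sum of [R_m f] is [O(n^{m/2})] in [L_2], so
    that after normalization only the linear term [m = 1] survives, with a factor [d].

    The central limit theorem for the linear term is proved with characteristic functions, adding
    one summand of the reversed martingale at a time; exactness replaces the conditional variance
    [V^*(e^2)] by its mean. The continuity theorem uses Bernstein polynomials in
    [(1 + sin (y / L)) / 2], which are trigonometric polynomials in [y].

    The diagonal map exists because the diagonal of a convergent tensor series is the limit of the
    averages of its sum over diagonal cells of fine partitions, hence depends only on the sum. *)

(** * Integrals and norms *)

(** No filtration or conditional expectation appears: the martingale structure is the recursion
    [bsumS], a first summand plus a function of S x, together with the duality of V and V^*. If V^*
    e = 0, then e is orthogonal to functions of S x, so the term linear in e drops out of the
    binomial expansion of an even moment. This replaces Burkholder's inequality, as only the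
    exponents 2m occur.

    The exponent 2m is forced by Hoelder: a product of m functions of L_{2m} lies in L_2, with norm
    at most the cross norm of their tensor. All operators act on elementary tensors factor by
    factor, so estimates are made there and summed over the series.

    A set of m coordinates contributes n^{1/2-m} O(n^{m/2}) after normalization, which tends to 0
    for m > 1. The variance is found by Pythagoras: |u|^2 - |V^* u|^2 = |u - V V^* u|^2.

    V^*, D_m and the sums of series are arbitrary choices among a.e. versions: each has to be shown
    to exist before its defining property can be used, and identities about them hold a.e. only. *)

Section real_integrable.
Context d (Y : measurableType d) (R : realType).
Variable P : {measure set Y -> \bar R}.
Implicit Types (f g : Y -> R).

Definition intg f := P.-integrable setT (EFin \o f).

Lemma intg_measurable f : intg f -> measurable_fun setT f.
Proof. by move=> /measurable_int /measurable_EFinP. Qed.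

Lemma intgD f g : intg f -> intg g -> intg (fun x => f x + g x).
Proof.
move=> fi gi; rewrite /intg (_ : _ \o _ = (EFin \o f) \+ (EFin \o g))%E; last first.
  by apply/funext => x.
exact: integrableD.
Qed.

Lemma intgZ a f : intg f -> intg (fun x => a * f x).
Proof.
move=> fi; rewrite /intg.
have := @integrableZl _ _ _ P _ measurableT a _ fi.
by apply: eq_integrable.
Qed.

Lemma intgN f : intg f -> intg (fun x => - f x).
Proof. by move=> /(intgZ (-1)); under eq_fun do rewrite mulN1r. Qed.

Lemma intgB f g : intg f -> intg g -> intg (fun x => f x - g x).
Proof. by move=> fi /intgN; exact: intgD. Qed.

Lemma intg0 : intg (fun=> 0).
Proof. exact: integrable0. Qed.

Lemma intg_sum (I : Type) (s : seq I) (F : I -> Y -> R) :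
  (forall i, intg (F i)) -> intg (fun x => \sum_(i <- s) F i x).
Proof.
move=> Fi; elim: s => [|i s IH].
  by under eq_fun do rewrite big_nil; exact: intg0.
by under eq_fun do rewrite big_cons; exact: intgD.
Qed.

Lemma intg_norm f : intg f -> intg (fun x => `|f x|).
Proof. by move=> /integrable_norm. Qed.

Lemma intg_le f g : measurable_fun setT f -> intg g ->
  (forall x, `|f x| <= `|g x|) -> intg f.
Proof.
move=> mf gi fg; apply: (le_integrable _ _ _ gi) => //.
  exact/measurable_EFinP.
by move=> x _; rewrite /= lee_fin.
Qed.

(** The measure need not be complete, so measurability of [g] has to be given: it does not follow
    from equality a.e. *)
Lemma intg_ae f g : measurable_fun setT f -> measurable_fun setT g ->
  f = g %[ae P] -> intg f -> intg g.
Proof.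
move=> mf mg fg /integrableP[_ fi]; apply/integrableP; split.
  exact/measurable_EFinP.
rewrite (_ : (\int[P]_x _)%E = (\int[P]_x `|(EFin \o f) x|)%E)//.
apply: ge0_ae_eq_integral => //=.
- by apply/measurable_EFinP; apply: measurableT_comp.
- by apply/measurable_EFinP; apply: measurableT_comp.
- by apply: filterS fg => x /(_ I) -> _.
Qed.

Lemma Rint_ae f g : measurable_fun setT f -> measurable_fun setT g ->
  f = g %[ae P] -> \int[P]_x f x = \int[P]_x g x.
Proof.
move=> mf mg fg; congr fine; apply: ae_eq_integral => //; try exact/measurable_EFinP.
by apply: filterS fg => x /(_ I) -> _.
Qed.

Lemma RintD f g : intg f -> intg g ->
  \int[P]_x (f x + g x) = \int[P]_x f x + \int[P]_x g x.
Proof. exact: RintegralD. Qed.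

Lemma RintB f g : intg f -> intg g ->
  \int[P]_x (f x - g x) = \int[P]_x f x - \int[P]_x g x.
Proof. exact: RintegralB. Qed.

Lemma RintZ a f : intg f -> \int[P]_x (a * f x) = a * \int[P]_x f x.
Proof. exact: RintegralZl. Qed.

Lemma Rintegral_zero : \int[P]_x (0 : R) = 0.
Proof. by rewrite /Rintegral integral0. Qed.

Lemma Rint_sum (I : Type) (s : seq I) (F : I -> Y -> R) :
  (forall i, intg (F i)) ->
  \int[P]_x (\sum_(i <- s) F i x) = \sum_(i <- s) \int[P]_x F i x.
Proof.
move=> Fi; elim: s => [|i s IH].
  by under eq_Rintegral do rewrite big_nil; rewrite Rintegral_zero big_nil.
under eq_Rintegral do rewrite big_cons.
by rewrite RintD ?big_cons ?IH//; exact: intg_sum.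
Qed.

Lemma Rint_le f g : intg f -> intg g -> (forall x, f x <= g x) ->
  \int[P]_x f x <= \int[P]_x g x.
Proof. by move=> fi gi fg; apply: le_Rintegral. Qed.

Lemma Rint_norm f : intg f -> `|\int[P]_x f x| <= \int[P]_x `|f x|.
Proof. exact: le_normr_Rintegral. Qed.

Lemma EFin_Rint f : intg f -> (\int[P]_x f x)%:E = (\int[P]_x (f x)%:E)%E.
Proof. by move=> fi; rewrite fineK//; exact: integrable_fin_num. Qed.

Lemma Rint_ge0 f : (forall x, 0 <= f x) -> 0 <= \int[P]_x f x.
Proof. by move=> f0; apply: Rintegral_ge0. Qed.

Lemma Rint_eq0_ae f : intg f -> (forall x, 0 <= f x) ->
  \int[P]_x f x = 0 -> f = (fun=> 0) %[ae P].
Proof.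
move=> fi f0 If.
have mf := intg_measurable fi.
have : (\int[P]_x `|(EFin \o f) x|)%E = 0%E.
  rewrite -[RHS]/(0%:E) -If EFin_Rint//; apply: eq_integral => x _.
  by rewrite /= ger0_norm.
move/(ae_eq_integral_abs P measurableT) => H.
have /H : measurable_fun setT (EFin \o f) by exact/measurable_EFinP.
by apply: filterS => x /(_ I) [].
Qed.

End real_integrable.

Section bounded_integrable.
Context d (Y : measurableType d) (R : realType).
Variable P : probability Y R.

Lemma intg_bounded (f : Y -> R) (M : R) : measurable_fun setT f ->
  (forall x, `|f x| <= M) -> intg P f.
Proof.
move=> mf fM; apply: (@intg_le _ _ _ P f (fun=> M)) => //.
- exact: finite_measure_integrable_cst.
- by move=> x; apply: le_trans (fM x) _; exact: ler_norm.
Qed.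

Lemma intg_cst (c : R) : intg P (fun=> c).
Proof. exact: finite_measure_integrable_cst. Qed.

Lemma Rint_cst (c : R) : \int[P]_x c = c.
Proof.
rewrite (@Rintegral_cst _ _ _ P setT measurableT c).
rewrite [X in c * X](_ : _ = 1) ?mulr1//.
exact: (congr1 fine (@probability_setT _ _ _ P)).
Qed.

Lemma intgM_bounded (f g : Y -> R) (M : R) : intg P f -> measurable_fun setT g ->
  (forall x, `|g x| <= M) -> intg P (fun x => f x * g x).
Proof.
move=> fi mg gM; apply: (@intg_le _ _ _ P _ (fun x => M * f x)).
- by apply: measurable_funM => //; exact: intg_measurable fi.
- exact: intgZ.
- move=> x; rewrite !normrM mulrC; apply: ler_wpM2r => //.
  by apply: le_trans (gM x) _; exact: ler_norm.
Qed.

Lemma Rint_le_bound (f : Y -> R) (M : R) : intg P f -> (forall x, f x <= M) ->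
  \int[P]_x f x <= M.
Proof.
by move=> fi fM; rewrite -(Rint_cst M); apply: Rint_le => //; exact: intg_cst.
Qed.

End bounded_integrable.

Section norms.
Context d (Y : measurableType d) (R : realType).
Variable P : probability Y R.
Implicit Types (f g : Y -> R) (N : nat).

(** Exponents are natural numbers, since only 1, 2 and 2m are needed; then [|f| ^+ N] is an
    algebraic power, open to binomial expansion. Because of [fine] the value is meaningful only for
    functions of L_N. *)
Definition nrm N f : R := fine ('N[P]_(N%:R%:E)[EFin \o f])%E.

Lemma LpP N f : (0 < N)%N -> f \in Lfun P N%:R%:E <->
  measurable_fun setT f /\ intg P (fun x => `|f x| ^+ N).
Proof.
move=> N0; split.
- move=> fL; split; first by move: fL; rewrite inE => /andP[]; rewrite !inE.
  have := @Lfun_integrable _ _ _ P f N%:R; rewrite ler1n => /(_ N0 fL).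
  by apply: eq_integrable => // x _; rewrite /= powR_mulrn.
- move=> [mf /integrableP[_ fi]]; rewrite inE; apply/andP; split; rewrite inE//=.
  rewrite /finite_norm unlock; apply: poweR_lty.
  apply: le_lt_trans fi; rewrite le_eqVlt; apply/orP; left; apply/eqP.
  apply: eq_integral => x _ /=.
  by rewrite powR_mulrn// [in RHS]ger0_norm ?exprn_ge0.
Qed.

Lemma Lp_measurable N f : f \in Lfun P N%:R%:E -> measurable_fun setT f.
Proof. by rewrite inE => /andP[]; rewrite !inE. Qed.

Lemma nrm_ge0 N f : 0 <= nrm N f.
Proof. by rewrite /nrm fine_ge0 ?Lnorm_ge0. Qed.

Lemma nrmE N f : f \in Lfun P N%:R%:E ->
  (nrm N f)%:E = ('N[P]_(N%:R%:E)[EFin \o f])%E.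
Proof.
rewrite inE => /andP[_]; rewrite inE/= /finite_norm => fi.
by rewrite fineK// ge0_fin_numE ?Lnorm_ge0.
Qed.

Lemma nrm_pow N f : (0 < N)%N -> f \in Lfun P N%:R%:E ->
  nrm N f ^+ N = \int[P]_x (`|f x| ^+ N).
Proof.
move=> N0 fL; apply: EFin_inj; rewrite EFin_Rint; last by have /LpP[] := fL.
rewrite -[in LHS]powR_mulrn ?nrm_ge0// -poweR_EFin nrmE// powR_Lnorm; last first.
  by rewrite pnatr_eq0 -lt0n.
by apply: eq_integral => x _ /=; rewrite powR_mulrn.
Qed.

Lemma nrm_le N f (c : R) : (0 < N)%N -> 0 <= c -> f \in Lfun P N%:R%:E ->
  (nrm N f <= c) = (\int[P]_x (`|f x| ^+ N) <= c ^+ N).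
Proof.
by move=> N0 c0 fL; rewrite -nrm_pow// ler_pXn2r// ?nnegrE ?nrm_ge0.
Qed.

Lemma Lp_ae N f g : (0 < N)%N -> f \in Lfun P N%:R%:E -> measurable_fun setT g ->
  f = g %[ae P] -> g \in Lfun P N%:R%:E.
Proof.
move=> N0 /LpP[]// mf fi mg fg; apply/LpP => //; split => //.
apply: intg_ae fi.
- by apply: measurable_funX; exact: measurableT_comp.
- by apply: measurable_funX; exact: measurableT_comp.
- by apply: filterS fg => x /(_ I) -> _.
Qed.

Lemma nrm_ae N f g : (0 < N)%N -> measurable_fun setT f -> measurable_fun setT g ->
  f = g %[ae P] -> nrm N f = nrm N g.
Proof.
move=> N0 mf mg fg; rewrite /nrm unlock; apply: (congr1 (fun z => fine (z `^ N%:R^-1)%E)).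
have mp (h : Y -> R) : measurable_fun setT h -> measurable_fun setT (fun x => (`|h x| `^ N%:R)%:E).
  move=> mh; apply/measurable_EFinP; under eq_fun do rewrite powR_mulrn//.
  by apply: measurable_funX; exact: measurableT_comp.
apply: ge0_ae_eq_integral => //=; [exact: mp|exact: mp|].
by apply: filterS fg => x /(_ I) -> _.
Qed.

Lemma LpD N f g : (0 < N)%N -> f \in Lfun P N%:R%:E -> g \in Lfun P N%:R%:E ->
  (fun x => f x + g x) \in Lfun P N%:R%:E.
Proof.
move=> N0 fL gL.
have N1 : (1 <= N%:R%:E :> \bar R)%E by rewrite lee_fin ler1n.
by have [_ /(_ f g)] := Lfun_addr_closed P N1; apply.
Qed.

Lemma nrmD N f g : (0 < N)%N -> f \in Lfun P N%:R%:E -> g \in Lfun P N%:R%:E ->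
  nrm N (fun x => f x + g x) <= nrm N f + nrm N g.
Proof.
move=> N0 fL gL; rewrite -lee_fin EFinD !nrmE//; last exact: LpD.
apply: (@minkowski_EFin _ _ _ P f g N%:R); rewrite ?ler1n//.
- exact: Lp_measurable fL.
- exact: Lp_measurable gL.
Qed.

Lemma LpZ N f a : (0 < N)%N -> f \in Lfun P N%:R%:E ->
  (fun x => a * f x) \in Lfun P N%:R%:E.
Proof.
move=> N0 fL; have := @Lfun_scale _ _ _ P f a N%:R; rewrite ler1n => /(_ N0 fL).
by under eq_fun do rewrite mulrC.
Qed.

Lemma nrmZ N f a : (0 < N)%N -> f \in Lfun P N%:R%:E ->
  nrm N (fun x => a * f x) = `|a| * nrm N f.
Proof.
move=> N0 fL; apply: (@pexpIrn _ N) => //; rewrite ?nnegrE ?nrm_ge0 ?mulr_ge0 ?nrm_ge0//.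
rewrite exprMn !nrm_pow//; last exact: LpZ.
have /LpP[//|_ fi] := fL.
by rewrite -RintZ//; apply: eq_Rintegral => x _; rewrite normrM exprMn.
Qed.

Lemma LpN N f : (0 < N)%N -> f \in Lfun P N%:R%:E ->
  (fun x => - f x) \in Lfun P N%:R%:E.
Proof. by move=> N0 /(LpZ (-1) N0); under eq_fun do rewrite mulN1r. Qed.

Lemma LpB N f g : (0 < N)%N -> f \in Lfun P N%:R%:E -> g \in Lfun P N%:R%:E ->
  (fun x => f x - g x) \in Lfun P N%:R%:E.
Proof. by move=> N0 fL /(LpN N0); exact: LpD. Qed.

Lemma nrmN N f : (0 < N)%N -> f \in Lfun P N%:R%:E ->
  nrm N (fun x => - f x) = nrm N f.
Proof.
move=> N0 fL; have := nrmZ (-1) N0 fL; rewrite normrN1 mul1r => <-.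
by under eq_fun do rewrite -mulN1r.
Qed.

Lemma nrmB N f g : (0 < N)%N -> f \in Lfun P N%:R%:E -> g \in Lfun P N%:R%:E ->
  nrm N (fun x => f x - g x) <= nrm N f + nrm N g.
Proof. by move=> N0 fL gL; rewrite -(nrmN N0 gL) nrmD//; exact: LpN. Qed.

Lemma nrmBC N f g : nrm N (fun x => f x - g x) = nrm N (fun x => g x - f x).
Proof.
rewrite /nrm -[in LHS]oppe_Lnorm; congr (fine (Lnorm _ _ _)).
by apply/funext => x /=; rewrite opprB.
Qed.

Lemma Lp0 N : (0 < N)%N -> (fun=> 0) \in Lfun P N%:R%:E.
Proof.
move=> N0; apply/LpP => //; split => //.
by under eq_fun do rewrite normr0 expr0n (gtn_eqF N0); exact: intg0.
Qed.

Lemma nrm0 N : (0 < N)%N -> nrm N (fun=> 0) = 0.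
Proof.
by move=> N0; have := nrmZ 0 N0 (Lp0 N0); rewrite normr0 !mul0r.
Qed.

Lemma Lp_sum N (I : Type) (s : seq I) (F : I -> Y -> R) : (0 < N)%N ->
  (forall i, F i \in Lfun P N%:R%:E) ->
  (fun x => \sum_(i <- s) F i x) \in Lfun P N%:R%:E.
Proof.
move=> N0 FL; elim: s => [|i s IH].
  by under eq_fun do rewrite big_nil; exact: Lp0.
by under eq_fun do rewrite big_cons; exact: LpD.
Qed.

Lemma nrm_sum N (I : Type) (s : seq I) (F : I -> Y -> R) : (0 < N)%N ->
  (forall i, F i \in Lfun P N%:R%:E) ->
  nrm N (fun x => \sum_(i <- s) F i x) <= \sum_(i <- s) nrm N (F i).
Proof.
move=> N0 FL; elim: s => [|i s IH].
  by under eq_fun do rewrite big_nil; rewrite nrm0// big_nil.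
under eq_fun do rewrite big_cons; rewrite big_cons.
by apply: le_trans (nrmD _ _ _) _ => //; [exact: Lp_sum|rewrite lerD2l].
Qed.

Lemma nrm_dist N f g : (0 < N)%N -> f \in Lfun P N%:R%:E -> g \in Lfun P N%:R%:E ->
  `|nrm N f - nrm N g| <= nrm N (fun x => f x - g x).
Proof.
move=> N0 fL gL.
have H u v : u \in Lfun P N%:R%:E -> v \in Lfun P N%:R%:E ->
    nrm N u - nrm N v <= nrm N (fun x => u x - v x).
  move=> uL vL; rewrite lerBlDr.
  apply: le_trans (nrmD N0 (LpB N0 uL vL) vL).
  by under [in leRHS]eq_fun do rewrite subrK.
rewrite ler_norml H// andbT lerNl opprB nrmBC; exact: H.
Qed.

Lemma nrm_le_ae N f g : (0 < N)%N -> f \in Lfun P N%:R%:E ->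
  measurable_fun setT g -> {ae P, forall x, `|g x| <= `|f x|} ->
  g \in Lfun P N%:R%:E /\ nrm N g <= nrm N f.
Proof.
move=> N0 fL mg gf.
have /LpP[//|mf fi] := fL.
(* Clipping [g] to the interval [-|f|, |f|] makes the a.e. bound hold everywhere, as [intg_le]
   demands, and changes [g] only on a null set. *)
pose h (x : Y) : R := Num.max (- `|f x|) (Num.min (g x) `|f x|).
have mh : measurable_fun setT h.
  apply: measurable_maxr.
    by apply: measurableT_comp => //; exact: measurableT_comp.
  by apply: measurable_minr => //; exact: measurableT_comp.
have hf x : `|h x| <= `|f x|.
  rewrite /h ler_norml le_max lexx/= ge_max.
  by rewrite ge_min lexx orbT andbT (le_trans _ (normr_ge0 (f x)))// oppr_le0.
have hg : h = g %[ae P].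
  apply: filterS gf => x; rewrite ler_norml => /andP[g1 g2] _.
  by rewrite /h min_l// max_r.
have hL : h \in Lfun P N%:R%:E.
  apply/LpP => //; split => //; apply: intg_le fi _.
    by apply: measurable_funX; exact: measurableT_comp.
  by move=> x; rewrite !normrX !normr_id lerXn2r// nnegrE.
split; first exact: (Lp_ae N0 hL).
rewrite -(nrm_ae N0 mh mg hg) nrm_le ?nrm_ge0// nrm_pow//.
have /LpP[//|_ hi] := hL.
by apply: Rint_le => // x; rewrite lerXn2r// nnegrE.
Qed.

End norms.

(** * Hoelder's inequality for finite products *)

Section hoelder_product.
Context d (Y : measurableType d) (R : realType).
Variable P : probability Y R.

(** This is the inequality of arithmetic and geometric means for the numbers [a i ^+ #|I|]. *)
Lemma prod_le_mean_pow (I : finType) (a : I -> R) : (0 < #|I|)%N ->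
  (forall i, 0 <= a i) ->
  \prod_i a i <= (\sum_i a i ^+ #|I|) / #|I|%:R.
Proof.
move=> I0 a0.
have := @leif_AGM R I predT (fun i => a i ^+ #|I|).
rewrite /= (eq_card (B := I))// => H.
have /H[+ _] : {in predT, forall i : I, 0 <= a i ^+ #|I|}.
  by move=> i _; rewrite exprn_ge0.
rewrite -[X in X <= _]/(\prod_(i in predT) _) prodrXl ler_pXn2r//.
- by rewrite nnegrE prodr_ge0.
- by rewrite nnegrE divr_ge0// sumr_ge0// => i _; rewrite exprn_ge0.
Qed.

Lemma nrm_eq0 N (f : Y -> R) : (0 < N)%N -> f \in Lfun P N%:R%:E ->
  nrm P N f = 0 -> f = (fun=> 0) %[ae P].
Proof.
move=> N0 fL f0; have /LpP[//|mf fi] := fL.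
have : \int[P]_x (`|f x| ^+ N) = 0 by rewrite -nrm_pow// f0 expr0n (gtn_eqF N0).
move/(Rint_eq0_ae fi) => H.
have : forall x, 0 <= `|f x| ^+ N by move=> x; rewrite exprn_ge0.
move=> /H; apply: filterS => x /(_ I) /eqP; rewrite expf_eq0 N0/= normr_eq0.
by move=> /eqP.
Qed.

(** Generalized Hoelder inequality: after scaling all factors to norm 1, [prod_le_mean_pow] bounds
    the product pointwise by a mean of powers, whose integral is 1. *)
Lemma hoelder_prod (I : finType) (F : I -> Y -> R) : (0 < #|I|)%N ->
  (forall i, F i \in Lfun P #|I|%:R%:E) ->
  intg P (fun x => \prod_i F i x) /\
  \int[P]_x `|\prod_i F i x| <= \prod_i nrm P #|I| (F i).
Proof.
move=> I0 FL.
have mF i : measurable_fun setT (F i) := Lp_measurable (FL i).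
have mp : measurable_fun setT (fun x => \prod_i F i x).
  by apply: measurable_prod => i _; exact: mF.
have Fi i : intg P (fun x => `|F i x| ^+ #|I|) by have /LpP[] := FL i.
(* The weights [a] are free: all equal to 1 they give integrability, and equal to the norms they
   give the sharp bound. *)
have bnd (a : I -> R) : (forall i, 0 < a i) -> forall x,
    `|\prod_i F i x| <= (\prod_i a i / #|I|%:R) *
       (\sum_i (a i)^-1 ^+ #|I| * `|F i x| ^+ #|I|).
  move=> a0 x; have := @prod_le_mean_pow I (fun i => (a i)^-1 * `|F i x|) I0.
  have a'0 i : 0 <= (a i)^-1 * `|F i x| by rewrite mulr_ge0// invr_ge0 ltW.
  move=> /(_ a'0); rewrite big_split/= prodfV -normr_prod.
  rewrite ler_pdivrMl ?prodr_gt0// => /le_trans; apply.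
  rewrite -mulrA ler_wpM2l ?prodr_ge0// => [i _|]; first exact: ltW.
  by rewrite mulrC; under eq_bigr do rewrite exprMn.
have sumi (a : I -> R) : intg P (fun x => (\prod_i a i / #|I|%:R) *
       (\sum_i (a i)^-1 ^+ #|I| * `|F i x| ^+ #|I|)).
  by apply: intgZ; apply: intg_sum => i; exact: intgZ.
have pI : intg P (fun x => \prod_i F i x).
  apply: intg_le mp (sumi (fun=> 1)) _ => x.
  by apply: le_trans (bnd (fun=> 1) _ x) _ => //; exact: ler_norm.
split => //.
(* The norms can serve as weights only if they are positive; a factor of norm 0 makes the product
   vanish a.e. *)
have [/existsP[j /eqP j0]|/existsPn nz] := boolP [exists j, nrm P #|I| (F j) == 0].
  have := nrm_eq0 I0 (FL j) j0 => Fj.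
  rewrite (@Rint_ae _ _ _ _ _ (fun=> 0)) ?Rintegral_zero//.
  - by apply: prodr_ge0 => i _; exact: nrm_ge0.
  - exact: measurableT_comp.
  - by apply: filterS Fj => x /(_ Logic.I) Fj0 _; rewrite (bigD1 j)//= Fj0 mul0r normr0.
pose a i := nrm P #|I| (F i).
have a0 i : 0 < a i by rewrite lt_neqAle eq_sym nz nrm_ge0.
apply: le_trans (Rint_le (intg_norm pI) (sumi a) (bnd a a0)) _.
rewrite RintZ; last by apply: intg_sum => i; exact: intgZ.
rewrite Rint_sum; last by move=> i; exact: intgZ.
rewrite [X in _ * X](eq_bigr (fun=> 1)); last first.
  move=> i _; rewrite RintZ// -nrm_pow// -exprMn -/(a i) mulVf ?expr1n//.
  by rewrite gt_eqF.
by rewrite sumr_const -mulrA mulVf ?mulr1// pnatr_eq0 -lt0n.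
Qed.

End hoelder_product.

Section probability_norms.
Context d (Y : measurableType d) (R : realType).
Variable P : probability Y R.

Lemma Lp_cst N (c : R) : (0 < N)%N -> (fun=> c) \in Lfun P N%:R%:E.
Proof. by move=> N0; apply/LpP => //; split => //; exact: intg_cst. Qed.

Lemma nrm_cst N (c : R) : (0 < N)%N -> nrm P N (fun=> c) = `|c|.
Proof.
move=> N0; apply: (@pexpIrn _ N) => //; rewrite ?nnegrE ?nrm_ge0//.
by rewrite nrm_pow ?Rint_cst//; exact: Lp_cst.
Qed.

Lemma Lp_bounded N (f : Y -> R) M : (0 < N)%N -> measurable_fun setT f ->
  (forall x, `|f x| <= M) -> f \in Lfun P N%:R%:E.
Proof.
move=> N0 mf fM; apply/LpP => //; split => //.
apply: (@intg_bounded _ _ _ P _ (M ^+ N)).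
  by apply: measurable_funX; exact: measurableT_comp.
move=> x; rewrite normrX normr_id lerXn2r// nnegrE//.
exact: le_trans (fM x).
Qed.

Lemma Lp1_intg (f : Y -> R) : f \in Lfun P 1%:R%:E <-> intg P f.
Proof.
split; first by move=> /Lfun1_integrable.
by move=> ?; apply/Lfun1_integrable.
Qed.

(** Hoelder for [a] copies of [f] and [b] copies of [g], indexed by a disjoint sum. *)
Lemma hoelder_pow2 (a b : nat) (f g : Y -> R) : (0 < a + b)%N ->
  f \in Lfun P (a + b)%:R%:E -> g \in Lfun P (a + b)%:R%:E ->
  intg P (fun x => f x ^+ a * g x ^+ b) /\
  \int[P]_x `|f x ^+ a * g x ^+ b| <= nrm P (a + b) f ^+ a * nrm P (a + b) g ^+ b.
Proof.
move=> ab0 fL gL; pose F (i : 'I_a + 'I_b) := if i is inl _ then f else g.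
have cI : #|{: 'I_a + 'I_b}| = (a + b)%N by rewrite card_sum !card_ord.
have FL i : F i \in Lfun P #|{: 'I_a + 'I_b}|%:R%:E by rewrite cI; case: i.
have [|] := @hoelder_prod _ _ _ P _ F _ FL; rewrite cI//.
rewrite big_sumType/= !prodr_const !card_ord.
have E x : \prod_i F i x = f x ^+ a * g x ^+ b.
  by rewrite big_sumType/= !prodr_const !card_ord.
under eq_fun do rewrite E.
by under eq_Rintegral do rewrite E.
Qed.

(** Hoelder with N - M factors equal to the constant 1. *)
Lemma Lp_incl M N (f : Y -> R) : (0 < M <= N)%N -> f \in Lfun P N%:R%:E ->
  f \in Lfun P M%:R%:E /\ nrm P M f <= nrm P N f.
Proof.
move=> /andP[M0 MN] fL; have N0 : (0 < N)%N by exact: leq_trans MN.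
have := @hoelder_pow2 M (N - M) f (fun=> 1); rewrite subnKC// => H.
have {H} [fi H] := H N0 fL (Lp_cst 1 N0).
have fLM : f \in Lfun P M%:R%:E.
  apply/LpP => //; split; first exact: Lp_measurable fL.
  have := intg_norm fi.
  by under eq_fun do rewrite expr1n mulr1 normrX.
split => //; rewrite nrm_le ?nrm_ge0//.
move: H; rewrite nrm_cst// normr1 expr1n mulr1; apply: le_trans.
rewrite le_eqVlt; apply/orP; left; apply/eqP; apply: eq_Rintegral => x _.
by rewrite mulr1 normrX.
Qed.

Lemma Lp_intg N (f : Y -> R) : (0 < N)%N -> f \in Lfun P N%:R%:E -> intg P f.
Proof. by move=> N0 fL; apply/Lp1_intg; apply: (Lp_incl _ fL).1. Qed.

Lemma Rint_le_nrm1 (f : Y -> R) : intg P f -> \int[P]_x `|f x| = nrm P 1 f.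
Proof.
by move=> /Lp1_intg fL; rewrite -[RHS]expr1 nrm_pow//; under [RHS]eq_Rintegral do rewrite expr1.
Qed.

Lemma L2_mul (f g : Y -> R) : f \in Lfun P 2%:R%:E -> g \in Lfun P 2%:R%:E ->
  intg P (fun x => f x * g x) /\ `|\int[P]_x (f x * g x)| <= nrm P 2 f * nrm P 2 g.
Proof.
move=> fL gL; have [//|//|//|fg H] := @hoelder_pow2 1 1 f g.
split => //; exact: le_trans (Rint_norm fg) H.
Qed.

Lemma nrm2E (f : Y -> R) : f \in Lfun P 2%:R%:E ->
  nrm P 2 f ^+ 2 = \int[P]_x (f x ^+ 2).
Proof.
by move=> fL; rewrite nrm_pow//; apply: eq_Rintegral => x _; rewrite real_normK ?num_real.
Qed.

(** The square of the product has 2m factors, each index being taken twice; Hoelder with exponent 2m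
    applies to it. *)
Lemma hoelder_prod2 (m : nat) (F : 'I_m -> Y -> R) : (0 < m)%N ->
  (forall i, F i \in Lfun P (2 * m)%:R%:E) ->
  (fun x => \prod_i F i x) \in Lfun P 2%:R%:E /\
  nrm P 2 (fun x => \prod_i F i x) <= \prod_i nrm P (2 * m) (F i).
Proof.
move=> m0 FL; pose G (i : 'I_m + 'I_m) := match i with inl j => F j | inr j => F j end.
have cI : #|{: 'I_m + 'I_m}| = (2 * m)%N by rewrite card_sum !card_ord addnn mul2n.
have GL i : G i \in Lfun P #|{: 'I_m + 'I_m}|%:R%:E by rewrite cI; case: i.
have [|] := @hoelder_prod _ _ _ P _ G _ GL; rewrite cI ?muln_gt0//.
rewrite big_sumType/=.
have E x : \prod_i G i x = `|\prod_i F i x| ^+ 2.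
  by rewrite big_sumType/= -expr2 real_normK ?num_real.
under eq_fun do rewrite E.
under eq_Rintegral do rewrite E.
move=> Fi; rewrite -expr2 => H.
have L : (fun x => \prod_i F i x) \in Lfun P 2%:R%:E.
  apply/LpP => //; split => //.
  by apply: measurable_prod => i _; exact: Lp_measurable (FL i).
split => //; rewrite nrm_le//; last by apply: prodr_ge0 => i _; exact: nrm_ge0.
apply: le_trans H; rewrite le_eqVlt; apply/orP; left; apply/eqP.
by apply: eq_Rintegral => x _; rewrite [RHS]ger0_norm ?exprn_ge0.
Qed.

End probability_norms.

(** * Limits, dominated convergence and completeness of L_N *)

Lemma cvgn_le (R : realType) (u : nat -> R) (l b : R) :
  u n @[n --> \oo] --> l -> (forall n, u n <= b) -> l <= b.
Proof.
move=> ul ub; have <- : limn u = l by apply/cvg_lim.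
by apply: limr_le; [apply/cvg_ex; exists l|exact: nearW].
Qed.

Lemma cvgn_ge (R : realType) (u : nat -> R) (l b : R) :
  u n @[n --> \oo] --> l -> (\forall n \near \oo, b <= u n) -> b <= l.
Proof.
move=> ul ub; have <- : limn u = l by apply/cvg_lim.
by apply: limr_ge => //; apply/cvg_ex; exists l.
Qed.

Lemma cvgn_exp (R : realType) (u : nat -> R) (l : R) N :
  u n @[n --> \oo] --> l -> u n ^+ N @[n --> \oo] --> l ^+ N.
Proof.
move=> ul; elim: N => [|N IH]; first by under eq_fun do rewrite expr0; exact: cvg_cst.
by under eq_fun do rewrite exprS; rewrite exprS; exact: cvgM.
Qed.

(** Pointwise limits of functions are taken below as [fine (limn_esup _)]: this is measurable and
    defined everywhere, and it is the limit wherever a real limit exists. *)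
Lemma fine_limn_esup (R : realType) (u : nat -> R) (l : R) :
  u n @[n --> \oo] --> l -> fine (limn_esup (fun n => (u n)%:E)) = l.
Proof.
move=> ul; have H : (u n)%:E @[n --> \oo] --> l%:E by apply: cvg_EFin => //; exact: nearW.
by have [_ ->] := cvg_limn_einf_sup H.
Qed.

Section dominated_integral.
Context d (Y : measurableType d) (R : realType).
Variable P : {measure set Y -> \bar R}.

Lemma Rint_dct (g : nat -> Y -> R) (h b : Y -> R) :
  (forall n, measurable_fun setT (g n)) -> measurable_fun setT h -> intg P b ->
  {ae P, forall x, g n x @[n --> \oo] --> h x} ->
  {ae P, forall x, forall n, `|g n x| <= b x} ->
  intg P h /\ \int[P]_x g n x @[n --> \oo] --> \int[P]_x h x.
Proof.
move=> mg mh bi gh gb.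
have gi n : intg P (g n).
  apply: (@intg_ae _ _ _ P (fun x => Num.max (- `|b x|) (Num.min (g n x) `|b x|))) => //.
  - have mb := intg_measurable bi.
    apply: measurable_maxr; first by apply: measurableT_comp => //; exact: measurableT_comp.
    by apply: measurable_minr => //; exact: measurableT_comp.
  - apply: filterS gb => x /(_ n) gbn _.
    have : `|g n x| <= `|b x| by apply: le_trans gbn _; exact: ler_norm.
    by rewrite ler_norml => /andP[g1 g2]; rewrite min_l// max_r.
  - apply: intg_le (intg_norm bi) _.
      have mb := intg_measurable bi.
      apply: measurable_maxr; first by apply: measurableT_comp => //; exact: measurableT_comp.
      by apply: measurable_minr => //; exact: measurableT_comp.
    move=> x; rewrite normr_id ler_norml le_max lexx/= ge_max.
    by rewrite ge_min lexx orbT andbT (le_trans _ (normr_ge0 (b x)))// oppr_le0.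
have [|||||hi _ H] := @dominated_convergence _ _ _ P setT measurableT
    (fun n => EFin \o g n) (EFin \o h) (EFin \o b).
- by move=> n; exact/measurable_EFinP.
- exact/measurable_EFinP.
- by apply: filterS gh => x gx _; apply: cvg_EFin => //; exact: nearW.
- exact: bi.
- by apply: filterS gb => x gbx n _; rewrite lee_fin.
split => //.
by apply: fine_cvg; rewrite EFin_Rint.
Qed.

End dominated_integral.

Section dominated.
Context d (Y : measurableType d) (R : realType).
Variable P : probability Y R.

Lemma nrm_cvg0 N (g : nat -> Y -> R) : (0 < N)%N ->
  (forall n, g n \in Lfun P N%:R%:E) ->
  \int[P]_x (`|g n x| ^+ N) @[n --> \oo] --> (0:R) ->
  nrm P N (g n) @[n --> \oo] --> (0:R).
Proof.
move=> N0 gL /cvgr0Pnorm_lt H; apply/cvgr0Pnorm_lt => e e0.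
have := H _ (exprn_gt0 N e0); apply: filterS => n.
rewrite ger0_norm; last by apply: Rint_ge0 => x; rewrite exprn_ge0.
by rewrite -nrm_pow// ltr_pXn2r ?nnegrE ?nrm_ge0// ?ltW// ger0_norm ?nrm_ge0.
Qed.

Lemma nrm_dct N (g : nat -> Y -> R) (h b : Y -> R) : (0 < N)%N ->
  (forall n, measurable_fun setT (g n)) -> measurable_fun setT h ->
  b \in Lfun P N%:R%:E ->
  {ae P, forall x, g n x @[n --> \oo] --> h x} ->
  {ae P, forall x, forall n, `|g n x| <= b x} ->
  [/\ forall n, g n \in Lfun P N%:R%:E, h \in Lfun P N%:R%:E &
      nrm P N (fun x => g n x - h x) @[n --> \oo] --> (0:R)].
Proof.
move=> N0 mg mh bL gh gb.
have hb : {ae P, forall x, `|h x| <= b x}.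
  near=> x; have ghx : g n x @[n --> \oo] --> h x by near: x.
  have gbx : forall n, `|g n x| <= b x by near: x.
  by apply: (cvgn_le (cvg_norm ghx)) => n; exact: gbx.
have ghL n : g n \in Lfun P N%:R%:E.
  apply: (nrm_le_ae N0 bL (mg n) _).1; apply: filterS gb => x /(_ n) gbn.
  by apply: le_trans gbn _; exact: ler_norm.
have hL : h \in Lfun P N%:R%:E.
  apply: (nrm_le_ae N0 bL mh _).1; apply: filterS hb => x hbx.
  by apply: le_trans hbx _; exact: ler_norm.
split => //; apply: nrm_cvg0 => //; first by move=> n; exact: LpB.
rewrite -(Rintegral_zero P).
have /LpP[//|mb bi] := bL.
apply: (@Rint_dct _ _ _ P _ _ (fun x => 2 ^+ N * `|b x| ^+ N) _ _ _ _ _).2 => //.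
- by move=> n; apply: measurable_funX; apply: measurableT_comp => //; exact: measurable_funB.
- exact: intgZ.
- near=> x; have ghx : g n x @[n --> \oo] --> h x by near: x.
  rewrite (_ : 0 = `|h x - h x| ^+ N); last first.
    by rewrite subrr normr0 expr0n (gtn_eqF N0).
  apply: cvgn_exp; apply: cvg_norm; apply: cvgB => //; exact: cvg_cst.
- apply: filterS2 gb hb => x gbx hbx n.
  rewrite normrX normr_id -exprMn lerXn2r ?nnegrE// ?mulr_ge0//.
  rewrite mulr_natl mulr2n; apply: le_trans (ler_normB _ _) _.
  by apply: lerD; apply: le_trans (ler_norm _).
Unshelve. all: by end_near. Qed.

Lemma nrm_cvg N (g : nat -> Y -> R) (h : Y -> R) : (0 < N)%N ->
  (forall n, g n \in Lfun P N%:R%:E) -> h \in Lfun P N%:R%:E ->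
  nrm P N (fun x => g n x - h x) @[n --> \oo] --> (0:R) ->
  nrm P N (g n) @[n --> \oo] --> nrm P N h.
Proof.
move=> N0 gL hL /cvgr0Pnorm_lt H; apply/cvgrPdist_lt => e e0.
have := H _ e0; apply: filterS => n; rewrite distrC; apply: le_lt_trans.
by apply: le_trans (nrm_dist N0 (gL n) hL) _; exact: ler_norm.
Qed.

(* Riesz-Fischer *)
Lemma Lp_series_cvg N (v : nat -> Y -> R) (c : R) : (0 < N)%N ->
  (forall k, v k \in Lfun P N%:R%:E) ->
  (forall n, \sum_(0 <= k < n) nrm P N (v k) <= c) ->
  exists h : Y -> R, [/\ h \in Lfun P N%:R%:E, nrm P N h <= c,
    {ae P, forall x, \sum_(0 <= k < n) v k x @[n --> \oo] --> h x} &
    nrm P N (fun x => \sum_(0 <= k < n) v k x - h x) @[n --> \oo] --> (0:R)].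
Proof.
move=> N0 vL vc.
have c0 : 0 <= c by have := vc 0%N; rewrite big_geq.
(* Absolute convergence comes first: the sums [G] of absolute values have N-th moments bounded by
   [c ^+ N], so by monotone convergence their N-th powers have an integrable limit. *)
pose G n (x : Y) : R := \sum_(0 <= k < n) `|v k x|.
have absL (f : Y -> R) : f \in Lfun P N%:R%:E ->
    (fun x => `|f x|) \in Lfun P N%:R%:E /\ nrm P N (fun x => `|f x|) <= nrm P N f.
  move=> fL; apply: (nrm_le_ae N0 fL).
    by apply: measurableT_comp => //; exact: Lp_measurable fL.
  by apply: aeW => x; rewrite normr_id.
have GL n : G n \in Lfun P N%:R%:E by apply: Lp_sum => // i; exact: (absL _ (vL i)).1.
have Gc n : \int[P]_x (`|G n x| ^+ N) <= c ^+ N.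
  rewrite -nrm_le//; apply: le_trans (vc n).
  apply: le_trans (nrm_sum _ N0 _) _; first by move=> i; exact: (absL _ (vL i)).1.
  by apply: ler_sum => i _; exact: (absL _ (vL i)).2.
have G0 n x : 0 <= G n x by apply: sumr_ge0.
have Gnd x : {homo G^~ x : n m / (n <= m)%N >-> n <= m}.
  move=> n m nm; rewrite /G [leRHS](big_cat_nat (n := n))//= lerDl; exact: sumr_ge0.
have mG n : measurable_fun setT (G n) := Lp_measurable (GL n).
pose E n x := (G n x ^+ N)%:E.
have mE n : measurable_fun setT (E n).
  by apply/measurable_EFinP; apply: measurable_funX.
have E0 n x : setT x -> (0 <= E n x)%E by move=> _; rewrite lee_fin exprn_ge0.
have End x : setT x -> {homo E^~ x : n m / (n <= m)%N >-> (n <= m)%E}.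
  by move=> _ n m nm; rewrite lee_fin lerXn2r ?nnegrE// Gnd.
have Ecvg x : cvgn (E^~ x) by apply: ereal_nondecreasing_is_cvgn => n m nm; exact: End.
pose El (x : Y) : \bar R := limn (E^~ x).
have mEl : measurable_fun setT El.
  apply: (emeasurable_fun_cvg E) => // x _; exact: Ecvg.
have El0 x : (0 <= El x)%E by apply: lime_ge => //; apply: nearW => n; exact: E0.
have Eli : P.-integrable setT El.
  apply/integrableP; split => //; apply: (@le_lt_trans _ _ (c ^+ N)%:E); last exact: ltry.
  under eq_integral do rewrite gee0_abs//.
  have H := @cvg_monotone_convergence _ _ _ P setT measurableT E mE E0 End.
  rewrite -(cvg_lim _ H)//; apply: lime_le; first by apply/cvg_ex; eexists; exact: H.
  apply: nearW => n.
  have -> : (\int[P]_x E n x)%E = (\int[P]_x (`|G n x| ^+ N))%:E.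
    rewrite EFin_Rint; last by have /LpP[] := GL n.
    by apply: eq_integral => x _; rewrite /E ger0_norm.
  by rewrite lee_fin.
have Elfin := integrable_ae measurableT Eli.
pose S n x := \sum_(0 <= k < n) v k x.
have SL n : S n \in Lfun P N%:R%:E by apply: Lp_sum.
have mS n : measurable_fun setT (S n) := Lp_measurable (SL n).
pose h x := fine (limn_esup (fun n => (S n x)%:E)).
have mh : measurable_fun setT h.
  apply: measurableT_comp => //; apply: measurable_fun_limn_esup => n.
  exact/measurable_EFinP.
have GN x n : El x \is a fin_num -> G n x ^+ N <= fine (El x).
  move=> fx; rewrite -lee_fin fineK//; apply: lime_ge => //.
  by near=> m; apply: End => //; near: m; exact: nbhs_infty_ge.
have Gcv x : El x \is a fin_num -> cvgn (G^~ x).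
  move=> fx; apply: nondecreasing_is_cvgn; first by move=> n m nm; exact: Gnd.
  exists (1 + fine (El x)) => _ [n _ <-].
  (* Only the N-th power is known to be bounded; above 1 it dominates [G n x] itself. *)
  have [G1|G1] := leP (G n x) 1.
    by apply: le_trans G1 _; rewrite lerDl fine_ge0.
  apply: (@le_trans _ _ (G n x ^+ N)).
    by rewrite -(prednK N0) exprS ler_peMr// exprn_ege1// ltW.
  by apply: le_trans (GN _ _ fx) _; rewrite lerDr.
have Sh x : El x \is a fin_num -> S n x @[n --> \oo] --> h x.
  move=> fx; move: (Gcv x fx) => /(@normed_cvg R R^o (fun k => v k x)) Sc.
  by rewrite /h (fine_limn_esup (l := limn (S^~ x))).
have Scv : {ae P, forall x, S n x @[n --> \oo] --> h x}.
  by apply: filterS Elfin => x fx; apply: Sh; exact: fx.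
(* The full sum of absolute values lies in L_N and dominates all partial sums, so dominated
   convergence turns convergence a.e. into convergence in norm. *)
pose g x := limn_esup (fun n => (G n x)%:E).
have bL : (fun x => fine (g x)) \in Lfun P N%:R%:E /\
   {ae P, forall x n, G n x <= fine (g x)}.
  have mg : measurable_fun setT (fun x => fine (g x)).
    apply: measurableT_comp => //; apply: measurable_fun_limn_esup => n.
    exact/measurable_EFinP.
  have Gg x : El x \is a fin_num -> G n x @[n --> \oo] --> fine (g x).
    move=> /Gcv Gc'.
    by rewrite /g (fine_limn_esup (l := limn (G^~ x))).
  split.
    apply/LpP => //; split => //.
    apply: (@intg_ae _ _ _ P (fine \o El)).
    - exact: measurableT_comp.
    - by apply: measurable_funX; exact: measurableT_comp.
    - apply: filterS Elfin => x /(_ Logic.I) fx _ /=.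
      have H1 : G n x ^+ N @[n --> \oo] --> `|fine (g x)| ^+ N.
        apply: cvgn_exp; rewrite -(_ : (fun n => `|G n x|) = G^~ x).
          by apply: cvg_norm; exact: Gg.
        by apply/funext => n; rewrite ger0_norm.
      have H2 : G n x ^+ N @[n --> \oo] --> fine (El x).
        by apply: (@fine_cvg _ _ _ _ (E^~ x)); rewrite fineK//; exact: Ecvg.
      by rewrite -(cvg_lim _ H1)// -(cvg_lim _ H2).
    - apply: (le_integrable measurableT _ _ Eli).
        by apply/measurable_EFinP; exact: measurableT_comp.
      by move=> x _ /=; case: (El x) => [r||]//=; rewrite leey.
  apply: filterS Elfin => x /(_ Logic.I) fx n.
  apply: (cvgn_ge (Gg _ fx)).
  by near=> m; apply: Gnd; near: m; exact: nbhs_infty_ge.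
have [gL Ggb] := bL.
have Sb : {ae P, forall x, forall n, `|S n x| <= fine (g x)}.
  apply: filterS Ggb => x H n; apply: le_trans (H n); exact: ler_norm_sum.
have [_ hL Sh0] := nrm_dct N0 mS mh gL Scv Sb.
exists h; split => //.
apply: (cvgn_le (nrm_cvg N0 SL hL Sh0)) => n.
exact: le_trans (nrm_sum _ N0 vL) (vc n).
Unshelve. all: by end_near. Qed.

End dominated.

(** * Countable partitions and the duality relation *)

Section discretization.
Context d (Y : measurableType d) (R : realType).
Implicit Types (q : Y -> nat) (y : Y -> R).

(** A map to the natural numbers with measurable fibres encodes a countable measurable partition;
    every function of the label is then measurable. *)
Definition fibre_measurable q := forall a : nat, measurable (q @^-1` [set a]).

Lemma fibre_measurable_preimage q (B : set nat) : fibre_measurable q ->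
  measurable (q @^-1` B).
Proof.
move=> mq; rewrite (_ : q @^-1` B = \bigcup_(a in B) q @^-1` [set a]).
  by apply: bigcup_measurable => a _; exact: mq.
by apply/seteqP; split => [x Bx|x [a Ba /= qa]]; [exists (q x)|rewrite /= qa].
Qed.

Lemma fibre_measurable_comp q (c : nat -> R) : fibre_measurable q ->
  measurable_fun setT (c \o q).
Proof.
by move=> mq _ B mB; rewrite setTI comp_preimage; exact: fibre_measurable_preimage.
Qed.

Lemma discretize y (e : R) : 0 < e -> measurable_fun setT y ->
  exists q (c : nat -> R), fibre_measurable q /\ forall x, `|y x - c (q x)| <= e.
Proof.
move=> e0 my.
(* The cells are the level sets of the integer floor of [y x / e], coded as a natural number by
   [pickle]; the default 0 in [c] concerns codes that [q] does not attain. *)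
pose q x : nat := pickle (Num.floor (y x / e)).
pose c (n : nat) : R := (odflt 0 (unpickle n : option int))%:~R * e.
exists q, c; split.
  move=> a; case E : (unpickle a : option int) => [k|]; last first.
    rewrite (_ : _ @^-1` _ = set0)//; apply/seteqP; split => // x /= qx.
    by move: E; rewrite -qx /q pickleK.
  have [ka|ka] := eqVneq (pickle k) a; last first.
    rewrite (_ : _ @^-1` _ = set0)//; apply/seteqP; split => // x /= qx.
    move: E ka; rewrite -qx /q pickleK => -[<-]; by rewrite eqxx.
  rewrite (_ : _ @^-1` _ = setT `&` (fun x => y x / e) @^-1` `[k%:~R, (k + 1)%:~R[).
    by apply: measurable_funM => //; exact: measurable_itv.
  apply/seteqP; split => x /=; rewrite in_itv/=.
    move=> qx; split=> //; have : Num.floor (y x / e) = k.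
      by apply: (pcan_inj pickleK); rewrite -/(q x) qx ka.
    by move=> <-; exact: floor_itv.
  move=> [_ H]; rewrite -ka /q; congr pickle; exact: floor_def.
move=> x; rewrite /c /q pickleK/=.
have /andP[H1 H2] := floor_itv (y x / e).
rewrite -[X in `|X - _|](divfK (lt0r_neq0 e0)) -mulrBl normrM (gtr0_norm e0).
rewrite ler_piMl ?ltW// ger0_norm ?subr_ge0//.
by rewrite ltrBlDl; move: H2; rewrite intrD.
Qed.

End discretization.

Section duality.
Context d (Y : measurableType d) (R : realType).
Variable P : probability Y R.
Variable S : Y -> Y.
Hypothesis mS : measurable_fun setT S.
Implicit Types (f g h : Y -> R).

(** Indicators determine the duality with bounded functions: [h] is uniformly close to the countably
    valued [c \o q], which is the bounded pointwise limit of finite combinations [sK] of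
    indicators. *)
Lemma dual_indic_bounded f g : intg P f -> intg P g ->
  (forall A, measurable A ->
     \int[P]_x (g x * \1_A x) = \int[P]_x (f x * \1_A (S x))) ->
  forall h (M : R), measurable_fun setT h -> (forall x, `|h x| <= M) ->
  \int[P]_x (g x * h x) = \int[P]_x (f x * h (S x)).
Proof.
move=> fi gi fg h M mh hM.
have mf := intg_measurable fi; have mg := intg_measurable gi.
apply/eqP; rewrite -subr_eq0 -normr_le0; apply/ler_addgt0Pl => e e0; rewrite addr0.
(* Replacing [h] by a function within e / C costs at most e / C times the two L_1 norms, hence at
   most e; the summand 1 keeps [C] positive. *)
pose C := \int[P]_x `|g x| + \int[P]_x `|f x| + 1.
have C0 : 0 < C by rewrite ltr_wpDl// addr_ge0// Rint_ge0.
have [q [c [mq qc]]] := discretize (divr_gt0 e0 C0) mh.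
set e' := e / C in qc.
have ms : measurable_fun setT (c \o q) := fibre_measurable_comp c mq.
have sM x : `|c (q x)| <= M + e'.
  have -> : c (q x) = h x - (h x - c (q x)) by rewrite subKr.
  by apply: le_trans (ler_normB _ _) _; apply: lerD.
pose sK K x := \sum_(i < K) c i * \1_(q @^-1` [set (i : nat)]) x.
have sKE K x : sK K x = if (q x < K)%N then c (q x) else 0.
  rewrite /sK; case: ltnP => qK.
    rewrite (bigD1 (Ordinal qK))//= big1 ?addr0.
      by rewrite indicE mem_set ?mulr1.
    move=> i /eqP iq; rewrite indicE memNset ?mulr0//= => qi; apply: iq.
    exact: val_inj.
  rewrite big1// => i _; rewrite indicE memNset ?mulr0//= => qi.
  by have := ltn_ord i; rewrite -qi ltnNge qK.
have sKM K x : `|sK K x| <= M + e'.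
  by rewrite sKE; case: ifP => // _; rewrite normr0 (le_trans (normr_ge0 (c (q x)))).
have sKcv x : sK K x @[K --> \oo] --> c (q x).
  by apply: cvg_near_cst; exists (q x).+1 => // K /= qK; rewrite sKE ifT.
have msK K : measurable_fun setT (sK K).
  by apply: measurable_sum => i; apply: measurable_funM => //; exact: measurable_indic.
have lim (u : Y -> R) (W : Y -> Y) : intg P u -> measurable_fun setT W ->
   \int[P]_x (u x * sK K (W x)) @[K --> \oo] --> \int[P]_x (u x * c (q (W x))).
  move=> ui mW; have mu := intg_measurable ui.
  apply: (@Rint_dct _ _ _ P _ _ (fun x => (M + e') * `|u x|) _ _ _ _ _).2.
  - by move=> K; apply: measurable_funM => //; exact: measurableT_comp.
  - apply: measurable_funM => //; exact: (measurableT_comp ms).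
  - by apply: intgZ; exact: intg_norm.
  - by apply: aeW => x; apply: cvgMl_tmp; exact: sKcv.
  - by apply: aeW => x K; rewrite normrM mulrC ler_wpM2r.
have sKfg K : \int[P]_x (g x * sK K x) = \int[P]_x (f x * sK K (S x)).
  rewrite /sK.
  under eq_Rintegral do rewrite mulr_sumr.
  under [RHS]eq_Rintegral do rewrite mulr_sumr.
  have M1 A x : `|\1_A x : R| <= 1 by rewrite indicE; case: (_ \in _); rewrite ?normr1 ?normr0.
  have igA (u : Y -> R) (W : Y -> Y) A : intg P u -> measurable_fun setT W -> measurable A ->
      intg P (fun x => u x * (\1_A (W x))).
    move=> ui mW mA; apply: (intgM_bounded ui (M := 1)) => //.
    by apply: (measurableT_comp (measurable_indic mA)).
  rewrite !Rint_sum.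
  - apply: eq_bigr => i _.
    under eq_Rintegral do rewrite mulrCA.
    under [RHS]eq_Rintegral do rewrite mulrCA.
    have mA : measurable (q @^-1` [set (i : nat)]) by exact: mq.
    rewrite RintZ; last exact: (igA g id).
    by rewrite RintZ ?fg//; exact: igA.
  - move=> i; under eq_fun do rewrite mulrCA.
    by apply: intgZ; apply: igA.
  - move=> i; under eq_fun do rewrite mulrCA.
    by apply: intgZ; apply: (igA g id).
have sfg : \int[P]_x (g x * c (q x)) = \int[P]_x (f x * c (q (S x))).
  have H1 := lim g id gi (@measurable_id _ _ setT).
  have H2 := lim f S fi mS.
  apply: (cvg_unique _ H1) => //.
  by rewrite (_ : (fun K => _) = (fun K => \int[P]_x (f x * sK K (S x)))); [|exact/funext].
have bnd (u : Y -> R) (W : Y -> Y) : intg P u -> measurable_fun setT W ->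
   `|\int[P]_x (u x * h (W x)) - \int[P]_x (u x * c (q (W x)))| <= e' * \int[P]_x `|u x|.
  move=> ui mW.
  have i1 : intg P (fun x => u x * h (W x)).
    by apply: (intgM_bounded ui (M := M)) => //; exact: measurableT_comp.
  have i2 : intg P (fun x => u x * c (q (W x))).
    by apply: (intgM_bounded ui (M := M + e')) => //; exact: (measurableT_comp ms).
  rewrite -RintB// -RintZ; last exact: intg_norm.
  apply: le_trans (Rint_norm _) _; first exact: intgB.
  apply: Rint_le; [by apply: intg_norm; exact: intgB|by apply: intgZ; exact: intg_norm|].
  by move=> x; rewrite -mulrBr normrM mulrC ler_wpM2r.
have H1 := bnd g id gi (@measurable_id _ _ setT); have H2 := bnd f S fi mS.
rewrite -sfg distrC in H2.
apply: le_trans (ler_distD (\int[P]_x (g x * c (q x))) _ _) _.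
apply: le_trans (lerD H1 H2) _; rewrite -mulrDr /e' mulrAC ler_pdivrMr//.
by rewrite ler_pM2l// lerDl.
Qed.

End duality.

(** * The preadjoint of a measure preserving map *)

Section measure_preserving_integral.
Context d (Y : measurableType d) (R : realType).
Variable P : probability Y R.
Variable S : Y -> Y.
Hypothesis mpS : measure_preserving P S.
Implicit Types (f g h : Y -> R).

Let mS : measurable_fun setT S := mpS.1.

Lemma mp_ge0_integral (f : Y -> \bar R) : measurable_fun setT f ->
  (forall x, (0 <= f x)%E) -> (\int[P]_x f (S x) = \int[P]_x f x)%E.
Proof.
move=> mf f0.
have H := @ge0_integral_pushforward _ _ _ _ R S mS P setT f measurableT mf.
rewrite preimage_setT in H.
rewrite -[LHS]H//; apply: eq_measure_integral => A mA _.
exact: mpS.2.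
Qed.

Lemma mp_intg f : intg P f -> intg P (fun x => f (S x)).
Proof.
move=> fi; have mf := intg_measurable fi.
apply/integrableP; split; first by apply/measurable_EFinP; exact: measurableT_comp.
have /integrableP[_] := fi.
rewrite -(@mp_ge0_integral (fun x => `|(f x)%:E|)%E)//.
by apply/measurable_EFinP; exact: measurableT_comp.
Qed.

Lemma mp_Rint f : intg P f -> \int[P]_x f (S x) = \int[P]_x f x.
Proof.
move=> fi; have mf := intg_measurable fi.
have pos g : intg P g -> (forall x, 0 <= g x) -> \int[P]_x g (S x) = \int[P]_x g x.
  move=> gi g0; congr fine; apply: (mp_ge0_integral (f := EFin \o g)).
    by apply/measurable_EFinP; exact: intg_measurable gi.
  by move=> x; rewrite lee_fin.
(* The formula is known for nonnegative functions, and [f] is a difference of two integrable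
   ones. *)
have E x : f x = (`|f x| + f x) - `|f x| by rewrite addrAC subrr add0r.
under eq_Rintegral do rewrite E.
under [RHS]eq_Rintegral do rewrite E.
have i1 := intg_norm fi; have i2 := intgD i1 fi.
rewrite !RintB//; [|exact: (@mp_intg (fun x => `|f x| + f x))|exact: (@mp_intg (fun x => `|f x|))].
rewrite (pos (fun x => `|f x|))// (pos (fun x => `|f x| + f x))// => x.
by rewrite -lerBlDr sub0r; apply: le_trans (ler_norm _) _; rewrite normrN.
Qed.

Lemma mp_Lp N f : (0 < N)%N -> f \in Lfun P N%:R%:E ->
  (fun x => f (S x)) \in Lfun P N%:R%:E /\ nrm P N (fun x => f (S x)) = nrm P N f.
Proof.
move=> N0 fL; have /LpP[//|mf fi] := fL.
have L : (fun x => f (S x)) \in Lfun P N%:R%:E.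
  apply/LpP => //; split; first exact: measurableT_comp.
  exact: (mp_intg fi).
split => //; apply: (@pexpIrn _ N) => //; rewrite ?nnegrE ?nrm_ge0//.
by rewrite !nrm_pow// (mp_Rint fi).
Qed.

Lemma mp_ae (Q : Y -> Prop) : {ae P, forall x, Q x} -> {ae P, forall x, Q (S x)}.
Proof.
move=> [A [mA A0 QA]]; exists (S @^-1` A); split.
- by rewrite -[X in measurable X]setTI; exact: mS.
- by rewrite mpS.2.
- by move=> x /= nQ; apply: QA.
Qed.

End measure_preserving_integral.

Lemma mp_id d (Y : measurableType d) (R : realType) (P : probability Y R) :
  measure_preserving P id.
Proof. by split => //; exact: measurable_id. Qed.

Lemma mp_comp d (Y : measurableType d) (R : realType) (P : probability Y R) S1 S2 :
  measure_preserving P S1 -> measure_preserving P S2 ->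
  measure_preserving P (S1 \o S2).
Proof.
move=> [m1 p1] [m2 p2]; split; first exact: measurableT_comp.
move=> A mA; rewrite comp_preimage p2 ?p1//.
by rewrite -[X in measurable X]setTI; exact: m1.
Qed.

Lemma mp_iter d (Y : measurableType d) (R : realType) (P : probability Y R) S n :
  measure_preserving P S -> measure_preserving P (iter n S).
Proof.
move=> mpS; elim: n => [|n IH]; first exact: mp_id.
exact: (mp_comp mpS IH).
Qed.

Section preadjoint.
Context d (Y : measurableType d) (R : realType).
Variable P : probability Y R.
Implicit Types (S : Y -> Y) (f g h : Y -> R).

(** This is [is_koopman_preadjoint] for an arbitrary map S; with [S := pow_map T k] the two unfold
    to the same term, so one theory serves X and all its powers. *)
Definition is_adj S f g : Prop :=
  g \in Lfun P 1%E /\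
  forall h, h \in Lfun P +oo%E ->
    \int[P]_x (g x * h x) = \int[P]_x (f x * h (S x)).

Definition adj S f : Y -> R := xget (fun _ => 0) [set g | is_adj S f g].

Lemma bounded_Linfty h M : measurable_fun setT h -> (forall x, `|h x| <= M) ->
  h \in Lfun P +oo%E.
Proof.
move=> mh hM; rewrite inE; apply/andP; split; rewrite inE//=.
rewrite /finite_norm unlock; case: ifP => // _.
apply: (@le_lt_trans _ _ M%:E); last exact: ltry.
by apply/ess_supP; apply: nearW => x /=; rewrite lee_fin.
Qed.

Lemma Linfty_bounded h : h \in Lfun P +oo%E ->
  measurable_fun setT h /\ exists M, {ae P, forall x, `|h x| <= M}.
Proof.
rewrite inE => /andP[]; rewrite !inE/= => mh; split => //; move: b.
rewrite /finite_norm unlock ifT; last first.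
  have PT : (0 < P setT)%E by rewrite probability_setT lte01.
  exact: PT.
move=> H; apply: (ess_supr_bounded (f := fun x => `|h x|)).
by rewrite (_ : EFin \o _ = (abse \o (EFin \o h))%E).
Qed.

Variable S : Y -> Y.
Hypothesis mpS : measure_preserving P S.
Let mS : measurable_fun setT S := mpS.1.

(** Essentially bounded test functions reduce to bounded ones by clipping, because S pulls null sets
    back to null sets. *)
Lemma is_adj_bounded f g : intg P f -> intg P g ->
  (forall h M, measurable_fun setT h -> (forall x, `|h x| <= M) ->
    \int[P]_x (g x * h x) = \int[P]_x (f x * h (S x))) -> is_adj S f g.
Proof.
move=> fi gi H; split; first exact/Lp1_intg.
move=> h /Linfty_bounded[mh [M hM]].
pose h' (x : Y) : R := Num.max (- `|M|) (Num.min (h x) `|M|).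
have mh' : measurable_fun setT h' by apply: measurable_maxr => //; exact: measurable_minr.
have h'M x : `|h' x| <= `|M|.
  by rewrite /h' ler_norml le_max lexx/= ge_max ge_min lexx orbT andbT (le_trans _ (normr_ge0 M))// oppr_le0.
have hh' : {ae P, forall x, h x = h' x}.
  apply: filterS hM => x hxM.
  have : `|h x| <= `|M| by apply: le_trans hxM _; exact: ler_norm.
  by rewrite /h' ler_norml => /andP[g1 g2]; rewrite min_l// max_r.
have mf := intg_measurable fi; have mg := intg_measurable gi.
rewrite (@Rint_ae _ _ _ P _ (fun x => g x * h' x)).
- rewrite (H _ _ mh' h'M); apply: Rint_ae.
  + by apply: measurable_funM => //; exact: (measurableT_comp mh').
  + by apply: measurable_funM => //; exact: (measurableT_comp mh).
  + by apply: filterS (mp_ae mpS hh') => x ->.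
- exact: measurable_funM.
- exact: measurable_funM.
- by apply: filterS hh' => x ->.
Qed.

Lemma is_adj_unique f g g' : is_adj S f g -> is_adj S f g' -> g = g' %[ae P].
Proof.
move=> [/Lp1_intg gi Hg] [/Lp1_intg g'i Hg'].
have mg := intg_measurable gi; have mg' := intg_measurable g'i.
have /measurable_EFinP mg'' := mg'.
suff H : forall E, E `<=` setT -> measurable E ->
    (\int[P]_(x in E) (EFin \o g) x = \int[P]_(x in E) (EFin \o g') x)%E.
  have := @integral_ae_eq _ _ _ P setT measurableT (EFin \o g') (EFin \o g) gi mg'' H.
  by apply: filterS => x /(_ I) [->].
move=> E _ mE.
have E1 (u : Y -> R) : intg P u -> (\int[P]_(x in E) (EFin \o u) x)%E = (\int[P]_x (u x * \1_E x))%:E.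
  move=> ui; rewrite EFin_Rint.
    rewrite [LHS]integral_mkcond; apply: eq_integral => x _ /=.
    by rewrite /patch indicE; case: (x \in E); rewrite ?mulr1 ?mulr0.
  apply: (intgM_bounded ui (M := 1)); first exact: measurable_indic.
  by move=> x; rewrite indicE; case: (_ \in _); rewrite ?normr1 ?normr0.
have L : \1_E \in Lfun P +oo%E.
  apply: (@bounded_Linfty _ 1); first exact: measurable_indic.
  by move=> x; rewrite indicE; case: (_ \in _); rewrite ?normr1 ?normr0.
by rewrite !E1// Hg// Hg'.
Qed.

(** The preadjoint is the Radon-Nikodym derivative of the image under S of the charge f dP; this
    image is absolutely continuous because S preserves P. *)
Lemma is_adj_exists f : intg P f -> exists g, is_adj S f g.
Proof.
move=> fi.
pose nu0 : {charge set Y -> \bar R} := pushforward (induced_charge fi) S.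
pose nu := nu0 mS.
have nuP : nu `<< P.
  apply/null_content_dominatesP => A mA PA.
  rewrite /nu /nu0 /pushforward/= /induced_charge.
  apply: null_set_integral.
  - by rewrite -[X in measurable X]setTI; exact: mS.
  - by apply: measurable_funTS; apply/measurable_EFinP; exact: intg_measurable fi.
  - exact: etrans (mpS.2 A mA) PA.
pose g x := fine (Radon_Nikodym nu P x).
have gfin x := Radon_Nikodym_fin_num x nuP.
have gE x : (g x)%:E = Radon_Nikodym nu P x by rewrite fineK.
have gi : intg P g.
  rewrite /intg (_ : _ \o _ = Radon_Nikodym nu P); last exact/funext.
  exact: Radon_Nikodym_integrable.
exists g; apply: is_adj_bounded => //; apply: dual_indic_bounded => // A mA.
congr fine.
transitivity (\int[P]_(x in A) Radon_Nikodym nu P x)%E.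
  rewrite [RHS]integral_mkcond; apply: eq_integral => x _.
  rewrite /patch indicE; case: ifP => _; rewrite ?mulr1 ?mulr0//.
rewrite -Radon_Nikodym_integral// /nu /nu0/= /pushforward /induced_charge.
rewrite [LHS]integral_mkcond; apply: eq_integral => x _.
rewrite /patch indicE; case: ifP => H; move: (H).
  by rewrite inE /= => ?; rewrite mem_set ?mulr1.
by move/negbT; rewrite notin_setE => ?; rewrite memNset ?mulr0.
Qed.

Lemma adjP f : intg P f -> is_adj S f (adj S f).
Proof.
move=> /is_adj_exists[g gP]; rewrite /adj.
by case: xgetP => [h -> //|/(_ g)/(_ gP)].
Qed.

Lemma adj_intg f : intg P f -> intg P (adj S f).
Proof. by move=> /adjP[/Lp1_intg]. Qed.

Lemma adj_dual f h M : intg P f -> measurable_fun setT h ->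
  (forall x, `|h x| <= M) ->
  \int[P]_x (adj S f x * h x) = \int[P]_x (f x * h (S x)).
Proof. by move=> /adjP[_ H] mh hM; apply: H; exact: bounded_Linfty hM. Qed.

Lemma adj_unique f g : intg P f -> intg P g ->
  (forall h M, measurable_fun setT h -> (forall x, `|h x| <= M) ->
    \int[P]_x (g x * h x) = \int[P]_x (f x * h (S x))) -> adj S f = g %[ae P].
Proof.
move=> fi gi H; apply: is_adj_unique (adjP fi) _; exact: is_adj_bounded.
Qed.

End preadjoint.

(** * Fatou's lemma in L_N and the calculus of the preadjoint *)

Section fatou_norm.
Context d (Y : measurableType d) (R : realType).
Variable P : probability Y R.

Lemma limn_einf_le (u : nat -> \bar R) (c : \bar R) :
  (forall n, (u n <= c)%E) -> (limn_einf u <= c)%E.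
Proof.
move=> uc; rewrite limn_einf_lim; apply: lime_le; first exact: is_cvg_einfs.
apply: nearW => n; apply: le_trans (uc n).
by apply: ereal_inf_lbound; exists n => /=.
Qed.

(** Fatou's lemma for [|g n| ^+ N]: a norm bound survives a limit a.e. without any domination. *)
Lemma Lp_fatou N (g : nat -> Y -> R) (h : Y -> R) (b : R) : (0 < N)%N -> 0 <= b ->
  (forall n, g n \in Lfun P N%:R%:E) -> measurable_fun setT h ->
  {ae P, forall x, g n x @[n --> \oo] --> h x} ->
  (forall n, nrm P N (g n) <= b) -> h \in Lfun P N%:R%:E /\ nrm P N h <= b.
Proof.
move=> N0 b0 gL mh gh gb.
have mg n : measurable_fun setT (g n) := Lp_measurable (gL n).
pose G n x := (`|g n x| ^+ N)%:E.
have mG n : measurable_fun setT (G n).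
  by apply/measurable_EFinP; apply: measurable_funX; exact: measurableT_comp.
have mH : measurable_fun setT (fun x => (`|h x| ^+ N)%:E).
  by apply/measurable_EFinP; apply: measurable_funX; exact: measurableT_comp.
have H : (\int[P]_x (`|h x| ^+ N)%:E <= (b ^+ N)%:E)%E.
  have -> : (\int[P]_x (`|h x| ^+ N)%:E = \int[P]_x limn_einf (G^~ x))%E.
    apply: ge0_ae_eq_integral => //.
    - apply: measurableT_comp => //; apply: measurable_fun_limn_esup => n.
      exact: measurableT_comp.
    - move=> x _; rewrite limn_einf_lim; apply: lime_ge; first exact: is_cvg_einfs.
      by apply: nearW => n; apply: le_ereal_inf_tmp => _ [m _ <-]; rewrite lee_fin exprn_ge0.
    - apply: filterS gh => x ghx _.
      have H : G n x @[n --> \oo] --> (`|h x| ^+ N)%:E.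
        apply: cvg_EFin; first exact: nearW.
        by apply: cvgn_exp; apply: cvg_norm.
      by have [-> _] := cvg_limn_einf_sup H.
  apply: le_trans (fatou _ _ _ _) _ => //.
    by move=> n x _; rewrite lee_fin exprn_ge0.
  apply: limn_einf_le => n.
  rewrite -EFin_Rint; last by have /LpP[] := gL n.
  by rewrite lee_fin -nrm_pow// lerXn2r ?nnegrE ?nrm_ge0.
have hL : h \in Lfun P N%:R%:E.
  apply/LpP => //; split => //; apply/integrableP; split => //.
  apply: le_lt_trans (ltry (b ^+ N)); apply: le_trans H.
  by under eq_integral do rewrite /= ger0_norm ?exprn_ge0//.
split => //; rewrite nrm_le// -lee_fin EFin_Rint//.
by have /LpP[] := hL.
Qed.

End fatou_norm.

Section preadjoint_theory.
Context d (Y : measurableType d) (R : realType).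
Variable P : probability Y R.
Variable S : Y -> Y.
Hypothesis mpS : measure_preserving P S.
Let mS : measurable_fun setT S := mpS.1.
Implicit Types (f g h : Y -> R).

Lemma intg_mul_comp f h M : intg P f -> measurable_fun setT h ->
  (forall x, `|h x| <= M) -> intg P (fun x => f x * h (S x)).
Proof.
move=> fi mh hM; apply: (intgM_bounded fi (M := M)) => //.
exact: (measurableT_comp mh).
Qed.

Lemma adj_lin a b f f' : intg P f -> intg P f' ->
  adj P S (fun x => a * f x + b * f' x) =
    (fun x => a * adj P S f x + b * adj P S f' x) %[ae P].
Proof.
move=> fi f'i; have gi := adj_intg mpS fi; have g'i := adj_intg mpS f'i.
apply: adj_unique => //.
- by apply: intgD; exact: intgZ.
- by apply: intgD; exact: intgZ.
move=> h M mh hM.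
have E (c c' u v w : R) : (c * u + c' * v) * w = c * (u * w) + c' * (v * w) by ring.
under eq_Rintegral do rewrite E.
under [RHS]eq_Rintegral do rewrite E.
have i1 := intgM_bounded gi mh hM; have i2 := intgM_bounded g'i mh hM.
have i3 := intg_mul_comp fi mh hM; have i4 := intg_mul_comp f'i mh hM.
rewrite RintD ?RintZ//; [|exact: intgZ|exact: intgZ].
rewrite RintD ?RintZ//; [|exact: intgZ|exact: intgZ].
by rewrite (adj_dual _ _ mh hM)// (adj_dual _ _ mh hM).
Qed.

Lemma adjD f f' : intg P f -> intg P f' ->
  adj P S (fun x => f x + f' x) = (fun x => adj P S f x + adj P S f' x) %[ae P].
Proof.
move=> fi f'i; have := adj_lin 1 1 fi f'i.
rewrite (_ : (fun x => 1 * f x + 1 * f' x) = (fun x => f x + f' x)); last first.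
  by apply/funext => x; rewrite !mul1r.
by apply: filterS => x /(_ I) ->; rewrite !mul1r.
Qed.

Lemma adjB f f' : intg P f -> intg P f' ->
  adj P S (fun x => f x - f' x) = (fun x => adj P S f x - adj P S f' x) %[ae P].
Proof.
move=> fi f'i; have := adj_lin 1 (-1) fi f'i.
rewrite (_ : (fun x => 1 * f x + -1 * f' x) = (fun x => f x - f' x)); last first.
  by apply/funext => x; rewrite mul1r mulN1r.
by apply: filterS => x /(_ I) ->; rewrite mul1r mulN1r.
Qed.

Lemma adj0 : adj P S (fun=> 0) = (fun=> 0) %[ae P].
Proof.
apply: adj_unique => //; try exact: intg0.
by move=> h M _ _; apply: eq_Rintegral => x _; rewrite !mul0r.
Qed.

Lemma adj_sum (I : Type) (s : seq I) (F : I -> Y -> R) : (forall i, intg P (F i)) ->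
  adj P S (fun x => \sum_(i <- s) F i x) =
    (fun x => \sum_(i <- s) adj P S (F i) x) %[ae P].
Proof.
move=> Fi; elim: s => [|i s IH].
  rewrite (_ : (fun x => \sum_(i <- [::]) F i x) = (fun=> 0)); last first.
    by apply/funext => x; rewrite big_nil.
  by apply: filterS adj0 => x /(_ Logic.I) ->; rewrite big_nil.
rewrite (_ : (fun x => \sum_(j <- i :: s) F j x) = (fun x => F i x + \sum_(j <- s) F j x)); last first.
  by apply/funext => x; rewrite big_cons.
have := adjD (Fi i) (intg_sum s Fi).
by apply: filterS2 IH => x /(_ Logic.I) H /(_ Logic.I) ->; rewrite H big_cons.
Qed.

(** Duality: testing g = V^* f against sign(g) |g|^(N-1) gives |g|_N^N <= |f|_N |g|_N^(N-1), since V
    preserves norms. *)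
Lemma adj_Lp N f : (0 < N)%N -> f \in Lfun P N%:R%:E ->
  adj P S f \in Lfun P N%:R%:E /\ nrm P N (adj P S f) <= nrm P N f.
Proof.
move=> N0 fL; have fi := Lp_intg N0 fL; set g := adj P S f.
have gi : intg P g := adj_intg mpS fi.
have mg := intg_measurable gi.
(* So far [g] is only integrable. The argument runs on the truncations [gn], whose norms are finite
   and can be cancelled; Fatou removes the truncation. *)
pose t (n : nat) (x : Y) : R := if `|g x| <= n%:R then 1 else 0.
have mt n : measurable_fun setT (t n).
  apply: measurable_fun_ifT => //; apply: measurable_fun_ler => //.
  exact: measurableT_comp.
have t01 n x : 0 <= t n x <= 1 by rewrite /t; case: ifP => _; rewrite ?lexx ler01.
have tE n x : t n x ^+ N = t n x.
  by rewrite /t; case: ifP => _; rewrite ?expr1n// expr0n (gtn_eqF N0).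
pose gn n x := g x * t n x.
have mgn n : measurable_fun setT (gn n) by exact: measurable_funM.
have gnb n x : `|gn n x| <= n%:R.
  rewrite /gn /t; case: (leP `|g x| n%:R) => H; rewrite ?mulr1// mulr0 normr0//.
have gnL n : gn n \in Lfun P N%:R%:E by exact: (Lp_bounded P N0 (mgn n) (gnb n)).
have key n : nrm P N (gn n) <= nrm P N f.
  pose sg (x : Y) : R := if 0 <= g x then 1 else -1.
  pose h (x : Y) : R := sg x * `|g x| ^+ N.-1 * t n x.
  have mh : measurable_fun setT h.
    apply: measurable_funM => //; apply: measurable_funM.
      by apply: measurable_fun_ifT => //; exact: measurable_fun_ler.
    by apply: measurable_funX; exact: measurableT_comp.
  have hb x : `|h x| <= `|gn n x| ^+ N.-1.
    rewrite /h /gn !normrM /t; case: (leP `|g x| n%:R) => H; last first.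
      by rewrite normr0 mulr0 exprn_ge0// mulr_ge0.
    rewrite normr1 !mulr1 normrX normr_id ler_piMl ?exprn_ge0//.
    by rewrite /sg; case: ifP; rewrite ?normrN normr1.
  have hM x : `|h x| <= n%:R ^+ N.-1 by apply: le_trans (hb x) _; rewrite lerXn2r ?nnegrE.
  have E : \int[P]_x (`|gn n x| ^+ N) = \int[P]_x (f x * h (S x)).
    rewrite -(adj_dual mpS fi mh hM); apply: eq_Rintegral => x _.
    rewrite /gn /h -/g normrM exprMn (ger0_norm (andP (t01 n x)).1) tE.
    rewrite -[in LHS](prednK N0) exprS.
    rewrite [RHS]mulrA; congr (_ * _); rewrite mulrA; congr (_ * _).
    rewrite /sg; case: leP => g0; first by rewrite mulr1 ger0_norm.
    by rewrite mulrN1 ltr0_norm.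
  have [fS1 fS2] := mp_Lp mpS N0 (gnL n).
  have := @hoelder_pow2 _ _ _ P 1 N.-1 f (fun x => gn n (S x)).
  rewrite add1n prednK// => /(_ N0 fL fS1)[i1 i2].
  rewrite fS2 expr1 in i2.
  have H : nrm P N (gn n) ^+ N <= nrm P N f * nrm P N (gn n) ^+ N.-1.
    rewrite nrm_pow// E; apply: le_trans i2; apply: le_trans (le_trans (ler_norm _) (Rint_norm _)) _.
      exact: intg_mul_comp fi mh hM.
    apply: Rint_le; [apply: intg_norm; exact: intg_mul_comp fi mh hM|exact: intg_norm|].
    move=> x; rewrite expr1 [leLHS]normrM [leRHS]normrM ler_wpM2l// normrX.
    exact: hb.
  have [->|nz] := eqVneq (nrm P N (gn n)) 0; first exact: nrm_ge0.
  move: H nz (nrm_ge0 P N (gn n)); move: (nrm P N (gn n)) => a H nz a0.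
  move: H; rewrite -[in X in X <= _](prednK N0) exprS ler_pM2r//.
  by rewrite exprn_gt0// lt_neqAle eq_sym nz.
apply: (Lp_fatou (g := gn) N0 (nrm_ge0 _ _ _)) => //.
apply: aeW => x; apply: cvg_near_cst; exists (Num.truncn `|g x|).+1 => // n /= nx.
rewrite /gn /t ifT ?mulr1// ltW// (lt_le_trans (truncnS_gt _))// ler_nat.
exact: leq_trans nx.
Qed.

(* The duality extends beyond bounded [h] by truncating [h]. *)
Lemma adj_dual_intg f h : intg P f -> measurable_fun setT h ->
  intg P (fun x => adj P S f x * h x) -> intg P (fun x => f x * h (S x)) ->
  \int[P]_x (adj P S f x * h x) = \int[P]_x (f x * h (S x)).
Proof.
move=> fi mh i1 i2.
have mg := intg_measurable (adj_intg mpS fi); have mf := intg_measurable fi.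
pose t (n : nat) (x : Y) : R := if `|h x| <= n%:R then h x else 0.
have mt n : measurable_fun setT (t n).
  apply: measurable_fun_ifT => //; apply: measurable_fun_ler => //.
  exact: measurableT_comp.
have tb n x : `|t n x| <= n%:R by rewrite /t; case: ifP; rewrite ?normr0.
have th n x : `|t n x| <= `|h x| by rewrite /t; case: ifP; rewrite ?normr0.
have tcv x : t n x @[n --> \oo] --> h x.
  apply: cvg_near_cst; exists (Num.truncn `|h x|).+1 => // n /= nx.
  rewrite /t ifT// ltW// (lt_le_trans (truncnS_gt _))// ler_nat.
  exact: leq_trans nx.
have lim (u : Y -> R) (W : Y -> Y) : measurable_fun setT u -> measurable_fun setT W ->
    intg P (fun x => u x * h (W x)) ->
    \int[P]_x (u x * t n (W x)) @[n --> \oo] --> \int[P]_x (u x * h (W x)).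
  move=> mu mW ui.
  apply: (@Rint_dct _ _ _ P _ _ (fun x => `|u x * h (W x)|) _ _ _ _ _).2.
  - by move=> n; apply: measurable_funM => //; exact: (measurableT_comp (mt n)).
  - by apply: measurable_funM => //; exact: (measurableT_comp mh).
  - exact: intg_norm.
  - by apply: aeW => x; apply: cvgM; [exact: cvg_cst|exact: tcv].
  - by apply: aeW => x n; rewrite !normrM ler_wpM2l.
have H1 := lim _ id mg (@measurable_id _ _ setT) i1; have H2 := lim _ S mf mS i2.
apply: (cvg_unique _ H1) => //; rewrite (_ : (fun n => _) = (fun n => \int[P]_x (f x * t n (S x))))//.
by apply/funext => n; exact: (adj_dual mpS fi (mt n) (tb n)).
Qed.

(** V^* V is the identity because V is multiplicative and preserves integrals. *)
Lemma adj_comp f : intg P f -> adj P S (fun x => f (S x)) = f %[ae P].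
Proof.
move=> fi; apply: adj_unique => //; first exact: (mp_intg mpS fi).
move=> h M mh hM; rewrite (@mp_Rint _ _ _ P S mpS (fun x => f x * h x))//.
exact: intgM_bounded hM.
Qed.

Lemma adj_mean f : intg P f -> \int[P]_x adj P S f x = \int[P]_x f x.
Proof.
move=> fi; have := @adj_dual _ _ _ P S mpS f (fun=> 1) 1 fi.
have m1 : measurable_fun setT (fun=> 1 : R) by [].
have b1 : forall x : Y, `|1 : R| <= 1 by move=> _; rewrite normr1.
move=> /(_ (m1 _ _) b1).
by under eq_Rintegral do rewrite mulr1; under [X in _ = X]eq_Rintegral do rewrite mulr1.
Qed.

End preadjoint_theory.

Lemma adj_adj d (Y : measurableType d) (R : realType) (P : probability Y R)
    (S1 S2 : Y -> Y) (f : Y -> R) :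
  measure_preserving P S1 -> measure_preserving P S2 -> intg P f ->
  adj P S1 (adj P S2 f) = adj P (S1 \o S2) f %[ae P].
Proof.
move=> mp1 mp2 fi; have gi := adj_intg mp2 fi.
apply: ae_eq_sym; apply: adj_unique => //; first exact: mp_comp.
  exact: adj_intg.
move=> h M mh hM; rewrite (adj_dual mp1 gi mh hM).
rewrite (@adj_dual _ _ _ P S2 mp2 f (h \o S1) M)//; last by move=> x; exact: hM.
exact: measurableT_comp mh mp1.1.
Qed.
(** * Moments of Birkhoff sums *)

Section moment_inequality.
Context (R : realType).

(** The binomial expansion without the term j = 1, which vanishes for martingale differences, is at
    most (a^2 + C b^2)^m, so that squared norms grow additively. The constant 4^m is the sum of all
    the binomial coefficients. *)
Lemma even_moment_ineq (m : nat) (a b : R) : (0 < m)%N -> 0 <= a -> 0 <= b ->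
  \sum_(j < (2 * m).+1 | (j != 1 :> nat)) (a ^+ (2 * m - j) * b ^+ j) *+ 'C(2 * m, j) <=
  (a ^+ 2 + 4 ^+ m * b ^+ 2) ^+ m.
Proof.
move=> m0 a0 b0; have m2 : (1 < 2 * m)%N by rewrite -[1%N]muln1 (leq_ltn_trans _ (_ : 1 * m < 2 * m)%N) ?leq_mul2l// ltn_mul2r m0.
have t0 j : 0 <= a ^+ (2 * m - j) * b ^+ j by rewrite mulr_ge0 ?exprn_ge0.
have S4 : \sum_(j < (2 * m).+1) 'C(2 * m, j)%:R = 4 ^+ m :> R.
  rewrite (_ : 4 ^+ m = (1 + 1) ^+ (2 * m)); last by rewrite exprM; congr (_ ^+ _); ring.
  by rewrite exprDn; apply: eq_bigr => j _; rewrite !expr1n mul1r.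
(* If a <= b, every monomial is at most b^(2m). *)
have [ab|ba] := leP a b.
  apply: (@le_trans _ _ (\sum_(j < (2 * m).+1) b ^+ (2 * m) *+ 'C(2 * m, j))).
    rewrite [leRHS](bigID (fun j : 'I__ => j != 1 :> nat))/= -[leLHS]addr0 lerD//; last first.
      by apply: sumr_ge0 => j _; rewrite mulrn_wge0// exprn_ge0.
    apply: ler_sum => j _; rewrite lerMn2r; apply/orP; right.
    rewrite -[in leRHS](@subnK j (2 * m)) ?exprD; last by rewrite -ltnS.
    by rewrite ler_wpM2r ?exprn_ge0// lerXn2r// nnegrE.
  under eq_bigr do rewrite -mulr_natr.
  rewrite -mulr_sumr S4 mulrC.
  apply: (@le_trans _ _ ((4 ^+ m * b ^+ 2) ^+ m)).
    by rewrite exprMn -!exprM ler_wpM2r ?exprn_ge0// ler_weXn2l ?ler1n// leq_pmull.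
  rewrite lerXn2r ?nnegrE ?addr_ge0 ?mulr_ge0 ?exprn_ge0//.
  by rewrite lerDr exprn_ge0.
(* If b < a, the monomials with j >= 2 are at most a^(2m-2) b^2, and the first two terms of the
   expanded right-hand side absorb them. *)
have lb : a ^+ (2 * m) + 4 ^+ m * (a ^+ (2 * m - 2) * b ^+ 2) <= (a ^+ 2 + 4 ^+ m * b ^+ 2) ^+ m.
  have c0 : 0 <= 4 ^+ m :> R by exact: exprn_ge0.
  move: (4 ^+ m) c0 => c c0.
  case: m m0 {m2 t0 S4} => // m _.
  rewrite [leRHS]exprDn big_ord_recl big_ord_recl/= subn0 expr0 mulr1 bin0 mulr1n.
  rewrite addrA -[leLHS]addr0 lerD//; last first.
    by apply: sumr_ge0 => i _; rewrite mulrn_wge0// mulr_ge0// exprn_ge0// mulr_ge0 ?exprn_ge0.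
  rewrite -exprM lerD2l /bump leqnn addn0 expr1 bin1 subn1 -exprM/= mulrCA -[leLHS]mulr1n.
  rewrite (_ : (2 * m.+1 - 2 = 2 * m)%N); last by rewrite mulnS addKn.
  by apply: ler_wpMn2l => //; rewrite !mulr_ge0// exprn_ge0.
apply: le_trans lb; rewrite (bigD1 ord0)//= subn0 expr0 mulr1 bin0 mulr1n lerD2l.
apply: (@le_trans _ _ (\sum_(j < (2 * m).+1) (a ^+ (2 * m - 2) * b ^+ 2) *+ 'C(2 * m, j))).
  rewrite [leRHS](bigID (fun j : 'I__ => (j != 1 :> nat) && (j != ord0)))/= -[leLHS]addr0 lerD//; last first.
    by apply: sumr_ge0 => j _; rewrite mulrn_wge0// mulr_ge0 ?exprn_ge0.
  apply: ler_sum => j /andP[j1 j0]; rewrite lerMn2r; apply/orP; right.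
  have j2 : (2 <= j)%N by case: j j1 j0 => -[|[|j]].
  have jm : (j <= 2 * m)%N by rewrite -ltnS.
  rewrite -[X in b ^+ X](subnK j2) exprD mulrA ler_wpM2r ?exprn_ge0//.
  rewrite (_ : (2 * m - 2 = (2 * m - j) + (j - 2))%N); last by rewrite addnBA// subnK.
  by rewrite exprD ler_wpM2l ?exprn_ge0// lerXn2r ?nnegrE// ltW.
under eq_bigr do rewrite -mulr_natr.
by rewrite -mulr_sumr S4 mulrC.
Qed.

End moment_inequality.

Section birkhoff_sums.
Context d (Y : measurableType d) (R : realType).
Variable P : probability Y R.
Variable S : Y -> Y.
Hypothesis mpS : measure_preserving P S.
Let mS : measurable_fun setT S := mpS.1.
Implicit Types (f g h : Y -> R).

Definition bsum f (n : nat) (x : Y) : R := \sum_(0 <= k < n) f (iter k S x).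

Lemma bsum0 f x : bsum f 0 x = 0. Proof. by rewrite /bsum big_geq. Qed.

(** The first summand is peeled off, not the last: what remains is a function of S x, to which a
    function killed by V^* is orthogonal. This is the reversed martingale structure. *)
Lemma bsumS f n x : bsum f n.+1 x = f x + bsum f n (S x).
Proof.
rewrite /bsum big_nat_recl//=; congr (_ + _); apply: eq_bigr => k _.
by rewrite -iterSr.
Qed.

Lemma bsum_add f j k x : bsum f (j + k) x = bsum f j x + bsum f k (iter j S x).
Proof.
elim: j x => [|j IH] x; first by rewrite bsum0 add0r.
by rewrite addSn !bsumS IH addrA -iterSr.
Qed.

Lemma bsum_Lp N f n : (0 < N)%N -> f \in Lfun P N%:R%:E -> bsum f n \in Lfun P N%:R%:E.
Proof.
move=> N0 fL; apply: (Lp_sum _ N0) => k.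
exact: (mp_Lp (mp_iter k mpS) N0 fL).1.
Qed.

Lemma measurable_bsum f n : measurable_fun setT f -> measurable_fun setT (bsum f n).
Proof.
move=> mf; apply: measurable_sum => k.
by apply: (measurableT_comp mf); exact: (mp_iter k mpS).1.
Qed.

Lemma adj0_dual f h : intg P f -> adj P S f = (fun=> 0) %[ae P] ->
  measurable_fun setT h -> intg P (fun x => f x * h (S x)) ->
  \int[P]_x (f x * h (S x)) = 0.
Proof.
move=> fi f0 mh i2.
have mg := intg_measurable (adj_intg mpS fi).
have e0 : (fun x => adj P S f x * h x) = (fun=> 0) %[ae P].
  by apply: filterS f0 => x /(_ I) -> _; rewrite mul0r.
rewrite -(adj_dual_intg mpS fi mh _ i2).
  by rewrite (Rint_ae _ _ e0) ?Rintegral_zero//; exact: measurable_funM.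
apply: (intg_ae _ _ (ae_eq_sym e0) (intg0 P)) => //; exact: measurable_funM.
Qed.

(** Induction on n: the 2m-th power of f plus a function of S x is expanded, the term linear in f
    integrates to 0, and Hoelder bounds the other terms by powers of the two norms. *)
Lemma bsum_moment m f n : (0 < m)%N -> f \in Lfun P (2 * m)%:R%:E ->
  adj P S f = (fun=> 0) %[ae P] ->
  nrm P (2 * m) (bsum f n) ^+ 2 <= n%:R * (4 ^+ m * nrm P (2 * m) f ^+ 2).
Proof.
move=> m0 fL f0; have M0 : (0 < 2 * m)%N by rewrite muln_gt0.
elim: n => [|n IH].
  rewrite (_ : bsum f 0 = fun=> 0); last by apply/funext => x; rewrite bsum0.
  by rewrite nrm0// expr0n mul0r.
rewrite -natr1 mulrDl mul1r.
set b := nrm P (2 * m) f; set a := nrm P (2 * m) (bsum f n) in IH.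
have ML := bsum_Lp n M0 fL.
have [XL Xn] := mp_Lp mpS M0 ML.
suff : nrm P (2 * m) (bsum f n.+1) ^+ (2 * m) <= (a ^+ 2 + 4 ^+ m * b ^+ 2) ^+ m.
  rewrite exprM ler_pXn2r ?nnegrE ?exprn_ge0 ?nrm_ge0//; last first.
    by rewrite addr_ge0 ?mulr_ge0 ?exprn_ge0 ?nrm_ge0.
  by move=> /le_trans; apply; rewrite lerD2r.
apply: le_trans (even_moment_ineq m0 (nrm_ge0 _ _ _) (nrm_ge0 _ _ _)).
rewrite nrm_pow//; last exact: bsum_Lp.
have hp (j : 'I_(2 * m).+1) : intg P (fun x => bsum f n (S x) ^+ (2 * m - j) * f x ^+ j) /\
    \int[P]_x (bsum f n (S x) ^+ (2 * m - j) * f x ^+ j) <= a ^+ (2 * m - j) * b ^+ j.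
  have jm : (j <= 2 * m)%N by rewrite -ltnS.
  have := @hoelder_pow2 _ _ _ P (2 * m - j) j (fun x => bsum f n (S x)) f.
  rewrite subnK// Xn => /(_ M0 XL fL)[i1 i2]; split => //.
  exact: le_trans (le_trans (ler_norm _) (Rint_norm i1)) i2.
have E x : `|bsum f n.+1 x| ^+ (2 * m) =
    \sum_(j < (2 * m).+1) 'C(2 * m, j)%:R * (bsum f n (S x) ^+ (2 * m - j) * f x ^+ j).
  rewrite -normrX ger0_norm; last by rewrite exprM exprn_ge0// sqr_ge0.
  rewrite bsumS addrC exprDn; apply: eq_bigr => j _.
  by rewrite mulr_natl.
under eq_Rintegral do rewrite E.
rewrite Rint_sum; last by move=> j; apply: intgZ; exact: (hp j).1.
rewrite [leLHS](bigID (fun j : 'I__ => j != 1 :> nat))/= [X in _ + X]big1 ?addr0.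
  apply: ler_sum => j _; rewrite RintZ; last exact: (hp j).1.
  by rewrite -[leRHS]mulr_natl ler_wpM2l// (hp j).2.
move=> j /negPn/eqP j1; rewrite RintZ; last exact: (hp j).1.
have := (hp j).1; under eq_fun do rewrite j1 expr1 mulrC; move=> i1.
rewrite (@adj0_dual f (fun x => bsum f n x ^+ (2 * m - 1)))//.
- by rewrite mulr0.
- exact: Lp_intg M0 fL.
by apply: measurable_funX; exact: Lp_measurable ML.
Qed.

Lemma adj_cobound f : intg P f ->
  adj P S (fun x => f x - adj P S f (S x)) = (fun=> 0) %[ae P].
Proof.
move=> fi; have gi := adj_intg mpS fi.
have := adjB mpS fi (mp_intg mpS gi).
by apply: filterS2 (adj_comp mpS gi) => x /(_ I) H /(_ I) -> _; rewrite H subrr.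
Qed.

(** The two summands differ by the coboundary of V^* f, whose Birkhoff sum telescopes to its end
    values. *)
Lemma bsum_cobound f n x : bsum (fun x => f x - adj P S f x) n x =
  bsum (fun x => f x - adj P S f (S x)) n x + (adj P S f (iter n S x) - adj P S f x).
Proof.
elim: n x => [|n IH] x; first by rewrite !bsum0 subrr addr0.
rewrite !bsumS IH -iterSr; ring.
Qed.

(** In the constant, 2^m is the square root of the 4^m of [bsum_moment], the factor 2 bounds the
    norm of f - V V^* f, and the last 2 bounds the end values of the coboundary, by 1 <= sqrt n. *)
Lemma bsum_sqrt_bound m f n : (0 < m)%N -> (0 < n)%N -> f \in Lfun P (2 * m)%:R%:E ->
  nrm P (2 * m) (bsum (fun x => f x - adj P S f x) n) <=
    (2 ^+ m * 2 + 2) * Num.sqrt n%:R * nrm P (2 * m) f.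
Proof.
move=> m0 n0 fL; have M0 : (0 < 2 * m)%N by rewrite muln_gt0.
have [gL gf] := adj_Lp mpS M0 fL.
have fi := Lp_intg M0 fL.
have [gSL gS] := mp_Lp mpS M0 gL.
have [gnL gn] := mp_Lp (mp_iter n mpS) M0 gL.
set D := fun x => f x - adj P S f (S x).
have DL : D \in Lfun P (2 * m)%:R%:E by exact: LpB.
have Dn : nrm P (2 * m) D <= 2 * nrm P (2 * m) f.
  apply: le_trans (nrmB M0 fL gSL) _; rewrite gS mulr_natl mulr2n.
  by rewrite lerD2l.
have := bsum_moment n m0 DL (adj_cobound fi).
set s := Num.sqrt n%:R; have s1 : 1 <= s by rewrite -[1]sqrtr1 ler_wsqrtr// ler1n.
have s0 : 0 <= s by exact: sqrtr_ge0.
have -> : n%:R * (4 ^+ m * nrm P (2 * m) D ^+ 2) = (s * (2 ^+ m * nrm P (2 * m) D)) ^+ 2.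
  have E4 : (4 : R) = 2 ^+ 2 by rewrite expr2 -natrM.
  by rewrite !exprMn sqr_sqrtr// E4 exprAC.
rewrite ler_pXn2r ?nnegrE ?nrm_ge0 ?mulr_ge0 ?exprn_ge0 ?nrm_ge0// => H.
rewrite (_ : bsum _ n = fun x => bsum D n x + (adj P S f (iter n S x) - adj P S f x)); last first.
  by apply/funext => x; rewrite bsum_cobound.
have BL := bsum_Lp n M0 DL.
apply: le_trans (nrmD M0 BL (LpB M0 gnL gL)) _.
apply: le_trans (lerD H (nrmB M0 gnL gL)) _; rewrite gn.
have F0 := nrm_ge0 P (2 * m) f.
apply: (@le_trans _ _ (s * (2 ^+ m * (2 * nrm P (2 * m) f)) + 2 * nrm P (2 * m) f)).
  apply: lerD; last by rewrite mulr_natl mulr2n lerD.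
  by rewrite ler_wpM2l// ler_wpM2l// exprn_ge0.
rewrite [leRHS](_ : _ = s * (2 ^+ m * (2 * nrm P (2 * m) f)) + s * (2 * nrm P (2 * m) f)); last by ring.
by rewrite lerD2l ler_peMl// mulr_ge0.
Qed.

End birkhoff_sums.
(** * Decay of preadjoint iterates under exactness *)

Section exactness.
Context d (Y : measurableType d) (R : realType).
Variable P : probability Y R.
Variable S : Y -> Y.
Hypothesis exS : exact_map P S.
Let mpS : measure_preserving P S := exS.1.
Let mpi n : measure_preserving P (iter n S) := mp_iter n mpS.
Implicit Types (f g h : Y -> R).

Lemma limn_esup_shift (u : nat -> \bar R) n :
  limn_esup (fun k => u (k + n)%N) = limn_esup u.
Proof.
rewrite !limn_esup_lim.
have E m : esups (fun k => u (k + n)%N) m = esups u (m + n)%N.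
  rewrite /esups; congr ereal_sup; apply/seteqP; split => _ [k /= km <-].
    by exists (k + n)%N => //=; rewrite leq_add2r.
  have nk : (n <= k)%N by exact: leq_trans (leq_addl m n) km.
  by exists (k - n)%N; [rewrite /= -(leq_add2r n) subnK|rewrite subnK].
rewrite (_ : esups _ = (fun m => esups u (m + n)%N)); last exact/funext.
apply/cvg_lim => //.
have := @is_cvg_esups _ u; move=> /cvg_ex[l ul].
rewrite (cvg_lim _ ul)//; exact: (cvg_comp _ _ (@cvg_addnr n) ul).
Qed.

Lemma adj_iterS f j : intg P f ->
  adj P (iter j.+1 S) f = adj P S (adj P (iter j S) f) %[ae P].
Proof. by move=> fi; apply: ae_eq_sym; exact: (adj_adj mpS (mpi j) fi). Qed.

Lemma adj_iter_add f i j : intg P f ->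
  adj P (iter (j + i) S) f = adj P (iter j S) (adj P (iter i S) f) %[ae P].
Proof.
move=> fi; apply: ae_eq_sym.
rewrite (_ : iter (j + i) S = iter j S \o iter i S); last first.
  by apply/funext => x; rewrite iterD.
exact: (adj_adj (mpi j) (mpi i) fi).
Qed.

(** V^k V^{*k} is the orthogonal projection onto functions of S^k x, and these spaces decrease with
    k; so the inner product of two projections of f is the squared norm of the later one. *)
Lemma adj_iter_inner f i j : f \in Lfun P 2%:R%:E -> (i <= j)%N ->
  \int[P]_x (adj P (iter i S) f (iter i S x) * adj P (iter j S) f (iter j S x)) =
  nrm P 2 (adj P (iter j S) f) ^+ 2.
Proof.
move=> fL ij; have fi : intg P f := Lp_intg (isT : (0 < 2)%N) fL.
have AL k : adj P (iter k S) f \in Lfun P 2%:R%:E := (adj_Lp (mpi k) (isT : (0 < 2)%N) fL).1.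
have Ai k : intg P (adj P (iter k S) f) := adj_intg (mpi k) fi.
set A := fun k => adj P (iter k S) f.
have AS k l : (fun x => A k (iter l S x)) \in Lfun P 2%:R%:E := (mp_Lp (mpi l) (isT : (0 < 2)%N) (AL k)).1.
transitivity (\int[P]_x (A i x * A j (iter (j - i) S x))).
  rewrite -(@mp_Rint _ _ _ P (iter i S) (mpi i) (fun x => A i x * A j (iter (j - i) S x))).
    by apply: eq_Rintegral => x _; rewrite -iterD subnK.
  exact: (L2_mul (AL i) (AS j _)).1.
have e : A j = adj P (iter (j - i) S) (A i) %[ae P].
  by have := adj_iter_add i (j - i) fi; rewrite subnK.
have mA k : measurable_fun setT (A k) := Lp_measurable (AL k).
have AAL := (adj_Lp (mpi (j - i)) (isT : (0 < 2)%N) (AL i)).1.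
rewrite -(@adj_dual_intg _ _ _ P (iter (j - i) S) (mpi _) (A i) (A j))//.
- rewrite (nrm2E (AL j)) -/(A j); apply: Rint_ae.
  + by apply: measurable_funM => //; exact: Lp_measurable AAL.
  + by apply: measurable_funX.
  + by apply: filterS e => x /(_ I) Ex _; rewrite -Ex expr2.
- exact: Ai.
- exact: (L2_mul AAL (AL j)).1.
- exact: (L2_mul (AL i) (AS j _)).1.
Qed.

(** The set where q > 0 lies in every S^{-n} F, so it has measure 0 or 1, and in the second case the
    zero mean forces q = 0 a.e. The same applies to -q. *)
Lemma exact_tail_ae0 (q : Y -> R) : intg P q -> \int[P]_x q x = 0 ->
  (forall n, exists Q : Y -> R, measurable_fun setT Q /\ forall x, q x = Q (iter n S x)) ->
  q = (fun=> 0) %[ae P].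
Proof.
move=> qi q0 qQ; have mq := intg_measurable qi.
have key (w : Y -> R) : intg P w -> \int[P]_x w x = 0 ->
    (forall n, exists Q : Y -> R, measurable_fun setT Q /\ forall x, w x = Q (iter n S x)) ->
    {ae P, forall x, w x <= 0}.
  move=> wi w0 wQ; have mw := intg_measurable wi.
  pose A := [set x | 0 < w x].
  have mQ (Q : Y -> R) : measurable_fun setT Q -> measurable [set x | 0 < Q x].
    move=> mQ; rewrite (_ : [set x | 0 < Q x] = setT `&` Q @^-1` `]0, +oo[).
      by apply: mQ => //; exact: measurable_itv.
    by apply/seteqP; split => x /=; rewrite in_itv/= andbT // => -[].
  have mA : measurable A by exact: mQ.
  have [|A0|A1] := exS.2 A mA.
  - move=> n _; have [Q [mQn wE]] := wQ n; exists [set x | 0 < Q x]; first exact: mQ.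
    by apply/seteqP; split => x; rewrite /A/= wE.
  - by exists A; split => // x /= /negP; rewrite -ltNge.
  - have An : {ae P, forall x, 0 < w x}.
      exists (~` A); split; first exact: measurableC.
        by rewrite probability_setC// A1 subee.
      by move=> x /= nw; exact: nw.
    have E : w = (fun x => `|w x|) %[ae P].
      by apply: filterS An => x wx _; rewrite gtr0_norm.
    have mwn : measurable_fun setT (fun x => `|w x|) by exact: measurableT_comp.
    have := Rint_eq0_ae (intg_norm wi) (fun x => normr_ge0 (w x)).
    rewrite -(Rint_ae mw mwn E) => /(_ w0).
    by apply: filterS => x /(_ I)/eqP; rewrite normr_eq0 => /eqP ->.
have H1 := key q qi q0 qQ.
have H2 : {ae P, forall x, - q x <= 0}.
  apply: key; first exact: intgN.
    under eq_Rintegral do rewrite -mulN1r.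
    by rewrite RintZ// q0 mulr0.
  move=> n; have [Q [mQ qE]] := qQ n; exists (fun x => - Q x); split.
    exact: measurableT_comp.
  by move=> x; rewrite qE.
apply: filterS2 H1 H2 => x; rewrite oppr_le0 => x1 x2 _.
by apply/eqP; rewrite eq_le x1.
Qed.

(** The projections [Q k] of h onto functions of S^k x are Cauchy in L_2. Their limit is a function
    of S^n x for every n and has mean 0, so it vanishes by exactness. *)
Lemma exact_adj_cvg2 h : h \in Lfun P 2%:R%:E -> \int[P]_x h x = 0 ->
  nrm P 2 (adj P (iter j S) h) @[j --> \oo] --> (0:R).
Proof.
move=> hL h0; have hi : intg P h := Lp_intg (isT : (0 < 2)%N) hL.
pose A k := adj P (iter k S) h.
have AL k : A k \in Lfun P 2%:R%:E := (adj_Lp (mpi k) (isT : (0 < 2)%N) hL).1.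
have mA k : measurable_fun setT (A k) := Lp_measurable (AL k).
pose Q k (x : Y) : R := A k (iter k S x).
have QL k : Q k \in Lfun P 2%:R%:E := (mp_Lp (mpi k) (isT : (0 < 2)%N) (AL k)).1.
have Qn k : nrm P 2 (Q k) = nrm P 2 (A k) := (mp_Lp (mpi k) (isT : (0 < 2)%N) (AL k)).2.
pose a k := nrm P 2 (A k).
have a0 k : 0 <= a k := nrm_ge0 _ _ _.
have and1 k : a k.+1 <= a k.
  have mB := Lp_measurable (adj_Lp mpS (isT : (0 < 2)%N) (AL k)).1.
  rewrite /a (nrm_ae (isT : (0 < 2)%N) (mA k.+1) mB (adj_iterS k hi)).
  exact: (adj_Lp mpS (isT : (0 < 2)%N) (AL k)).2.
have and : {homo a : n m / (n <= m)%N >-> m <= n}.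
  exact/nonincreasing_seqP.
have Qd i j : (i <= j)%N -> nrm P 2 (fun x => Q i x - Q j x) ^+ 2 = a i ^+ 2 - a j ^+ 2.
  move=> ij; rewrite nrm2E; last exact: LpB.
  have E x : (Q i x - Q j x) ^+ 2 = (Q i x * Q i x - 2 * (Q i x * Q j x)) + Q j x * Q j x by ring.
  under eq_Rintegral do rewrite E.
  have m2 k l := (L2_mul (QL k) (QL l)).1.
  rewrite RintD//; last by apply: intgB => //; exact: intgZ.
  rewrite RintB//; last exact: intgZ.
  rewrite RintZ// !adj_iter_inner// /a; ring.
have a2cv : cvgn (fun k => a k ^+ 2).
  apply: nonincreasing_is_cvgn.
    by move=> n m nm; rewrite lerXn2r ?nnegrE// and.
  by exists 0 => _ [n _ <-]; rewrite exprn_ge0.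
(* Rates 2^-k make the increments along the subsequence [J] summable, whence convergence a.e. and
   not only in norm. *)
have : forall k : nat, exists N, forall i, (N <= i)%N -> forall j, (i <= j)%N ->
    a i ^+ 2 - a j ^+ 2 <= (2^-1 ^+ k) ^+ 2.
  move=> k; have e0 : 0 < (2^-1 ^+ k) ^+ 2 :> R by rewrite !exprn_gt0.
  have /cvgrPdist_le/(_ _ e0)[N _ HN] := a2cv.
  exists N => i Ni j ij.
  have l2 n : limn (fun k => a k ^+ 2) <= a n ^+ 2.
    apply: limr_le => //; exists n => // m /= nm.
    by rewrite lerXn2r ?nnegrE// and.
  apply: le_trans (HN i Ni); rewrite distrC ger0_norm ?subr_ge0//.
  by rewrite lerD2l lerN2.
move=> /choice[Nf HN].
(* The sum makes [J] monotone and at least [Nf]; the summand k makes it unbounded. *)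
pose J k := (\sum_(0 <= i < k.+1) Nf i + k)%N.
have JN k : (Nf k <= J k)%N by rewrite /J big_nat_recr//= addnAC leq_addl.
have Jk k : (k <= J k)%N by rewrite /J leq_addl.
have JS k : (J k <= J k.+1)%N.
  by rewrite /J [in leqRHS]big_nat_recr//= -addnA leq_add2l addnS leqW// leq_addl.
pose v k (x : Y) : R := Q (J k.+1) x - Q (J k) x.
have vL k : v k \in Lfun P 2%:R%:E by exact: LpB.
have vn k : nrm P 2 (v k) <= 2^-1 ^+ k.
  rewrite /v nrmBC -(@ler_pXn2r _ 2)// ?nnegrE ?nrm_ge0 ?exprn_ge0//.
  by rewrite Qd//; exact: HN.
have geo n : \sum_(0 <= k < n) (2^-1 : R) ^+ k <= 2.
  suff -> : \sum_(0 <= k < n) (2^-1 : R) ^+ k = 2 - 2 * 2^-1 ^+ n.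
    by rewrite gerBl mulr_ge0// exprn_ge0.
  elim: n => [|n IH]; first by rewrite big_geq// expr0 mulr1 subrr.
  by rewrite big_nat_recr//= IH exprS mulrA divff// mul1r; ring.
have [|w [wL _ wae wn]] := @Lp_series_cvg _ _ _ P 2 v 2 isT vL.
  by move=> n; apply: le_trans (geo n); apply: ler_sum => k _; exact: vn.
have sE n x : \sum_(0 <= k < n) v k x = Q (J n) x - Q (J 0%N) x.
  elim: n => [|n IH]; first by rewrite big_geq// subrr.
  by rewrite big_nat_recr//= IH /v; ring.
(* A limsup at every point is taken, because [exact_tail_ae0] asks for a function of S^n x
   everywhere and not only a.e. *)
pose q (x : Y) : R := fine (limn_esup (fun k => (Q (J k) x)%:E)).
have mQ k : measurable_fun setT (Q k) := Lp_measurable (QL k).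
have mlim (u : nat -> Y -> R) : (forall k, measurable_fun setT (u k)) ->
    measurable_fun setT (fun x => fine (limn_esup (fun k => (u k x)%:E))).
  move=> mu; apply: measurableT_comp => //; apply: measurable_fun_limn_esup => k.
  exact/measurable_EFinP.
have mq : measurable_fun setT q by exact: mlim.
have qw : (fun x => w x + Q (J 0%N) x) = q %[ae P].
  apply: filterS wae => x wx _; rewrite /q.
  rewrite (@fine_limn_esup _ _ (w x + Q (J 0%N) x))//.
  rewrite (_ : (fun k => Q (J k) x) = (fun n => \sum_(0 <= k < n) v k x + Q (J 0%N) x)).
    by apply: cvgD => //; exact: cvg_cst.
  by apply/funext => n; rewrite sE subrK.
have wQL := LpD (isT : (0 < 2)%N) wL (QL (J 0%N)).
have qL : q \in Lfun P 2%:R%:E := Lp_ae (isT : (0 < 2)%N) wQL mq qw.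
have Qq : nrm P 2 (fun x => Q (J n) x - q x) @[n --> \oo] --> (0:R).
  rewrite (_ : (fun n => _) = (fun n => nrm P 2 (fun x => \sum_(0 <= k < n) v k x - w x)))//.
  apply/funext => n; apply: nrm_ae => //.
  - exact: measurable_funB.
  - by apply: measurable_funB; [exact: Lp_measurable (Lp_sum _ _ vL)|exact: Lp_measurable wL].
  - by apply: filterS qw => x /(_ I) <- _; rewrite sE; ring.
have qi : intg P q := Lp_intg (isT : (0 < 2)%N) qL.
have Qi k : intg P (Q k) := Lp_intg (isT : (0 < 2)%N) (QL k).
have q0 : \int[P]_x q x = 0.
  apply/eqP; rewrite -normr_le0; apply: (cvgn_ge Qq).
  apply: nearW => n; have -> : \int[P]_x q x = - \int[P]_x (Q (J n) x - q x).
    rewrite RintB// /Q (mp_Rint (mpi _) (adj_intg (mpi _) hi)) adj_mean// h0.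
    by rewrite sub0r opprK.
  rewrite normrN; apply: le_trans (Rint_norm _) _; first exact: intgB.
  rewrite Rint_le_nrm1; last exact: intgB.
  by apply: (Lp_incl _ (LpB _ (QL _) qL)).2.
have q00 : q = (fun=> 0) %[ae P].
  apply: exact_tail_ae0 => // n.
  (* Dropping the first n indices does not change the limsup and leaves only projections of order at
     least n, which are functions of S^n x. *)
  exists (fun y => fine (limn_esup (fun k => (A (J (k + n)) (iter (J (k + n) - n) S y))%:E))).
  split.
    by apply: mlim => k; apply: (measurableT_comp (mA _)); exact: (mpi _).1.
  move=> x; rewrite /q -(limn_esup_shift _ n); congr (fine (limn_esup _)).
  apply/funext => k; rewrite /Q -iterD subnK//.
  by apply: leq_trans (Jk _); rewrite leq_addl.
have aJ : a (J n) @[n --> \oo] --> (0:R).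
  rewrite (_ : (fun n => a (J n)) = (fun n => nrm P 2 (fun x => Q (J n) x - q x)))//.
  apply/funext => n; rewrite /a -Qn; apply: nrm_ae => //; first exact: measurable_funB.
  by apply: filterS q00 => x /(_ I) -> _; rewrite subr0.
(* The norms [a] decrease, so convergence along [J] is enough. *)
apply/cvgr0Pnorm_lt => e e0; have /cvgr0Pnorm_lt/(_ _ e0)[N _ HJ] := aJ.
exists (J N) => // j /= Jj; rewrite ger0_norm ?nrm_ge0//.
apply: le_lt_trans (and _ _ Jj) _.
by have := HJ N (leqnn _); rewrite /= ger0_norm.
Qed.

(** The function f^2 - E f^2 of the central limit theorem is only integrable, hence this L_1
    version. By density, h is replaced at a cost e/4 by a bounded function and at another e/4 by a
    centred one, and V^* contracts L_1. *)
Lemma exact_adj_cvg1 h : intg P h -> \int[P]_x h x = 0 ->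
  nrm P 1 (adj P (iter j S) h) @[j --> \oo] --> (0:R).
Proof.
move=> hi h0; have mh := intg_measurable hi.
pose t (n : nat) (x : Y) : R := if `|h x| <= n%:R then h x else 0.
have mt n : measurable_fun setT (t n).
  apply: measurable_fun_ifT => //; apply: measurable_fun_ler => //.
  exact: measurableT_comp.
have tb n x : `|t n x| <= n%:R by rewrite /t; case: ifP; rewrite ?normr0.
have th n x : `|t n x| <= `|h x| by rewrite /t; case: ifP; rewrite ?normr0.
have tcv x : t n x @[n --> \oo] --> h x.
  apply: cvg_near_cst; exists (Num.truncn `|h x|).+1 => // n /= nx.
  rewrite /t ifT// ltW// (lt_le_trans (truncnS_gt _))// ler_nat.
  exact: leq_trans nx.
have L1 (f : Y -> R) : intg P f -> f \in Lfun P 1%:R%:E by move=> ?; apply/Lp1_intg.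
have nhL : (fun x => `|h x|) \in Lfun P 1%:R%:E by apply: L1; exact: intg_norm.
have [tL _ tcvg] := @nrm_dct _ _ _ P 1 t h _ isT mt mh nhL (aeW _ tcv) (aeW _ (fun x n => th n x)).
apply/cvgr0Pnorm_lt => e e0.
have e4 : 0 < e / 4 by rewrite divr_gt0.
have /cvgr0Pnorm_lt/(_ _ e4)[N _ HN] := tcvg.
have {}HN : nrm P 1 (fun x => t N x - h x) < e / 4.
  by have := HN N (leqnn _); rewrite /= ger0_norm ?nrm_ge0.
pose c := \int[P]_x t N x.
have ti : intg P (t N) by apply: intg_bounded (mt N) (tb N).
have ce : `|c| < e / 4.
  rewrite -[c]subr0 -h0 -RintB//; apply: le_lt_trans (Rint_norm _) _; first exact: intgB.
  by rewrite Rint_le_nrm1//; exact: intgB.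
pose g (x : Y) : R := t N x - c.
have gL : g \in Lfun P 2%:R%:E.
  by apply: LpB => //; [exact: (Lp_bounded P _ (mt N) (tb N))|exact: Lp_cst].
have gi : intg P g := Lp_intg (isT : (0 < 2)%N) gL.
have g0 : \int[P]_x g x = 0.
  by rewrite RintB//; [rewrite Rint_cst subrr|exact: intg_cst].
have e2 : 0 < e / 2 by rewrite divr_gt0.
have /cvgr0Pnorm_lt/(_ _ e2) := exact_adj_cvg2 gL g0.
apply: filterS => j; rewrite !ger0_norm ?nrm_ge0// => Hj.
have Ai := adj_intg (mpi j) hi; have Agi := adj_intg (mpi j) gi.
have hgi : intg P (fun x => h x - g x) by exact: intgB.
have e1 := adjB (mpi j) hi gi.
have : nrm P 1 (fun x => adj P (iter j S) h x - adj P (iter j S) g x) < e / 2.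
  rewrite -(nrm_ae _ _ _ e1)//; last 2 first.
  - exact: intg_measurable (adj_intg (mpi j) hgi).
  - exact: intg_measurable (intgB Ai Agi).
  apply: le_lt_trans (adj_Lp (mpi j) _ (L1 _ hgi)).2 _ => //.
  rewrite (_ : (fun x => h x - g x) = (fun x => (h x - t N x) + c)); last first.
    by apply/funext => x; rewrite /g; ring.
  apply: le_lt_trans (nrmD _ _ _) _ => //.
  - by apply: L1; exact: intgB.
  - exact: Lp_cst.
  rewrite nrm_cst// nrmBC (_ : e / 2 = e / 4 + e / 4); first exact: ltrD.
  by field.
have -> : adj P (iter j S) h = fun x => (adj P (iter j S) h x - adj P (iter j S) g x) + adj P (iter j S) g x.
  by apply/funext => x; rewrite subrK.
move=> H1; apply: le_lt_trans (nrmD _ _ _) _ => //.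
- by apply: L1; exact: intgB.
- exact: L1.
rewrite [e](_ : e = e / 2 + e / 2); last by field.
apply: ltrD => //.
  move: H1; congr (nrm P 1 _ < _); apply/funext => x; ring.
by apply: le_lt_trans Hj; apply: (Lp_incl _ (adj_Lp (mpi j) _ gL).1).2.
Qed.

End exactness.
(** * Central limit theorem for reversed martingales *)

Section taylor_cos.
Context (R : realType).

(** The Taylor inequalities below follow from one another by integration from 0; this is the
    integration step, by the mean value theorem. *)
Lemma ge0_of_derive (f f' : R -> R) : (forall x : R, is_derive x (1 : R) f (f' x)) ->
  f 0 = 0 -> (forall x, 0 <= x -> 0 <= f' x) -> forall x, 0 <= x -> 0 <= f x.
Proof.
move=> df f0 f'0 x; rewrite le_eqVlt => /orP[/eqP <-|x0]; first by rewrite f0.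
have [|c cx] := @MVT R f f' 0 x x0.
  by apply: derivable_within_continuous => y _; apply: ex_derive; exact: df.
rewrite f0 !subr0 => ->; rewrite mulr_ge0 ?(ltW x0)// f'0//.
by move: cx; rewrite in_itv/= => /andP[/ltW].
Qed.

Lemma sin_le_id (u : R) : 0 <= u -> 0 <= u - sin u.
Proof.
apply: (@ge0_of_derive (fun u => u - sin u) (fun u => 1 - cos u)).
- by rewrite sin0 subrr.
- by move=> x _; rewrite subr_ge0 cos_le1.
Qed.

Lemma cos_ge_quad (u : R) : 0 <= u -> 0 <= u ^+ 2 / 2 - 1 + cos u.
Proof.
apply: (@ge0_of_derive (fun u => u ^+ 2 / 2 - 1 + cos u) (fun u => u - sin u)).
- by move=> x; apply: is_derive_eq; rewrite /GRing.scale/=; field.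
- by rewrite cos0; ring.
- by move=> x; exact: sin_le_id.
Qed.

Lemma sin_ge_cubic (u : R) : 0 <= u -> 0 <= u ^+ 3 / 6 - u + sin u.
Proof.
apply: (@ge0_of_derive (fun u => u ^+ 3 / 6 - u + sin u) (fun u => u ^+ 2 / 2 - 1 + cos u)).
- by move=> x; apply: is_derive_eq; rewrite /GRing.scale/=; field.
- by rewrite sin0; ring.
- by move=> x; exact: cos_ge_quad.
Qed.

Lemma cos_le_quartic (u : R) : 0 <= u -> 0 <= u ^+ 4 / 24 - u ^+ 2 / 2 + 1 - cos u.
Proof.
apply: (@ge0_of_derive (fun u => u ^+ 4 / 24 - u ^+ 2 / 2 + 1 - cos u) (fun u => u ^+ 3 / 6 - u + sin u)).
- by move=> x; apply: is_derive_eq; rewrite /GRing.scale/=; field.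
- by rewrite cos0; ring.
- by move=> x; exact: sin_ge_cubic.
Qed.

(** This is min(u^2, |u|^3), the remainder of Lindeberg's argument: quadratic for large u, so that
    second moments suffice, and cubic for small u. *)
Definition trunc_cube (u : R) := u ^+ 2 * Num.min 1 `|u|.

Lemma trunc_cube_ge0 u : 0 <= trunc_cube u.
Proof. by rewrite mulr_ge0 ?sqr_ge0// le_min ler01 normr_ge0. Qed.

(** The remainder is cos A times u^2 / 2 - 1 + cos u, plus sin A times u - sin u; these are bounded
    by one and by two times [trunc_cube u]. *)
Lemma cos_taylor (A u : R) :
  `|cos (A + u) - (cos A - u * sin A - u ^+ 2 / 2 * cos A)| <= 3 * trunc_cube u.
Proof.
have main (v : R) : 0 <= v ->
    0 <= v ^+ 2 / 2 - 1 + cos v <= trunc_cube v /\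
    0 <= v - sin v <= 2 * trunc_cube v.
  move=> v0; rewrite /trunc_cube (ger0_norm v0).
  have h1 := sin_le_id v0; have h2 := cos_ge_quad v0.
  have h3 := sin_ge_cubic v0; have h4 := cos_le_quartic v0.
  have c1 := cos_le1 v; have s1 := sin_geN1 v.
  rewrite h1 h2/=; case: (leP 1 v) => v1.
    rewrite mulr1; split; nra.
  have v2 : v ^+ 4 <= v ^+ 3 by rewrite exprS ler_piMl ?exprn_ge0// ltW.
  have v30 : 0 <= v ^+ 3 by rewrite exprn_ge0.
  by rewrite -exprSr; split; lra.
have key : `|u ^+ 2 / 2 - 1 + cos u| <= trunc_cube u /\ `|u - sin u| <= 2 * trunc_cube u.
  have [u0|u0] := leP 0 u.
    by have [/andP[a1 a2] /andP[b1 b2]] := main _ u0; rewrite !ger0_norm.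
  have un0 : 0 <= - u by lra.
  have [] := main _ un0; rewrite /trunc_cube normrN sqrrN cosN sinN => /andP[a1 a2] /andP[b1 b2].
  split; first by rewrite ger0_norm.
  rewrite ler0_norm; last by lra.
  by move: b2; lra.
have -> : cos (A + u) - (cos A - u * sin A - u ^+ 2 / 2 * cos A) =
   cos A * (u ^+ 2 / 2 - 1 + cos u) + sin A * (u - sin u).
  by rewrite cosD; field.
apply: le_trans (ler_normD _ _) _; rewrite !normrM.
have cA : `|cos A| <= 1 by rewrite ler_norml cos_geN1 cos_le1.
have sA : `|sin A| <= 1 by rewrite ler_norml sin_geN1 sin_le1.
have [k1 k2] := key.
have n1 : 0 <= `|u ^+ 2 / 2 - 1 + cos u| by [].
have n2 : 0 <= `|u - sin u| by [].
have := ler_pM (normr_ge0 _) n1 cA k1; have := ler_pM (normr_ge0 _) n2 sA k2.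
rewrite !mul1r; lra.
Qed.

Lemma cos_lip (x y : R) : `|cos x - cos y| <= `|x - y|.
Proof.
wlog xy : x y / x <= y.
  by move=> H; case: (leP x y) => [/H//|/ltW/H]; rewrite distrC [leRHS]distrC.
move: xy; rewrite le_eqVlt => /orP[/eqP ->|xy]; first by rewrite !subrr normr0.
have [|c _] := @MVT R cos (fun z => - sin z) x y xy.
  by apply: derivable_within_continuous => z _; apply: ex_derive; exact: is_derive_cos.
rewrite distrC [in leRHS]distrC => ->; rewrite normrM ler_piMl//.
by rewrite normrN ler_norml sin_geN1 sin_le1.
Qed.

Lemma expRN_bounds (y : R) : 0 <= y <= 1 -> `|1 - y - expR (- y)| <= y ^+ 2.
Proof.
move=> /andP[y0 y1].
have l1 : 1 - y <= expR (- y) by have := expR_ge1Dx (- y); lra.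
have l2 : expR (- y) <= 1 - y + y ^+ 2.
  rewrite expRN; have h := expR_ge1Dx y.
  apply: (@le_trans _ _ (1 + y)^-1); first by rewrite lef_pV2 ?posrE ?expR_gt0//; lra.
  have p : 0 < 1 + y by lra.
  rewrite -(ler_pM2r p) mulVf ?gt_eqF//; nra.
by rewrite ler_norml; lra.
Qed.

End taylor_cos.

Section martingale_clt.
Context d (Y : measurableType d) (R : realType).
Variable P : probability Y R.
Variable S : Y -> Y.
Hypothesis exS : exact_map P S.
Let mpS : measure_preserving P S := exS.1.
Let mS : measurable_fun setT S := mpS.1.
Variable f : Y -> R.
Hypothesis fL : f \in Lfun P 2%:R%:E.
Hypothesis f0 : adj P S f = (fun=> 0) %[ae P].
Let fi : intg P f := Lp_intg (isT : (0 < 2)%N) fL.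
Let mf : measurable_fun setT f := Lp_measurable fL.
Let var : R := \int[P]_x (f x ^+ 2).
Let f2i : intg P (fun x => f x ^+ 2).
Proof. by have := (L2_mul fL fL).1. Qed.

Let M := bsum S f.
Let mM n : measurable_fun setT (M n) := measurable_bsum mpS n mf.

Let mcos (u : Y -> R) (s th : R) : measurable_fun setT u ->
  measurable_fun setT (fun x => cos (s * u x - th)).
Proof.
move=> mu; apply: (measurableT_comp (f := cos)).
  by apply: continuous_measurable_fun; exact: continuous_cos.
by apply: measurable_funB => //; exact: measurable_funM.
Qed.

Let msin (u : Y -> R) (s th : R) : measurable_fun setT u ->
  measurable_fun setT (fun x => sin (s * u x - th)).
Proof.
move=> mu; apply: (measurableT_comp (f := sin)).
  by apply: continuous_measurable_fun; exact: continuous_sin.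
by apply: measurable_funB => //; exact: measurable_funM.
Qed.

Let cos1 (x : R) : `|cos x| <= 1. Proof. by rewrite ler_norml cos_geN1 cos_le1. Qed.
Let sin1 (x : R) : `|sin x| <= 1. Proof. by rewrite ler_norml sin_geN1 sin_le1. Qed.

Let mtc (s : R) : measurable_fun setT (fun x => trunc_cube (s * f x)).
Proof.
apply: measurable_funM; first by apply: measurable_funX; exact: measurable_funM.
apply: measurable_minr => //; apply: measurableT_comp => //; exact: measurable_funM.
Qed.

Let tci (s : R) : intg P (fun x => trunc_cube (s * f x)).
Proof.
apply: (@intg_le _ _ _ P _ (fun x => s ^+ 2 * f x ^+ 2)) => //.
  by apply: intgZ.
move=> x; rewrite -exprMn [leRHS]ger0_norm ?sqr_ge0// ger0_norm ?trunc_cube_ge0//.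
by rewrite /trunc_cube ler_piMr ?sqr_ge0// ge_min lexx.
Qed.

(** The error made when the conditional variance V^*(f^2) is replaced by its mean inside the
    integral with the remaining sum. *)
Definition clt_err (s th : R) k :=
  `|\int[P]_x ((f x ^+ 2 - var) * cos (s * M k (S x) - th))|.

(** Second order expansion in the new summand f around A, a function of S x: the linear term
    vanishes since V^* f = 0, and f^2 is replaced by [var]. The phase [th] covers cosine and sine
    together, that is, both parts of the characteristic function. *)
Lemma char_step (s th : R) k :
  `|\int[P]_x cos (s * M k.+1 x - th) -
    (1 - s ^+ 2 * var / 2) * \int[P]_x cos (s * M k x - th)| <=
  s ^+ 2 / 2 * clt_err s th k + 3 * \int[P]_x trunc_cube (s * f x).
Proof.
pose A x := s * M k (S x) - th.
have mMS : measurable_fun setT (fun x => M k (S x)) by exact: measurableT_comp.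
have mcA : measurable_fun setT (fun x => cos (A x)) by exact: mcos.
have icA : intg P (fun x => cos (A x)) by exact: intg_bounded mcA _.
have ci : intg P (fun x => cos (s * M k.+1 x - th)) by apply: (intg_bounded P (M := 1)) => //; exact: mcos.
have fsi : intg P (fun x => f x * sin (A x)) by apply: (intgM_bounded fi (M := 1)) => //; exact: msin.
have fci : intg P (fun x => f x ^+ 2 * cos (A x)) by apply: (intgM_bounded f2i (M := 1)).
have vci : intg P (fun x => (f x ^+ 2 - var) * cos (A x)).
  by apply: (@intgM_bounded _ _ _ P _ _ 1) => //; apply: intgB => //; exact: intg_cst.
have z0 : \int[P]_x (f x * sin (A x)) = 0.
  apply: (@adj0_dual _ _ _ P S mpS f (fun y => sin (s * M k y - th))) => //; exact: msin.
have cE : \int[P]_x cos (A x) = \int[P]_x cos (s * M k x - th).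
  rewrite -(@mp_Rint _ _ _ P S mpS (fun x => cos (s * M k x - th)))//.
  by apply: (intg_bounded P (M := 1)) => //; exact: mcos.
have E1 : \int[P]_x (cos (A x) - s * (f x * sin (A x)) - s ^+ 2 / 2 * (f x ^+ 2 * cos (A x))) =
   (1 - s ^+ 2 * var / 2) * \int[P]_x cos (s * M k x - th) -
   s ^+ 2 / 2 * \int[P]_x ((f x ^+ 2 - var) * cos (A x)).
  have i1 := intgZ s fsi; have i2 := intgZ (s ^+ 2 / 2) fci.
  rewrite RintB//; last exact: intgB.
  rewrite RintB// RintZ// z0 mulr0 subr0 RintZ// cE.
  have E x : (f x ^+ 2 - var) * cos (A x) = f x ^+ 2 * cos (A x) - var * cos (A x) by ring.
  have -> : \int[P]_x ((f x ^+ 2 - var) * cos (A x)) =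
      \int[P]_x (f x ^+ 2 * cos (A x)) - var * \int[P]_x cos (s * M k x - th).
    under eq_Rintegral do rewrite E.
    by rewrite (RintB fci) ?RintZ ?cE//; exact: intgZ.
  by field.
have H : `|\int[P]_x (cos (s * M k.+1 x - th) - (cos (A x) - s * (f x * sin (A x)) - s ^+ 2 / 2 * (f x ^+ 2 * cos (A x))))|
   <= 3 * \int[P]_x trunc_cube (s * f x).
  have i3 : intg P (fun x => cos (A x) - s * (f x * sin (A x)) - s ^+ 2 / 2 * (f x ^+ 2 * cos (A x))).
    by apply: intgB; [apply: intgB => //; exact: intgZ|exact: intgZ].
  rewrite -RintZ//; apply: le_trans (Rint_norm _) _; first exact: intgB.
  apply: Rint_le; [by apply: intg_norm; exact: intgB|exact: intgZ|move=> x].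
  have -> : s * M k.+1 x - th = A x + s * f x by rewrite /A /M bsumS; ring.
  by have := cos_taylor (A x) (s * f x); congr (`|_| <= _); ring.
move: H; rewrite RintB// ?E1; last first.
  by apply: intgB; [apply: intgB => //; exact: intgZ|exact: intgZ].
rewrite /clt_err -/(A _) => H.
set I0 := \int[P]_x cos (s * M k.+1 x - th) in H *.
set B := \int[P]_x ((f x ^+ 2 - var) * cos (A x)) in H *.
rewrite (_ : I0 - _ = (I0 - ((1 - s ^+ 2 * var / 2) * \int[P]_x cos (s * M k x - th) - s ^+ 2 / 2 * B)) - s ^+ 2 / 2 * B); last by ring.
apply: le_trans (ler_normB _ _) _; rewrite addrC lerD//.
by rewrite normrM ger0_norm// divr_ge0// sqr_ge0.
Qed.

(* The first [j] summands of [M k] are negligible for small [s]; the rest is a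
   function of [S^(j+1)], against which [f^2 - var] decorrelates by exactness. *)
Lemma clt_err_small (th e : R) : 0 < e ->
  exists2 s0 : R, 0 < s0 & forall s k, `|s| <= s0 -> clt_err s th k <= e.
Proof.
move=> e0; pose h x := f x ^+ 2 - var.
have hi : intg P h by apply: intgB => //; exact: intg_cst.
have h0 : \int[P]_x h x = 0 by rewrite RintB ?Rint_cst ?subrr//; exact: intg_cst.
have e2 : 0 < e / 2 by rewrite divr_gt0.
(* The depth [j] is fixed before the size of s: after j + 1 applications of V^*, the function f^2 -
   var has small L_1 norm. *)
have /cvgr0Pnorm_lt/(_ _ e2)[j _ Hj] := exact_adj_cvg1 exS hi h0.
have {}Hj : nrm P 1 (adj P (iter j.+1 S) h) < e / 2.
  by have := Hj j.+1 (leqnSn _); rewrite /= ger0_norm ?nrm_ge0.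
pose B x := bsum S (fun x => `|f x|) j (S x).
have mnf : measurable_fun setT (fun x => `|f x|) by exact: measurableT_comp.
have mB : measurable_fun setT B by exact: (measurableT_comp (measurable_bsum mpS j mnf) mS).
have B0 x : 0 <= B x by apply: sumr_ge0.
have mh : measurable_fun setT h := intg_measurable hi.
have mhn : measurable_fun setT (fun x => `|h x|) by exact: measurableT_comp.
(* This bounds the effect of removing the first j summands: two cosines differ by at most 2, and by
   at most the difference of their arguments. *)
pose rho (s : R) := \int[P]_x (`|h x| * Num.min 2 (s * B x)).
have mmin (s : R) : measurable_fun setT (fun x => Num.min 2 (s * B x)).
  by apply: measurable_minr => //; exact: measurable_funM.
have min2 s x : 0 <= s -> `|Num.min 2 (s * B x)| <= 2.
  by move=> s0; rewrite ger0_norm ?ge_min ?lexx// le_min ler0n mulr_ge0.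
have rhoi s : 0 <= s -> intg P (fun x => `|h x| * Num.min 2 (s * B x)).
  by move=> s0; apply: (intgM_bounded (intg_norm hi) (M := 2)) => // x; exact: min2.
have rho0 : rho (n.+1%:R^-1) @[n --> \oo] --> (0:R).
  rewrite -(Rintegral_zero P).
  apply: (@Rint_dct _ _ _ P _ _ (fun x => 2 * `|h x|) _ _ _ _ _).2.
  - by move=> n; exact: measurable_funM.
  - exact: measurable_cst.
  - by apply: intgZ; exact: intg_norm.
  - apply: aeW => x; rewrite -(mulr0 `|h x|); apply: cvgM; first exact: cvg_cst.
    apply: (@squeeze_cvgr _ _ _ _ (fun=> 0) (fun n => n.+1%:R^-1 * B x)).
    + by apply: nearW => n; rewrite ge_min lexx orbT andbT le_min ler0n mulr_ge0.
    + exact: cvg_cst.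
    + have H : n.+1%:R^-1 * B x @[n --> \oo] --> 0 * B x.
        by apply: cvgM; [exact: cvg_harmonic|exact: cvg_cst].
      by rewrite mul0r in H.
  - apply: aeW => x n; rewrite normrM normr_id mulrC ler_wpM2r//; exact: min2.
have /cvgr0Pnorm_lt/(_ _ e2)[n _ Hn] := rho0.
have {}Hn : rho (n.+1%:R^-1) < e / 2.
  have := Hn n (leqnn _); rewrite /= ger0_norm//; apply: Rint_ge0 => x.
  by rewrite mulr_ge0// le_min ler0n mulr_ge0.
exists n.+1%:R^-1; first by rewrite invr_gt0.
move=> s k sn.
have [c [mc cM cE]] : exists c : Y -> R, [/\ measurable_fun setT c, (forall y, `|c y| <= 1) &
    forall x, `|cos (s * M k (S x) - th) - c (iter j.+1 S x)| <= Num.min 2 (n.+1%:R^-1 * B x)].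
  have le2 (u v : R) : `|u| <= 1 -> `|v| <= 1 -> `|u - v| <= 2.
    by move=> u1 v1; apply: le_trans (ler_normB _ _) _; lra.
  (* With at most j summands nothing is left after the removal, and [c] is constant. *)
  have [kj|kj] := leqP k j.
    exists (fun=> cos (- th)); split => // x; rewrite le_min le2//=.
    apply: le_trans (cos_lip _ _) _; rewrite addrK normrM ler_pM//.
    rewrite /M /B -(subnKC kj) bsum_add -[leLHS]addr0 lerD ?sumr_ge0//.
    exact: ler_norm_sum.
  exists (fun y => cos (s * M (k - j) y - th)); split => //; first exact: mcos.
  move=> x; rewrite le_min le2//=; apply: le_trans (cos_lip _ _) _.
  rewrite /M -{1}(subnKC (ltnW kj)) bsum_add -[S (iter j S x)]/(iter j.+1 S x) iterSr.
  rewrite (_ : _ - _ = s * bsum S f j (S x)); last by ring.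
  by rewrite normrM ler_pM//; exact: ler_norm_sum.
rewrite /clt_err -/(h _).
have i1 : intg P (fun x => h x * cos (s * M k (S x) - th)).
  by apply: (intgM_bounded hi (M := 1)) => //; apply: mcos; exact: measurableT_comp.
have mcS : measurable_fun setT (fun x => c (iter j.+1 S x)).
  by apply: (measurableT_comp mc); exact: (mp_iter j.+1 mpS).1.
have i2 : intg P (fun x => h x * c (iter j.+1 S x)) by apply: (intgM_bounded hi (M := 1)).
have -> : \int[P]_x (h x * cos (s * M k (S x) - th)) =
   \int[P]_x (h x * (cos (s * M k (S x) - th) - c (iter j.+1 S x))) + \int[P]_x (h x * c (iter j.+1 S x)).
  under [X in _ = X + _]eq_Rintegral do rewrite mulrBr.
  by rewrite RintB// subrK.
apply: le_trans (ler_normD _ _) _; rewrite [e](_ : e = e / 2 + e / 2); last by field.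
apply: lerD.
  apply/ltW/(le_lt_trans _ Hn).
  have i3 : intg P (fun x => h x * (cos (s * M k (S x) - th) - c (iter j.+1 S x))).
    by under eq_fun do rewrite mulrBr; exact: intgB.
  apply: le_trans (Rint_norm i3) _; apply: Rint_le; [exact: intg_norm|exact: rhoi|].
  by move=> x; rewrite normrM ler_wpM2l.
rewrite -(adj_dual (mp_iter j.+1 mpS) hi mc cM).
have Ai := adj_intg (mp_iter j.+1 mpS) hi.
have i4 := intgM_bounded Ai mc cM.
apply/ltW/(le_lt_trans _ Hj); rewrite -Rint_le_nrm1//.
apply: le_trans (Rint_norm i4) _; apply: Rint_le; [exact: intg_norm|exact: intg_norm|].
by move=> x; rewrite normrM ler_piMr.
Qed.

(** Lindeberg's condition by dominated convergence: the integrand is at most t^2 f^2 min(1, |t f| /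
    sqrt n). *)
Lemma trunc_cube_small (t e : R) : 0 < e ->
  \forall n \near \oo, n%:R * \int[P]_x trunc_cube (t / Num.sqrt n%:R * f x) <= e.
Proof.
move=> e0.
have sn (n : nat) : n%:R * (t / Num.sqrt n%:R) ^+ 2 <= t ^+ 2.
  case: n => [|n]; first by rewrite mul0r sqr_ge0.
  by rewrite expr_div_n sqr_sqrtr// mulrCA divff ?mulr1.
pose g (n : nat) (x : Y) : R := n%:R * trunc_cube (t / Num.sqrt n%:R * f x).
have mg n : measurable_fun setT (g n) by apply: measurable_funM => //.
have g0 n x : 0 <= g n x by rewrite mulr_ge0// trunc_cube_ge0.
have gb n x : g n x <= t ^+ 2 * f x ^+ 2 * Num.min 1 `|t / Num.sqrt n%:R * f x|.
  rewrite /g /trunc_cube mulrA; apply: ler_wpM2r; first by rewrite le_min ler01/=.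
  by rewrite exprMn mulrA ler_wpM2r ?sqr_ge0.
have : \int[P]_x g n x @[n --> \oo] --> (0:R).
  rewrite -(Rintegral_zero P).
  apply: (@Rint_dct _ _ _ P _ _ (fun x => t ^+ 2 * f x ^+ 2) _ _ _ _ _).2 => //.
  - exact: intgZ.
  - apply: aeW => x.
    have sc : (Num.sqrt n%:R)^-1 @[n --> \oo] --> (0 : R).
      apply/cvgr0Pnorm_lt => u u0; near=> n.
      have n1 : u ^- 2 < n%:R by near: n; exact: nbhs_infty_gtr.
      have n0 : 0 < n%:R :> R by apply: lt_trans n1; rewrite invr_gt0 exprn_gt0.
      rewrite ger0_norm ?invr_ge0// invf_plt ?posrE ?sqrtr_gt0//.
      rewrite -(@ltr_pXn2r _ 2)// ?nnegrE ?invr_ge0 ?(ltW u0)// sqr_sqrtr ?(ltW n0)//.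
      by rewrite exprVn.
    apply: (@squeeze_cvgr _ _ _ _ (fun=> 0) (fun n => t ^+ 2 * f x ^+ 2 * (`|t * f x| * (Num.sqrt n%:R)^-1))).
    + apply: nearW => n; rewrite g0/=; apply: le_trans (gb n x) _.
      apply: ler_wpM2l; first by rewrite mulr_ge0 ?sqr_ge0.
      rewrite ge_min; apply/orP; right.
      by rewrite mulrAC normrM ler_wpM2l// ger0_norm// invr_ge0.
    + exact: cvg_cst.
    + have H : t ^+ 2 * f x ^+ 2 * (`|t * f x| * (Num.sqrt n%:R)^-1) @[n --> \oo] -->
          t ^+ 2 * f x ^+ 2 * (`|t * f x| * 0).
        by apply: cvgM; [exact: cvg_cst|apply: cvgM => //; exact: cvg_cst].
      by rewrite !mulr0 in H.
  - apply: aeW => x n; rewrite ger0_norm//; apply: le_trans (gb n x) _.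
    by apply: ler_piMr; [rewrite mulr_ge0 ?sqr_ge0|rewrite ge_min lexx].
move=> /cvgr0Pnorm_lt/(_ _ e0); apply: filterS => n; rewrite ger0_norm; last first.
  exact: Rint_ge0.
by move=> /ltW; rewrite /g RintZ//.
Unshelve. all: by end_near. Qed.

(** Each of the n steps multiplies the integral by exp(-y), y = t^2 var / (2 n), up to an error e /
    n; since exp(-y) <= 1, the errors only add up. *)
Lemma martingale_clt_char (t th : R) :
  \int[P]_x cos (t / Num.sqrt n%:R * M n x - th) @[n --> \oo] -->
  expR (- (t ^+ 2 * var / 2)) * cos th.
Proof.
have v0 : 0 <= var by apply: Rint_ge0 => x; exact: sqr_ge0.
apply/cvgrPdist_le => e e0.
pose v := t ^+ 2 * var / 2; have v'0 : 0 <= v by rewrite /v divr_ge0// mulr_ge0// sqr_ge0.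
have e1 : 0 < e / 3 by rewrite divr_gt0.
(* Over n steps the covariance error is multiplied by t^2 / 2; dividing by t^2 / 2 + 1 instead
   covers t = 0 as well. *)
have t1 : 0 < t ^+ 2 / 2 + 1 by rewrite ltr_wpDl// divr_ge0// sqr_ge0.
have [s0 s00 Hs] := clt_err_small th (divr_gt0 e1 t1).
near=> n.
have n0 : (0 < n)%N by near: n; exact: nbhs_infty_gt.
have nR : 0 < n%:R :> R by rewrite ltr0n.
pose s := t / Num.sqrt n%:R.
have s2 : s ^+ 2 = t ^+ 2 / n%:R by rewrite /s expr_div_n sqr_sqrtr// ltW.
have ss0 : `|s| <= s0.
  rewrite -(@ler_pXn2r _ 2)// ?nnegrE ?(ltW s00)// real_normK ?num_real// s2.
  rewrite ler_pdivrMr// mulrC -ler_pdivrMr ?exprn_gt0//.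
  by near: n; exact: nbhs_infty_ger.
pose y := v / n%:R.
have y01 : 0 <= y <= 1.
  rewrite divr_ge0//= ler_pdivrMr// mul1r; near: n; exact: nbhs_infty_ger.
have yv : y = s ^+ 2 * var / 2 by rewrite /y /v s2; field; rewrite gt_eqF.
pose c k := \int[P]_x cos (s * M k x - th).
have cb k : `|c k| <= 1.
  have ci : intg P (fun x => cos (s * M k x - th)) by apply: (intg_bounded P (M := 1)) => //; exact: mcos.
  apply: le_trans (Rint_norm ci) _; apply: Rint_le_bound => //; exact: intg_norm.
have H3 : n%:R * (3 * \int[P]_x trunc_cube (s * f x)) <= e / 3.
  have : n%:R * \int[P]_x trunc_cube (t / Num.sqrt n%:R * f x) <= e / 3 / 3.
    by near: n; apply: trunc_cube_small; rewrite !divr_gt0.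
  rewrite -/s; lra.
have H4 : n%:R * y ^+ 2 <= e / 3.
  have -> : n%:R * y ^+ 2 = v ^+ 2 / n%:R by rewrite /y; field; rewrite gt_eqF.
  rewrite ler_pdivrMr// mulrC -ler_pdivrMr//.
  by near: n; exact: nbhs_infty_ger.
(* The three thirds of e pay for the covariance error, the Taylor remainder, and the passage from 1
   - y to exp(-y). *)
have step k : `|c k.+1 - expR (- y) * c k| <= e / n%:R.
  have h1 := char_step s th k.
  have h2 := expRN_bounds y01.
  rewrite -[c k.+1 - _](subrKA ((1 - y) * c k)) (_ : (1 - y) * c k - _ = (1 - y - expR (- y)) * c k); last by ring.
  apply: le_trans (ler_normD _ _) _.
  rewrite yv in h2 *; rewrite -/(c _) -/(c _) in h1.
  apply: le_trans (lerD h1 (_ : _ <= y ^+ 2)) _.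
    by rewrite normrM yv -[leRHS]mulr1 ler_pM.
  rewrite ler_pdivlMr// mulrC !mulrDr.
  have : n%:R * (s ^+ 2 / 2 * clt_err s th k) <= e / 3.
    apply: (@le_trans _ _ (t ^+ 2 / 2 * (e / 3 / (t ^+ 2 / 2 + 1)))).
      have -> : n%:R * (s ^+ 2 / 2 * clt_err s th k) = t ^+ 2 / 2 * clt_err s th k.
        by rewrite s2; field; rewrite gt_eqF.
      by rewrite ler_wpM2l ?divr_ge0 ?sqr_ge0// Hs.
    rewrite mulrA ler_pdivrMr// mulrC ler_wpM2l ?(ltW e1)//; lra.
  lra.
have tele k : `|c k - expR (- y) ^+ k * c 0%N| <= k%:R * (e / n%:R).
  elim: k => [|k IH]; first by rewrite expr0 mul1r subrr normr0 mul0r.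
  rewrite exprS -mulrA -[c k.+1 - _](subrKA (expR (- y) * c k)) -mulrBr.
  apply: le_trans (ler_normD _ _) _; rewrite -natr1 mulrDl mul1r addrC lerD//.
  rewrite normrM; apply: le_trans IH; rewrite ler_piMl// ger0_norm ?expR_ge0//.
  by rewrite -[leRHS]expR0 ler_expR oppr_le0; case/andP: y01.
have c0 : c 0%N = cos th.
  rewrite /c -(Rint_cst P (cos th)); apply: eq_Rintegral => x _.
  by rewrite /M bsum0 mulr0 sub0r cosN.
have := tele n; rewrite mulrCA mulfV ?gt_eqF// mulr1 -expRM_natl c0 distrC.
by rewrite -[X in expR X](_ : - v = _)//; rewrite /y -mulr_natl mulrN mulrCA mulfV ?gt_eqF// mulr1.
Unshelve. all: by end_near. Qed.

Lemma martingale_var n : nrm P 2 (M n) ^+ 2 = n%:R * var.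
Proof.
elim: n => [|n IH].
  by rewrite (_ : M 0 = fun=> 0) ?nrm0 ?expr0n ?mul0r//; apply/funext => x; rewrite /M bsum0.
have ML := bsum_Lp mpS n (isT : (0 < 2)%N) fL.
have [MSL MSn] := mp_Lp mpS (isT : (0 < 2)%N) ML.
rewrite nrm2E; last exact: (bsum_Lp mpS n.+1 (isT : (0 < 2)%N) fL).
have i1 := (L2_mul fL MSL).1.
have i2 : intg P (fun x => M n (S x) ^+ 2) by have := (L2_mul MSL MSL).1.
have E x : M n.+1 x ^+ 2 = f x ^+ 2 + 2 * (f x * M n (S x)) + M n (S x) ^+ 2.
  by rewrite /M bsumS; ring.
under eq_Rintegral do rewrite E.
rewrite RintD//; last by apply: intgD => //; exact: intgZ.
rewrite RintD//; last exact: intgZ.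
rewrite RintZ// (adj0_dual mpS fi f0 (mM n))// mulr0 addr0.
by rewrite -(nrm2E MSL) MSn IH -natr1 mulrDl mul1r addrC.
Qed.

End martingale_clt.

(** * Characteristic function of the Gaussian law *)

Section gaussian_fourier.
Context (R : realType).
Variables (s : R) (s0 : s != 0).
Local Notation leb := (@lebesgue_measure R).
Local Notation p := (normal_pdf 0 s).

Lemma normal_intg_bounded (h : R -> R) M : measurable_fun setT h ->
  (forall z, `|h z| <= M) -> intg leb (fun z => h z * p z).
Proof.
move=> mh hM.
apply: (@intg_le _ _ _ leb (fun z => h z * p z) (fun z => M * p z)).
- by apply: measurable_funM => //; exact: measurable_normal_pdf.
- by apply: intgZ; exact: integrable_normal_pdf.
- by move=> z; apply: le_trans (ler_norm _); rewrite normrM (ger0_norm (normal_pdf_ge0 _ _ _)) ler_wpM2r ?normal_pdf_ge0.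
Qed.

(** Half of the Gaussian exponent absorbs the factor |z|, and the other half is a density of
    variance 2 s^2. This is the integrable majorant for z p(z) times a bounded function. *)
Lemma normal_pdf_moment : exists2 C, 0 <= C &
  forall z, `|z| * p z <= C * normal_pdf 0 (Num.sqrt 2 * s) z.
Proof.
have q0 : Num.sqrt 2 * s != 0 by rewrite mulf_neq0// sqrtr_eq0 -ltNge ltr0n.
exists ((1 + 4 * s ^+ 2) * (normal_peak s / normal_peak (Num.sqrt 2 * s))).
  apply: mulr_ge0; last by rewrite divr_ge0 ?normal_peak_ge0.
  by rewrite addr_ge0// mulr_ge0// sqr_ge0.
move=> z; rewrite !normal_pdfE// /normal_fun subr0 exprMn sqr_sqrtr//.
have pk : normal_peak (Num.sqrt 2 * s) != 0 by rewrite gt_eqF// normal_peak_gt0.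
have -> : forall c e, (1 + 4 * s ^+ 2) * (normal_peak s / c) * (c * e) = (normal_peak s * ((1 + 4 * s ^+ 2) * e)) * (c / c) :> R by move=> c e; ring.
rewrite divff// mulr1 mulrCA; apply: ler_wpM2l; first exact: normal_peak_ge0.
pose w := z ^+ 2 / (4 * s ^+ 2).
have s2 : s ^+ 2 != 0 by rewrite expf_neq0.
have -> : - z ^+ 2 / (s ^+ 2 *+ 2) = - w - w by rewrite /w -mulr_natr; field.
have -> : - z ^+ 2 / ((2 * s ^+ 2) *+ 2) = - w by rewrite /w -mulr_natr; field.
rewrite expRD mulrA; apply: ler_wpM2r; first exact: expR_ge0.
rewrite expRN ler_pdivrMr ?expR_gt0//.
have w0 : 0 <= w by rewrite /w divr_ge0// ?sqr_ge0// mulr_ge0// sqr_ge0.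
apply: (@le_trans _ _ (1 + 4 * s ^+ 2 * w)).
  have -> : 4 * s ^+ 2 * w = `|z| ^+ 2 by rewrite real_normK ?num_real// /w; field.
  by have := normr_ge0 z; nra.
have e1 : 1 + w <= expR w by exact: expR_ge1Dx.
have := sqr_ge0 s; nra.
Qed.

Lemma normal_intg_linear (h : R -> R) M : measurable_fun setT h ->
  (forall z, `|h z| <= M) -> intg leb (fun z => (z * h z) * p z).
Proof.
move=> mh hM; have [C C0 CE] := normal_pdf_moment.
apply: (@intg_le _ _ _ leb (fun z => (z * h z) * p z) (fun z => (M * C) * normal_pdf 0 (Num.sqrt 2 * s) z)).
- by apply: measurable_funM; [exact: measurable_funM|exact: measurable_normal_pdf].
- by apply: intgZ; exact: integrable_normal_pdf.
- move=> z; apply: le_trans (ler_norm _); rewrite !normrM (ger0_norm (normal_pdf_ge0 _ _ _)) mulrAC mulrC -mulrA.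
  by apply: ler_pM => //; rewrite mulr_ge0// normal_pdf_ge0.
Qed.

Lemma is_derive_normal_pdf (z : R) : is_derive z (1 : R) p (- (z / s ^+ 2) * p z).
Proof.
rewrite !normal_pdfE// /normal_fun.
have -> : (fun x : R => normal_peak s * expR (- (x - 0) ^+ 2 / (s ^+ 2 *+ 2))) =
  (fun x : R => normal_peak s * expR (- (s ^+ 2 *+ 2)^-1 * (x * x))).
  by apply/funext => x; congr (_ * expR _); rewrite subr0 mulNr mulNr mulrC expr2.
have s2 : s ^+ 2 != 0 by rewrite expf_neq0.
apply: is_derive_eq; rewrite /GRing.scale/= subr0.
have -> : - z ^+ 2 / (s ^+ 2 *+ 2) = - (s ^+ 2 *+ 2)^-1 * (z * z).
  by rewrite mulNr mulNr mulrC expr2.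
by rewrite -mulr_natr; field.
Qed.

(* The integral of the derivative of [sin (t z - th) * p z] vanishes. *)
Lemma normal_by_parts (t th : R) :
  t * \int[leb]_z (cos (t * z - th) * p z) =
  (s ^+ 2)^-1 * \int[leb]_z ((z * sin (t * z - th)) * p z).
Proof.
pose G (z : R) := sin (t * z - th) * p z.
pose g (z : R) := t * (cos (t * z - th) * p z) + (- (s ^+ 2)^-1) * ((z * sin (t * z - th)) * p z).
have dG (z : R) : is_derive z (1 : R) G (g z).
  have := is_derive_normal_pdf z => dp.
  by apply: is_derive_eq; rewrite /GRing.scale/= /g; ring.
have maff : measurable_fun setT (fun z : R => t * z - th).
  by apply: measurable_funB => //; exact: measurable_funM.
have mc : measurable_fun setT (fun z : R => cos (t * z - th)).
  by apply: measurableT_comp maff; apply: continuous_measurable_fun; exact: continuous_cos.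
have ms : measurable_fun setT (fun z : R => sin (t * z - th)).
  by apply: measurableT_comp maff; apply: continuous_measurable_fun; exact: continuous_sin.
have ic : intg leb (fun z => cos (t * z - th) * p z).
  by apply: (@normal_intg_bounded _ 1) => // z; rewrite ler_norml cos_geN1 cos_le1.
have is_ : intg leb (fun z => (z * sin (t * z - th)) * p z).
  by apply: (@normal_intg_linear _ 1) => // z; rewrite ler_norml sin_geN1 sin_le1.
have ig : intg leb g by apply: intgD; exact: intgZ.
suff I0 : \int[leb]_z g z = 0.
  apply/eqP; rewrite -subr_eq0 -mulNr; apply/eqP.
  by rewrite -[RHS]I0 /g RintD ?RintZ//; exact: intgZ.
have [C C0 CE] := normal_pdf_moment.
have q0 : Num.sqrt 2 * s != 0 by rewrite mulf_neq0// sqrtr_eq0 -ltNge ltr0n.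
have cg : continuous g.
  have cp : continuous p by exact: continuous_normal_pdf.
  have ca : continuous (fun z : R => t * z - th).
    by move=> z; apply: cvgB; [apply: cvgM; [exact: cvg_cst|exact: cvg_id]|exact: cvg_cst].
  move=> z; apply: cvgD; (apply: cvgM; [exact: cvg_cst|apply: cvgM; [|exact: cp]]).
    by apply: (continuous_comp (ca z)); exact: continuous_cos.
  by apply: cvgM; [exact: cvg_id|apply: (continuous_comp (ca z)); exact: continuous_sin].
(* The fundamental theorem of calculus is applied on bounded intervals; the boundary values of [G]
   decay like 1 / |z| because |z| p(z) is bounded. *)
pose g_ (n : nat) (z : R) := g z * \1_(`[- n.+1%:R, n.+1%:R]%classic : set R) z.
have Ig n : \int[leb]_z g_ n z = G n.+1%:R - G (- n.+1%:R).
  have n0 : - n.+1%:R < n.+1%:R :> R by apply: (@lt_trans _ _ 0); rewrite ?oppr_lt0 ltr0n.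
  rewrite -[RHS]/(fine ((G n.+1%:R)%:E - (G (- n.+1%:R))%:E)) -(@continuous_FTC2 _ g G)//.
  - rewrite -[RHS]/(\int[leb]_(x in `[- n.+1%:R, n.+1%:R]) g x) [RHS]Rintegral_mkcond.
    congr (Rintegral leb setT _); apply/funext => z.
    by rewrite /g_ patchE indicE; case: (z \in _); rewrite ?mulr1 ?mulr0.
  - exact: continuous_subspaceT.
  - have cG : continuous G by move=> z; apply: differentiable_continuous; apply/derivable1_diffP.
    split; first by move=> z _.
      exact/cvg_at_right_filter/cG.
    exact/cvg_at_left_filter/cG.
  - by move=> z _; rewrite derive1E; exact: derive_val.
have lim1 : \int[leb]_z g_ n z @[n --> \oo] --> \int[leb]_z g z.
  apply: (@Rint_dct _ _ _ leb _ _ (fun z => `|g z|) _ _ _ _ _).2.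
  - move=> n; apply: measurable_funM; first exact: intg_measurable ig.
    exact: measurable_indic.
  - exact: intg_measurable ig.
  - exact: intg_norm.
  - apply: aeW => z; apply: cvg_near_cst.
    exists (Num.bound `|z|) => // n /= bn.
    have zn : `|z| <= n.+1%:R.
      apply: ltW; apply: (@lt_le_trans _ _ (Num.bound `|z|)%:R); first exact: archi_boundP.
      by rewrite ler_nat ltnW.
    rewrite /g_ indicE mem_set ?mulr1//=.
    by rewrite in_itv/= -ler_norml.
  - apply: aeW => z n; rewrite /g_ normrM indicE; case: (_ \in _); rewrite ?normr1 ?normr0 ?mulr1 ?mulr0//.
have G0 (z : R) : z != 0 -> `|G z| <= C * normal_peak (Num.sqrt 2 * s) * `|z|^-1.
  move=> z0; rewrite ler_pdivlMr ?normr_gt0// mulrC.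
  apply: le_trans (le_trans (CE z) _); last first.
    by apply: ler_wpM2l => //; exact: normal_pdf_ub.
  apply: ler_wpM2l => //; rewrite /G normrM (ger0_norm (normal_pdf_ge0 _ _ _)).
  by apply: ler_piMl; [exact: normal_pdf_ge0|rewrite ler_norml sin_geN1 sin_le1].
apply: (cvg_unique _ lim1) => //.
pose K := C * normal_peak (Num.sqrt 2 * s).
apply: norm_cvg0 => /=.
have lim2 : (K + K) * n.+1%:R^-1 @[n --> \oo] --> (0 : R).
  by rewrite -[X in _ --> X](mulr0 (K + K)); apply: cvgM; [exact: cvg_cst|exact: cvg_harmonic].
apply: (@squeeze_cvgr _ _ _ _ (fun=>0) (fun n => (K + K) * n.+1%:R^-1)); [|exact: cvg_cst|exact: lim2].
apply: nearW => n; rewrite normr_ge0/= Ig.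
apply: le_trans (ler_normB _ _) _; rewrite mulrDl; apply: lerD.
  by apply: le_trans (G0 _ _) _; rewrite ?pnatr_eq0// ger0_norm.
by apply: le_trans (G0 _ _) _; rewrite ?oppr_eq0 ?pnatr_eq0// normrN ger0_norm.
Qed.

(** As a function of t the integral satisfies F' = - s^2 t F, by differentiation under the integral
    and [normal_by_parts]; hence F(t) exp(s^2 t^2 / 2) is constant, equal to F(0) = cos th. *)
Lemma normal_cos_lebesgue (t th : R) :
  \int[leb]_z (cos (t * z - th) * p z) = expR (- (t ^+ 2 * s ^+ 2 / 2)) * cos th.
Proof.
pose F (t : R) := \int[leb]_z (cos (t * z - th) * p z).
have s2 : s ^+ 2 != 0 by rewrite expf_neq0.
have mc (u : R) : measurable_fun setT (fun z : R => cos (u * z - th)).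
  apply: (measurableT_comp (f := cos)).
    by apply: continuous_measurable_fun; exact: continuous_cos.
  by apply: measurable_funB => //; exact: measurable_funM.
have ic u : intg leb (fun z => cos (u * z - th) * p z).
  by apply: (@normal_intg_bounded _ 1) => // z; rewrite ler_norml cos_geN1 cos_le1.
have dc (u z : R) : is_derive u (1 : R) (fun u => cos (u * z - th) * p z) (- ((z * sin (u * z - th)) * p z)).
  by apply: is_derive_eq; rewrite /GRing.scale/=; ring.
have dF (u : R) : is_derive u (1 : R) F (- (s ^+ 2 * u * F u)).
  have d1 : partial1of2 (fun (u z : R) => cos (u * z - th) * p z) =
            fun u z => - ((z * sin (u * z - th)) * p z).
    by apply/funext => v; apply/funext => z; rewrite partial1of2E derive_val.
  have [C C0 CE] := normal_pdf_moment.
  have Iu : (`]u - 1, u + 1[%classic : set R) u.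
    by rewrite /= in_itv/= ltrBlDr ltrDl ltr01.
  have H1 : forall x, (`]u - 1, u + 1[%classic : set R) x -> leb.-integrable setT (EFin \o (fun z => cos (x * z - th) * p z)).
    by move=> x _; exact: ic.
  have H2 : forall x y, (`]u - 1, u + 1[%classic : set R) x -> setT y -> derivable (fun u : R => cos (u * y - th) * p y) x 1.
    by [].
  have H3 : forall y, 0 <= C * normal_pdf 0 (Num.sqrt 2 * s) y.
    by move=> y; rewrite mulr_ge0// normal_pdf_ge0.
  have H4 : intg leb (fun y => C * normal_pdf 0 (Num.sqrt 2 * s) y).
    by apply: intgZ; exact: integrable_normal_pdf.
  have H5 : forall x y, (`]u - 1, u + 1[%classic : set R) x -> setT y ->
     `|partial1of2 (fun (u z : R) => cos (u * z - th) * p z) x y| <= C * normal_pdf 0 (Num.sqrt 2 * s) y.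
    move=> x y _ _; rewrite d1 normrN !normrM (ger0_norm (normal_pdf_ge0 _ _ _)).
    apply: le_trans (CE y); apply: ler_wpM2r; first exact: normal_pdf_ge0.
    by rewrite ler_piMr// ler_norml sin_geN1 sin_le1.
  have dd := derivable_under_integral measurableT Iu H1 H2 H3 H4 H5.
  have de := differentiation_under_integral measurableT Iu H1 H2 H3 H4 H5.
  apply: DeriveDef; first exact: dd.
  rewrite -derive1E de d1.
  have -> : s ^+ 2 * u * F u = \int[leb]_z ((z * sin (u * z - th)) * p z).
    by rewrite -mulrA /F normal_by_parts mulrA divff// mul1r.
  transitivity (\int[leb]_z ((-1) * ((z * sin (u * z - th)) * p z))).
    by congr (Rintegral leb setT _); apply/funext => z; rewrite mulN1r.
  rewrite RintZ ?mulN1r//.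
  apply: (@normal_intg_linear _ 1); last by move=> z; rewrite ler_norml sin_geN1 sin_le1.
  apply: (measurableT_comp (f := sin)).
    by apply: continuous_measurable_fun; exact: continuous_sin.
  by apply: measurable_funB => //; exact: measurable_funM.
pose H (u : R) := F u * expR (s ^+ 2 / 2 * (u * u)).
have dH (u : R) : is_derive u (1 : R) H 0.
  have dFu := dF u.
  by apply: is_derive_eq; rewrite /GRing.scale/=; field.
have H0 : H t = H 0 by exact: is_derive_0_is_cst.
have F0 : F 0 = cos th.
  rewrite /F; under eq_Rintegral do rewrite mul0r sub0r cosN.
  rewrite RintZ; last exact: integrable_normal_pdf.
  by rewrite /Rintegral integral_normal_pdf mulr1.
move: H0; rewrite /H F0 !mul0r mulr0 expR0 mulr1 => <-.
rewrite -/(F t) mulrCA -expRD; have -> : - (t ^+ 2 * s ^+ 2 / 2) + s ^+ 2 / 2 * (t * t) = 0 by field.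
by rewrite expR0 mulr1.
Qed.

Lemma Rintegral_normal_prob (h : R -> R) M : measurable_fun setT h ->
  (forall z, `|h z| <= M) ->
  \int[normal_prob 0 s]_z h z = \int[leb]_z (h z * p z).
Proof.
move=> mh hM.
have ih : (normal_prob 0 s : {measure set _ -> \bar R}).-integrable setT (EFin \o h).
  exact: (intg_bounded (normal_prob 0 s) mh hM).
rewrite /Rintegral -(Radon_Nikodym_change_of_variables (normal_prob_dominates 0 s))//=.
congr fine.
apply: ae_eq_integral => //.
- apply: emeasurable_funM => //; first exact: measurable_int ih.
  apply: (measurable_int leb).
  by apply: Radon_Nikodym_integrable; exact: normal_prob_dominates.
- by apply/measurable_EFinP; apply: measurable_funM => //; exact: measurable_normal_pdf.
- set r := Radon_Nikodym _ _.
  suff key : ae_eq leb setT r (EFin \o p).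
    by apply: filterS key => z /(_ I) kz _; rewrite kz.
  rewrite /r {r}.
  rewrite Radon_NikodymE//=; first exact: normal_prob_dominates.
  move=> abmu; case: cid => /= k [k1 k2 k3].
  apply: integral_ae_eq => //=.
  + by apply/measurable_EFinP; exact: measurable_normal_pdf.
  + by move=> E _ mE; rewrite -k3.
Qed.

Lemma normal_cos (t th : R) :
  \int[normal_prob 0 s]_z cos (t * z - th) = expR (- (t ^+ 2 * s ^+ 2 / 2)) * cos th.
Proof.
rewrite (@Rintegral_normal_prob _ 1) ?normal_cos_lebesgue//.
  apply: (measurableT_comp (f := cos)).
    by apply: continuous_measurable_fun; exact: continuous_cos.
  by apply: measurable_funB => //; exact: measurable_funM.
by move=> z; rewrite ler_norml cos_geN1 cos_le1.
Qed.

End gaussian_fourier.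
(** * Continuity theorem for characteristic functions *)

Section bernstein.
Context (R : realType).
Implicit Types (u : R) (phi psi : nat -> R).

(* The expectation of [phi] at a binomial variable with parameters [n] and [u]. *)
Fixpoint bern u n phi : R :=
  if n is n'.+1 then u * bern u n' (phi \o S) + (1 - u) * bern u n' phi else phi 0.

Lemma bern_lin u n a b phi psi :
  bern u n (fun k => a * phi k + b * psi k) = a * bern u n phi + b * bern u n psi.
Proof.
elim: n phi psi => [//|n IH] phi psi /=.
by rewrite IH -[X in bern u n X]/(fun k => a * (phi \o S) k + b * (psi \o S) k) IH; ring.
Qed.

Lemma bern_cst u n c : bern u n (fun=> c) = c.
Proof. by elim: n => [//|n IH] /=; rewrite -[X in bern u n X]/(fun=> c) IH; ring. Qed.

Lemma bern_le u n phi psi : 0 <= u <= 1 -> (forall k, phi k <= psi k) ->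
  bern u n phi <= bern u n psi.
Proof.
move=> /andP[u0 u1]; elim: n phi psi => [|n IH] phi psi le_pp /=; first exact: le_pp.
by apply: lerD; apply: ler_wpM2l; rewrite ?subr_ge0//; apply: IH => k /=.
Qed.

(** The offset c carries the induction: one trial moves it by u - 1 or by u. For c = 0 this is the
    binomial variance. *)
Lemma bern_variance u n c :
  bern u n (fun k => (k%:R - n%:R * u - c) ^+ 2) = n%:R * (u * (1 - u)) + c ^+ 2.
Proof.
elim: n c => [|n IH] c /=; first by ring.
have -> : ((fun k : nat => (k%:R - n.+1%:R * u - c) ^+ 2) \o S) =
  (fun k : nat => (k%:R - n%:R * u - (c + u - 1)) ^+ 2).
  by apply/funext => k /=; rewrite -!natr1; ring.
have -> : (fun k : nat => (k%:R - n.+1%:R * u - c) ^+ 2) =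
  (fun k : nat => (k%:R - n%:R * u - (c + u)) ^+ 2).
  by apply/funext => k /=; rewrite -!natr1; ring.
by rewrite !IH -natr1; ring.
Qed.

(** Chebyshev's argument: the quadratic error averages to K / n^2 times the variance n u (1 - u), at
    most K / n. *)
Lemma bern_approx u n (F : R -> R) c e K : 0 <= u <= 1 -> (0 < n)%N -> 0 <= K ->
  (forall v, `|F v - c| <= e + K * (v - u) ^+ 2) ->
  `|bern u n (fun k => F (k%:R / n%:R)) - c| <= e + K / n%:R.
Proof.
move=> u01 n0 K0 Fe.
have n0' : (n%:R : R) != 0 by rewrite pnatr_eq0 -lt0n.
have ub : bern u n (fun k => e + K * (k%:R / n%:R - u) ^+ 2) <= e + K / n%:R.
  have -> : (fun k : nat => e + K * (k%:R / n%:R - u) ^+ 2) =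
    (fun k : nat => 1 * e + K / n%:R ^+ 2 * (k%:R - n%:R * u - 0) ^+ 2).
    by apply/funext => k; field.
  rewrite (bern_lin u n 1 (K / n%:R ^+ 2) (fun=> e)) bern_cst bern_variance mul1r lerD2l.
  rewrite expr0n/= addr0.
  have -> : K / n%:R ^+ 2 * (n%:R * (u * (1 - u))) = K / n%:R * (u * (1 - u)) by field.
  rewrite ler_piMr//; first by rewrite divr_ge0.
  by move: u01 => /andP[u0 u1]; nra.
have -> : bern u n (fun k => F (k%:R / n%:R)) - c = bern u n (fun k => F (k%:R / n%:R) - c).
  rewrite -{1}(bern_cst u n c) -[RHS]/(bern u n (fun k => F (k%:R / n%:R) - c)).
  have -> : (fun k : nat => F (k%:R / n%:R) - c) = (fun k : nat => 1 * F (k%:R / n%:R) + (-1) * c).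
    by apply/funext => k; ring.
  by rewrite (bern_lin u n 1 (-1) (fun k => F (k%:R / n%:R)) (fun=> c)); ring.
rewrite ler_norml; apply/andP; split.
  apply: (@le_trans _ _ (- bern u n (fun k => e + K * (k%:R / n%:R - u) ^+ 2))); first by rewrite lerN2.
  have -> : - bern u n (fun k => e + K * (k%:R / n%:R - u) ^+ 2) =
      bern u n (fun k => (-1) * (e + K * (k%:R / n%:R - u) ^+ 2) + 0 * 0).
    by rewrite (bern_lin u n (-1) 0 (fun k => e + K * (k%:R / n%:R - u) ^+ 2) (fun=> 0)); ring.
  apply: bern_le => // k; rewrite mul0r addr0 mulN1r.
  by have := Fe (k%:R / n%:R); rewrite ler_norml => /andP[].
apply: le_trans ub; apply: bern_le => // k.
by have := Fe (k%:R / n%:R); rewrite ler_norml => /andP[].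
Qed.

Lemma bern_bounded u n phi M : 0 <= u <= 1 -> (forall k, `|phi k| <= M) ->
  `|bern u n phi| <= M.
Proof.
move=> u01 pM; rewrite ler_norml; apply/andP; split.
  by rewrite -(bern_cst u n (- M)); apply: bern_le => // k; have := pM k; rewrite ler_norml => /andP[].
by rewrite -[leRHS](bern_cst u n M); apply: bern_le => // k; have := pM k; rewrite ler_norml => /andP[].
Qed.

(* [arcsin] turns a continuous function on [[-L, L]] into one of [u = (1 + sin (y / L)) / 2],
   whose Bernstein polynomials are trigonometric polynomials in [y]. *)
Lemma trig_modulus (phi : R -> R) (L M e : R) : continuous phi -> 0 < L -> 0 < e ->
  0 <= M -> (forall y, `|phi y| <= M) ->
  exists2 K, 0 <= K & forall y v, `|y| <= L ->
    `|phi (L * asin (2 * v - 1)) - phi y| <= e + K * (v - (1 + sin (y / L)) / 2) ^+ 2.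
Proof.
move=> cphi L0 e0 M0 phiM.
pose u (y : R) := (1 + sin (y / L)) / 2.
pose F (v : R) := phi (L * asin (2 * v - 1)).
have cu : continuous u.
  move=> y; apply: cvgM; last exact: cvg_cst.
  apply: cvgD; first exact: cvg_cst.
  apply: (@continuous_comp _ _ _ (fun y : R => y / L) sin); last exact: continuous_sin.
  by apply: cvgM; [exact: cvg_id|exact: cvg_cst].
(* Since pi / 2 > 1, the points y / L lie strictly inside the interval where [asin] inverts [sin],
   so the values of [sin] avoid the end points and [asin] is continuous there. *)
have pi2 : 1 < pi / 2 :> R.
  rewrite lt_neqAle pihalf_ge1 andbT; apply/eqP => p1.
  have c1 : cos 1 = 0 :> R by rewrite p1 cos_pihalf.
  by have := @cos_ge_quad R 1 ler01; rewrite c1; lra.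
have yL (y : R) : `|y| <= L -> - 1 <= y / L <= 1.
  by move=> yL; rewrite -ler_norml normrM normfV (gtr0_norm L0) ler_pdivrMr// mul1r.
have Fu (y : R) : `|y| <= L -> F (u y) = phi y.
  move=> /yL /andP[y1 y2]; rewrite /F /u.
  have -> : 2 * ((1 + sin (y / L)) / 2) - 1 = sin (y / L) by field.
  rewrite sinK; last by rewrite in_itv/=; apply/andP; split; lra.
  by rewrite mulrC divfK// gt_eqF.
have cF (y : R) : `|y| <= L -> {for u y, continuous F}.
  move=> /yL /andP[y1 y2].
  have sy : -1 < sin (y / L) < 1.
    rewrite -[X in X < _ < _]opprK -{1}(@sin_pihalf R) -{2}(@sin_pihalf R) -sinN opprK.
    by rewrite !ltr_sin ?in_itv/=; apply/andP; split; rewrite ?in_itv/=; lra.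
  apply: (@continuous_comp _ _ _ (fun v : R => L * asin (2 * v - 1)) phi); last exact: cphi.
  apply: cvgM; first exact: cvg_cst.
  apply: (@continuous_comp _ _ _ (fun v : R => 2 * v - 1) asin).
    by apply: cvgB; [apply: cvgM; [exact: cvg_cst|exact: cvg_id]|exact: cvg_cst].
  by apply: continuous_asin; rewrite /u; have -> : 2 * ((1 + sin (y / L)) / 2) - 1 = sin (y / L) by field.
(* Compactness of [-L, L] makes the radius of continuity uniform in y. *)
have : \forall i \near (0:R)^'+, (`[- L, L]%classic : set R) `<=`
    (fun y => forall v, `|v - u y| < i -> `|F v - phi y| <= e).
  apply: (compact_near_coveringP _).1; first exact: segment_compact.
  move=> y; rewrite /= in_itv/= -ler_norml => Ly.
  have e2 : 0 < e / 2 by lra.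
  have /cvgrPdist_lt/(_ _ e2) := cF y Ly; rewrite near_simpl => /nbhs_ballP[r /= r0 Hr].
  have /cvgrPdist_lt/(_ _ e2) Hp := cphi y.
  have r2 : 0 < r / 2 by lra.
  have /cvgrPdist_lt/(_ _ r2) Hu := cu y.
  near=> y' i => v /= vi.
  have A1 : `|phi y - phi y'| < e / 2 by near: y'.
  have A2 : `|u y - u y'| < r / 2 by near: y'.
  have ir : i < r / 2 by near: i; exact: nbhs_right_lt.
  have A3 : `|F (u y) - F v| < e / 2.
    apply: Hr; rewrite /ball/=.
    have -> : u y - v = (u y - u y') - (v - u y') by ring.
    by apply: le_lt_trans (ler_normB _ _) _; lra.
  have -> : F v - phi y' = - (F (u y) - F v) + (phi y - phi y') by rewrite Fu//; ring.
  by apply: le_trans (ler_normD _ _) _; rewrite normrN; lra.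
move=> near_del; near (0:R)^'+ => del.
have del0 : 0 < del by near: del; exact: nbhs_right_gt.
have Hd : (`[- L, L]%classic : set R) `<=`
    (fun y => forall v, `|v - u y| < del -> `|F v - phi y| <= e) by near: del.
(* At distance del or more the quadratic term alone reaches 2 M, the trivial bound on the
   difference. *)
exists (2 * M / del ^+ 2); first by rewrite divr_ge0 ?sqr_ge0// mulr_ge0.
move=> y v Ly; have Ky : (`[- L, L]%classic : set R) y by rewrite /= in_itv/= -ler_norml.
have [vd|vd] := ltP `|v - u y| del.
  apply: (@le_trans _ _ e); first exact: Hd.
  by rewrite lerDl mulr_ge0// ?sqr_ge0// divr_ge0 ?sqr_ge0// mulr_ge0.
apply: (@le_trans _ _ (2 * M)).
  by apply: le_trans (ler_normB _ _) _; have := phiM y; have := phiM (L * asin (2 * v - 1)); lra.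
apply: (@le_trans _ _ (2 * M / del ^+ 2 * (v - u y) ^+ 2)); last by rewrite lerDr ltW.
rewrite mulrAC ler_pdivlMr ?exprn_gt0//; apply: ler_wpM2l; first by rewrite mulr_ge0.
by rewrite -(real_normK (num_real (v - u y))) ler_pXn2r// nnegrE// ltW.
Unshelve. all: by end_near.
Qed.

End bernstein.

Section levy.
Context d (X : measurableType d) (R : realType).
Variables (P : probability X R) (nu : probability (measurableTypeR R) R).
Variables (Z : nat -> X -> R) (C : R).
Hypothesis mZ : forall n, measurable_fun setT (Z n).
Hypothesis Z2 : forall n, intg P (fun x => Z n x ^+ 2).
Hypothesis ZC : forall n, \int[P]_x (Z n x ^+ 2) <= C.
Hypothesis Zcos : forall t th : R,
  \int[P]_x cos (t * Z n x - th) @[n --> \oo] --> \int[nu]_y cos (t * y - th).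

(** The class is closed under linear combinations and contains the cosines; [test_bern] deduces that
    it contains the approximating polynomials. *)
Let test (g : R -> R) := [/\ measurable_fun setT g, exists M, forall y, `|g y| <= M &
  \int[P]_x g (Z n x) @[n --> \oo] --> \int[nu]_y g y].

Let test_intg g : test g -> (forall n, intg P (fun x => g (Z n x))) /\ intg nu g.
Proof.
move=> [mg [M gM] _]; split=> [n|].
  by apply: (@intg_bounded _ _ _ P _ M) => //; exact: measurableT_comp.
exact: (@intg_bounded _ _ _ nu _ M).
Qed.

Let test_lin a b g h : test g -> test h -> test (fun y => a * g y + b * h y).
Proof.
move=> tg th; have [ig jg] := test_intg tg; have [ih jh] := test_intg th.
move: tg th => [mg [M gM] cg] [mh [N hN] ch]; split.
- by apply: measurable_funD; exact: measurable_funM.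
- exists (`|a| * M + `|b| * N) => y; apply: le_trans (ler_normD _ _) _.
  by rewrite !normrM lerD// ler_wpM2l.
- rewrite (RintD (P := nu)); [|exact: intgZ|exact: intgZ].
  rewrite !RintZ//.
  rewrite [X in X @ _ --> _](_ : _ = fun n => a * \int[P]_x g (Z n x) + b * \int[P]_x h (Z n x)).
    by apply: cvgD; (apply: cvgM; first exact: cvg_cst).
  by apply/funext => n; rewrite RintD ?RintZ//; exact: intgZ.
Qed.

Let test_cos t th : test (fun y => cos (t * y - th)).
Proof.
split; last exact: Zcos.
  apply: (measurableT_comp (f := cos)).
    by apply: continuous_measurable_fun; exact: continuous_cos.
  by apply: measurable_funB => //; exact: measurable_funM.
by exists 1 => y; rewrite ler_norml cos_geN1 cos_le1.
Qed.

(** The factor cos (t y - th) closes the induction: multiplied by (1 + sin (y / L)) / 2 or (1 - sin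
    (y / L)) / 2, it becomes a combination of three cosines of the same kind. *)
Let test_bern L n phi t th :
  test (fun y => bern ((1 + sin (y / L)) / 2) n phi * cos (t * y - th)).
Proof.
elim: n phi t th => [|n IH] phi t th /=.
  have := test_lin (phi 0) 0 (test_cos t th) (test_cos t th).
  by under eq_fun do rewrite mul0r addr0.
pose b psi t th (y : R) := bern ((1 + sin (y / L)) / 2) n psi * cos (t * y - th).
have main psi (s : R) : test (fun y => (1 / 2) * b psi t th y +
    (s / 4) * (1 * b psi (t + L^-1) (th + pi / 2) y + 1 * b psi (L^-1 - t) (pi / 2 - th) y)).
  by apply: test_lin; [exact: IH|apply: test_lin; exact: IH].
have := test_lin 1 1 (main (phi \o S) 1) (main phi (-1)).
congr test; apply/funext => y.
have cp (z : R) : cos (z - pi / 2) = sin z by rewrite cosBpihalf.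
have -> : b (phi \o S) (t + L^-1) (th + pi / 2) y = bern ((1 + sin (y / L)) / 2) n (phi \o S) * sin (y / L + (t * y - th)).
  by rewrite /b; congr (_ * _); rewrite -cp; congr cos; ring.
have -> : b (phi \o S) (L^-1 - t) (pi / 2 - th) y = bern ((1 + sin (y / L)) / 2) n (phi \o S) * sin (y / L - (t * y - th)).
  by rewrite /b; congr (_ * _); rewrite -cp; congr cos; ring.
have -> : b phi (t + L^-1) (th + pi / 2) y = bern ((1 + sin (y / L)) / 2) n phi * sin (y / L + (t * y - th)).
  by rewrite /b; congr (_ * _); rewrite -cp; congr cos; ring.
have -> : b phi (L^-1 - t) (pi / 2 - th) y = bern ((1 + sin (y / L)) / 2) n phi * sin (y / L - (t * y - th)).
  by rewrite /b; congr (_ * _); rewrite -cp; congr cos; ring.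
by rewrite /b (sinD (y / L) (t * y - th)) (sinB (y / L) (t * y - th)); field.
Qed.

(** Bounded second moments control the tails of [Z n] through Chebyshev; on [-L, L] the function is
    uniformly close to a Bernstein polynomial, for which convergence is known. *)
Lemma levy_bounded_continuous (phi : R -> R) M : continuous phi ->
  (forall y, `|phi y| <= M) ->
  \int[P]_x phi (Z n x) @[n --> \oo] --> \int[nu]_y phi y.
Proof.
move=> cphi phiM.
have M0 : 0 <= M by apply: le_trans (phiM 0).
have mphi : measurable_fun setT phi by exact: continuous_measurable_fun.
pose tail (L : nat) (y : R) : R := if `|y| <= L%:R then 0 else 1.
have mtail L : measurable_fun setT (tail L).
  by apply: measurable_fun_ifT => //; apply: measurable_fun_ler => //; exact: measurableT_comp.
have tail01 L y : 0 <= tail L y <= 1 by rewrite /tail; case: ifP; rewrite ?lexx ?ler01.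
have tail1 L y : `|tail L y| <= 1 by have /andP[t0 t1] := tail01 L y; rewrite ger0_norm.
have nutail : \int[nu]_y tail L y @[L --> \oo] --> (0 : R).
  rewrite -(Rintegral_zero nu).
  apply: (@Rint_dct _ _ _ nu _ _ (fun=> 1) _ _ _ _ _).2 => //.
  - exact: intg_cst.
  - apply: aeW => y; apply: cvg_near_cst.
    exists (Num.bound `|y|) => // L /= bL; rewrite /tail ifT//.
    by apply: ltW; apply: lt_le_trans (archi_boundP (normr_ge0 _)) _; rewrite ler_nat.
  - by apply: aeW => y L.
have Ztail L n : (0 < L)%N -> \int[P]_x tail L (Z n x) <= C / L%:R ^+ 2.
  move=> L0; have L0' : 0 < L%:R :> R by rewrite ltr0n.
  rewrite ler_pdivlMr ?exprn_gt0// mulrC -RintZ; last first.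
    by apply: (@intg_bounded _ _ _ P _ 1) => //; exact: measurableT_comp.
  apply: le_trans (ZC n); apply: Rint_le => //.
    by apply: intgZ; apply: (@intg_bounded _ _ _ P _ 1) => //; exact: measurableT_comp.
  move=> x; rewrite /tail; case: ifPn; first by rewrite mulr0 sqr_ge0.
  rewrite -ltNge mulr1 => Lz; rewrite -(real_normK (num_real (Z n x))).
  by rewrite ler_pXn2r ?nnegrE// ltW.
apply/cvgrPdist_le => e e0.
have C0 : 0 <= C by apply: le_trans (ZC 0); apply: Rint_ge0 => x; exact: sqr_ge0.
(* The two comparisons with the polynomial [b] cost 3 e' each and its convergence costs e', 7 e' in
   all. *)
pose e' := e / 8.
have e'0 : 0 < e' by rewrite /e'; lra.
have ev1 : \forall L \near \oo, `|0 - 2 * M * \int[nu]_y tail L y| <= e'.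
  have : 2 * M * \int[nu]_y tail k y @[k --> \oo] --> (0:R).
    by rewrite -(mulr0 (2 * M)); apply: cvgM; [exact: cvg_cst|exact: nutail].
  by move=> /cvgrPdist_le/(_ _ e'0).
have [k _ ev2] : \forall n \near \oo, `|0 - 2 * M * C * n.+1%:R^-1| <= e'.
  have : 2 * M * C * n.+1%:R^-1 @[n --> \oo] --> (0:R).
    by rewrite -(mulr0 (2 * M * C)); apply: cvgM; [exact: cvg_cst|exact: cvg_harmonic].
  by move=> /cvgrPdist_le/(_ _ e'0).
near \oo => L.
have L0 : (0 < L)%N by near: L; exact: nbhs_infty_gt.
have nuL : 2 * M * \int[nu]_y tail L y <= e'.
  suff : `|0 - 2 * M * \int[nu]_y tail L y| <= e'.
    by rewrite sub0r normrN; apply: le_trans; exact: ler_norm.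
  by near: L.
have ZL : 2 * M * (C / L%:R ^+ 2) <= e'.
  apply: (@le_trans _ _ (2 * M * C * L%:R^-1)).
    rewrite mulrA; apply: ler_wpM2l; first by rewrite !mulr_ge0.
    by rewrite lef_pV2 ?posrE ?exprn_gt0 ?ltr0n// -{1}(expr1 L%:R) ler_weXn2l// ler1n.
  have kL : (k < L)%N by near: L; exact: nbhs_infty_gt.
  have := ev2 L.-1; rewrite /= prednK// -ltnS prednK// => /(_ kL).
  by rewrite sub0r normrN; apply: le_trans; exact: ler_norm.
have LR : 0 < L%:R :> R by rewrite ltr0n.
have [K K0 HK] := trig_modulus cphi LR e'0 M0 phiM.
have [N N0 KN] : exists2 N, (0 < N)%N & K / N%:R <= e'.
  exists (Num.bound (K / e')).+1 => //; rewrite ler_pdivrMr ?ltr0n// mulrC -ler_pdivrMr//.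
  apply: ltW; apply: lt_trans (archi_boundP _) _; first by rewrite divr_ge0// ltW.
  by rewrite ltr_nat.
pose b (y : R) := bern ((1 + sin (y / L%:R)) / 2) N (fun k => phi (L%:R * asin (2 * (k%:R / N%:R) - 1))).
have tb : test b.
  have := test_bern L%:R N (fun k => phi (L%:R * asin (2 * (k%:R / N%:R) - 1))) 0 0.
  by under eq_fun do rewrite mul0r subr0 cos0 mulr1.
have [ib jb] := test_intg tb; have [_ _ cb] := tb.
have u01 (y : R) : 0 <= (1 + sin (y / L%:R)) / 2 <= 1.
  by have := sin_geN1 (y / L%:R); have := sin_le1 (y / L%:R); move=> s1 s2; apply/andP; split; lra.
have pb y : `|phi y - b y| <= 2 * e' + 2 * M * tail L y.
  rewrite distrC /tail; case: ifPn => [yL|_].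
    rewrite mulr0 addr0.
    have := @bern_approx R _ N (fun v => phi (L%:R * asin (2 * v - 1))) (phi y) e' K (u01 y) N0 K0 (fun v => HK y v yL).
    by move=> /le_trans; apply; lra.
  rewrite mulr1; have bM : `|b y| <= M by exact: bern_bounded.
  by apply: le_trans (ler_normB _ _) _; have := phiM y; lra.
have close d' (Y : measurableType d') (Q : probability Y R) (W : Y -> R) : measurable_fun setT W ->
    intg Q (fun x => b (W x)) -> 2 * M * \int[Q]_x tail L (W x) <= e' ->
    `|\int[Q]_x phi (W x) - \int[Q]_x b (W x)| <= 3 * e'.
  move=> mW ibW QL.
  have ip : intg Q (fun x => phi (W x)).
    by apply: (@intg_bounded _ _ _ Q _ M) => //; exact: measurableT_comp.
  have it : intg Q (fun x => tail L (W x)).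
    by apply: (@intg_bounded _ _ _ Q _ 1) => //; exact: measurableT_comp.
  rewrite -RintB//; apply: le_trans (Rint_norm (intgB ip ibW)) _.
  have i1 : intg Q (fun=> 2 * e') by exact: intg_cst.
  have i2 := intgZ (2 * M) it.
  apply: le_trans (Rint_le (intg_norm (intgB ip ibW)) (intgD i1 i2) (fun x => pb (W x))) _.
  by rewrite RintD// RintZ// Rint_cst; lra.
have c2 : `|\int[nu]_y phi y - \int[nu]_y b y| <= 3 * e' by exact: (@close _ _ nu id).
near=> n.
have c1 : `|\int[P]_x phi (Z n x) - \int[P]_x b (Z n x)| <= 3 * e'.
  apply: close => //; apply: le_trans ZL; apply: ler_wpM2l; first by rewrite mulr_ge0.
  exact: Ztail.
have c3 : `|\int[nu]_y b y - \int[P]_x b (Z n x)| <= e'.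
  by near: n; move: cb => /cvgrPdist_le; exact.
have -> : \int[nu]_y phi y - \int[P]_x phi (Z n x) = (\int[nu]_y phi y - \int[nu]_y b y) +
  (\int[nu]_y b y - \int[P]_x b (Z n x)) - (\int[P]_x phi (Z n x) - \int[P]_x b (Z n x)) by ring.
apply: le_trans (ler_normB _ _) _.
have := ler_normD (\int[nu]_y phi y - \int[nu]_y b y) (\int[nu]_y b y - \int[P]_x b (Z n x)).
by rewrite /e' in c1 c2 c3 *; lra.
Unshelve. all: by end_near.
Qed.

End levy.
(** * Product spaces *)

Section power_measure.
Context {disp : measure_display} {R : realType} {X : measurableType disp}.
Variable mu : probability X R.

Lemma measurable_tcons_section m (x : X) :
  measurable_fun setT (fun t : m.-tuple X => tcons (x, t)).
Proof.
apply: (measurableT_comp (f := @tcons _ X m)); first exact: measurable_tcons.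
exact: measurable_pair1.
Qed.

Lemma pow_section_measurable m (G : m.+1.-tuple X -> R) (x : X) :
  measurable_fun setT G -> measurable_fun setT (fun t => G (tcons (x, t))).
Proof. by move=> mG; apply: (measurableT_comp mG); exact: measurable_tcons_section. Qed.

(** Tonelli's theorem transported along [tcons], of which [power_prob] is by construction the image
    measure. *)
Lemma pow_ge0_integral m (G : m.+1.-tuple X -> \bar R) :
  measurable_fun setT G -> (forall y, (0 <= G y)%E) ->
  measurable_fun setT (fun x => \int[mu \^ m]_t G (tcons (x, t)))%E /\
  (\int[mu \^ m.+1]_y G y = \int[mu]_x \int[mu \^ m]_t G (tcons (x, t)))%E.
Proof.
move=> mG G0.
have mG' : measurable_fun setT (G \o @tcons _ X m).
  by apply: measurableT_comp => //; exact: measurable_tcons.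
split; first exact: (@measurable_fun_fubini_tonelli_F _ _ _ _ _ (mu \^ m) (G \o @tcons _ X m) mG' (fun p => G0 _)).
rewrite /= ge0_integral_distribution//.
exact: (@fubini_tonelli1 _ _ _ _ _ mu (mu \^ m) (G \o @tcons _ X m) mG' (fun p => G0 _)).
Qed.

Lemma pow_ge0_Rint m (G : m.+1.-tuple X -> R) : measurable_fun setT G ->
  (forall y, 0 <= G y) -> (forall x, intg (mu \^ m) (fun t => G (tcons (x, t)))) ->
  [/\ measurable_fun setT (fun x => \int[mu \^ m]_t G (tcons (x, t))),
    intg (mu \^ m.+1) G <-> intg mu (fun x => \int[mu \^ m]_t G (tcons (x, t))) &
    \int[mu \^ m.+1]_y G y = \int[mu]_x \int[mu \^ m]_t G (tcons (x, t))].
Proof.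
move=> mG G0 iG.
have mG' : measurable_fun setT (EFin \o G) by exact/measurable_EFinP.
have [mI EI] := pow_ge0_integral mG' (fun y => eq_ind_r is_true (G0 y) (lee_fin 0 (G y))).
have E1 x : (\int[mu \^ m]_t (EFin \o G) (tcons (x, t)))%E = (\int[mu \^ m]_t G (tcons (x, t)))%:E.
  by rewrite EFin_Rint.
have mI' : measurable_fun setT (fun x => \int[mu \^ m]_t G (tcons (x, t))).
  by apply/measurable_EFinP; move: mI; under eq_fun do rewrite E1.
have E2 : (\int[mu \^ m.+1]_y (G y)%:E = \int[mu]_x (\int[mu \^ m]_t G (tcons (x, t)))%:E)%E.
  by rewrite [LHS]EI; apply: eq_integral => x _; exact: E1.
split => //; last by rewrite /Rintegral E2.
have I0 x : 0 <= \int[mu \^ m]_t G (tcons (x, t)) by exact: Rint_ge0.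
split=> /integrableP[_ H]; apply/integrableP; split; do ?exact/measurable_EFinP.
  move: H; congr (_ < _)%E; under eq_integral do rewrite gee0_abs ?lee_fin//.
  by rewrite E2; apply: eq_integral => x _; rewrite gee0_abs ?lee_fin.
move: H; congr (_ < _)%E; under [RHS]eq_integral do rewrite gee0_abs ?lee_fin//.
by rewrite [RHS]E2; apply: eq_integral => x _; rewrite gee0_abs ?lee_fin.
Qed.

(** All sections are asked to be integrable, not almost all, so that the inner integrals are
    additive at every point; products of tensors with bounded functions comply. *)
Lemma pow_Rint m (G : m.+1.-tuple X -> R) : intg (mu \^ m.+1) G ->
  (forall x, intg (mu \^ m) (fun t => G (tcons (x, t)))) ->
  intg mu (fun x => \int[mu \^ m]_t G (tcons (x, t))) /\
  \int[mu \^ m.+1]_y G y = \int[mu]_x \int[mu \^ m]_t G (tcons (x, t)).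
Proof.
move=> iG iS.
have iA := intg_norm iG; have iB := intgD iA iG.
have sA x := intg_norm (iS x); have sB x := intgD (sA x) (iS x).
have B0 y : 0 <= `|G y| + G y by have := ler_norm (- G y); rewrite normrN; lra.
have [_ HA eA] := pow_ge0_Rint (intg_measurable iA) (fun y => normr_ge0 (G y)) sA.
have [_ HB eB] := pow_ge0_Rint (intg_measurable iB) B0 sB.
have jA := HA.1 iA; have jB := HB.1 iB.
have E x : \int[mu \^ m]_t G (tcons (x, t)) =
    \int[mu \^ m]_t (`|G (tcons (x, t))| + G (tcons (x, t))) - \int[mu \^ m]_t `|G (tcons (x, t))|.
  by rewrite RintD// addrAC subrr add0r.
have EE : (fun x => \int[mu \^ m]_t G (tcons (x, t))) = (fun x =>
    \int[mu \^ m]_t (`|G (tcons (x, t))| + G (tcons (x, t))) - \int[mu \^ m]_t `|G (tcons (x, t))|).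
  exact/funext.
rewrite EE; split; first exact: intgB.
by rewrite RintB// -eA -eB RintD// addrAC subrr add0r.
Qed.

Lemma measurable_tensor m (g : 'I_m -> X -> R) : (forall i, measurable_fun setT (g i)) ->
  measurable_fun setT (tensor g).
Proof.
move=> mg; apply: measurable_prod => i _.
by apply: (measurableT_comp (mg i)); exact: measurable_tnth.
Qed.

Lemma tensorS m (g : 'I_m.+1 -> X -> R) x t :
  tensor g (tcons (x, t)) = g ord0 x * tensor (fun i => g (lift ord0 i)) t.
Proof. by rewrite /tensor big_ord_recl; congr (_ * _); apply: eq_bigr => i _; rewrite tnthS. Qed.

Lemma tensor_intg m (g : 'I_m -> X -> R) : (forall i, intg mu (g i)) ->
  intg (mu \^ m) (tensor g) /\ \int[mu \^ m]_y tensor g y = \prod_i \int[mu]_x g i x.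
Proof.
elim: m g => [|m IH] g ig.
  have -> : tensor g = fun=> 1 by apply/funext => t; rewrite /tensor big_ord0.
  by rewrite big_ord0; split; [exact: intg_cst|exact: Rint_cst].
have mt : measurable_fun setT (tensor g) by apply: measurable_tensor => i; exact: intg_measurable (ig i).
have [i1 e1] := IH (fun i => g (lift ord0 i)) (fun i => ig _).
have [i2 e2] := IH (fun i x => `|g (lift ord0 i) x|) (fun i => intg_norm (ig _)).
have nt (x : X) (t : m.-tuple X) : `|tensor g (tcons (x, t))| = `|g ord0 x| * tensor (fun i x => `|g (lift ord0 i) x|) t.
  by rewrite tensorS normrM normr_prod.
have mnt : measurable_fun setT (fun y => `|tensor g y|) by exact: measurableT_comp.
have [||_ H _] := @pow_ge0_Rint m (fun y => `|tensor g y|) mnt.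
- by [].
- by move=> x; under eq_fun do rewrite nt; exact: intgZ.
have it : intg (mu \^ m.+1) (tensor g).
  suff : intg (mu \^ m.+1) (fun y => `|tensor g y|) by move=> /intg_le; apply => // y; rewrite normr_id.
  apply/H; have -> : (fun x => \int[mu \^ m]_t `|tensor g (tcons (x, t))|) =
      (fun x => \prod_i \int[mu]_x `|g (lift ord0 i) x| * `|g ord0 x|).
    by apply/funext => x; under eq_Rintegral do rewrite nt; rewrite RintZ// e2 mulrC.
  by apply: intgZ; exact: intg_norm.
split => //.
have is_ x : intg (mu \^ m) (fun t => tensor g (tcons (x, t))).
  by under eq_fun do rewrite tensorS; exact: intgZ.
rewrite (pow_Rint it is_).2 big_ord_recl mulrC.
rewrite -(RintZ _ (ig ord0)); apply: eq_Rintegral => x _.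
by under eq_Rintegral do rewrite tensorS; rewrite RintZ// e1 mulrC.
Qed.

Lemma tensor_Lp N m (g : 'I_m -> X -> R) : (0 < N)%N ->
  (forall i, g i \in Lfun mu N%:R%:E) ->
  tensor g \in Lfun (mu \^ m) N%:R%:E /\ nrm (mu \^ m) N (tensor g) = \prod_i nrm mu N (g i).
Proof.
move=> N0 gL.
have E (y : m.-tuple X) : `|tensor g y| ^+ N = tensor (fun i x => `|g i x| ^+ N) y.
  by rewrite /tensor normr_prod prodrXl.
have [i1 e1] := @tensor_intg m (fun i x => `|g i x| ^+ N) (fun i => ((LpP mu (g i) N0).1 (gL i)).2).
have L : tensor g \in Lfun (mu \^ m) N%:R%:E.
  apply/LpP => //; split; first by apply: measurable_tensor => i; exact: Lp_measurable (gL i).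
  by under eq_fun do rewrite E.
split => //; apply: (@pexpIrn _ N) => //; rewrite ?nnegrE ?nrm_ge0//.
  by apply: prodr_ge0 => i _; exact: nrm_ge0.
rewrite nrm_pow// -prodrXl; under eq_Rintegral do rewrite E.
by rewrite e1; apply: eq_bigr => i _; rewrite nrm_pow.
Qed.

End power_measure.

Section power_dynamics.
Context {disp : measure_display} {R : realType} {X : measurableType disp}.
Variables (mu : probability X R) (T : X -> X).
Hypothesis mpT : measure_preserving mu T.

Definition pow_map m (k : 'I_m -> nat) (x : m.-tuple X) : m.-tuple X :=
  [tuple iter (k i) T (tnth x i) | i < m].

Lemma pow_mapS m (k : 'I_m.+1 -> nat) x t :
  pow_map k (tcons (x, t)) = tcons (iter (k ord0) T x, pow_map (fun i => k (lift ord0 i)) t).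
Proof.
apply: eq_from_tnth => i; rewrite tnth_mktuple.
by case: (unliftP ord0 i) => [j|] ->; rewrite ?tnthS ?tnth_mktuple.
Qed.

Lemma pow_map_comp m (k l : 'I_m -> nat) :
  pow_map k \o pow_map l = pow_map (fun i => (k i + l i)%N).
Proof.
apply/funext => x /=; apply: eq_from_tnth => i.
by rewrite !tnth_mktuple iterD.
Qed.

Lemma pow_map0 m : pow_map (fun _ : 'I_m => 0%N) = id.
Proof. by apply/funext => x; apply: eq_from_tnth => i; rewrite tnth_mktuple. Qed.

Lemma measurable_pow_map m (k : 'I_m -> nat) : measurable_fun setT (pow_map k).
Proof.
apply/measurable_fun_tnthP => i.
rewrite (_ : _ \o _ = fun x => iter (k i) T (tnth x i)).
  by apply: (measurableT_comp (mp_iter (k i) mpT).1); exact: measurable_tnth.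
by apply/funext => x /=; rewrite tnth_mktuple.
Qed.

(** Induction on m by Tonelli for the indicator: the last coordinates are treated inside the
    integral, the first one outside. *)
Lemma mp_pow_map m (k : 'I_m -> nat) : measure_preserving (mu \^ m) (pow_map k).
Proof.
split; first exact: measurable_pow_map.
elim: m k => [|m IH] k A mA.
  by have -> : pow_map k = id by apply/funext => x; rewrite tuple0 [RHS]tuple0.
have mpS : measure_preserving (mu \^ m) (pow_map (fun i => k (lift ord0 i))).
  by split; [exact: measurable_pow_map|exact: IH].
have mkA : measurable (pow_map k @^-1` A).
  by rewrite -[X in measurable X]setTI; exact: measurable_pow_map.
have m1 : measurable_fun setT (EFin \o \1_A : m.+1.-tuple X -> \bar R).
  by apply/measurable_EFinP; exact: measurable_indic.
have ge1 (y : m.+1.-tuple X) : (0 <= (EFin \o \1_A : m.+1.-tuple X -> \bar R) y)%E by rewrite lee_fin.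
have m2 : measurable_fun setT (EFin \o \1_(pow_map k @^-1` A) : m.+1.-tuple X -> \bar R).
  by apply/measurable_EFinP; exact: measurable_indic.
have [mI1 e1] := pow_ge0_integral mu m1 ge1.
have ge2 (y : m.+1.-tuple X) : (0 <= (EFin \o \1_(pow_map k @^-1` A) : m.+1.-tuple X -> \bar R) y)%E by rewrite lee_fin.
have [_ e2] := pow_ge0_integral mu m2 ge2.
have I1 (B : set (m.+1.-tuple X)) : measurable B ->
    ((mu \^ m.+1) B = \int[mu \^ m.+1]_y (EFin \o \1_B) y)%E.
  by move=> mB; rewrite -[in LHS](setIT B) -integral_indic.
rewrite !I1//.
rewrite [LHS]e2 [RHS]e1.
rewrite -(mp_ge0_integral (mp_iter (k ord0) mpT) mI1); last by move=> x; apply: integral_ge0.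
apply: eq_integral => x _.
rewrite -[RHS](mp_ge0_integral mpS); last 2 first.
- apply: (measurableT_comp m1); exact: measurable_tcons_section.
- by [].
by apply: eq_integral => t _; rewrite /= -pow_mapS.
Qed.

Lemma tensor_pow_map m (g : 'I_m -> X -> R) k x :
  tensor g (pow_map k x) = tensor (fun i x => g i (iter (k i) T x)) x.
Proof. by apply: eq_bigr => i _; rewrite tnth_mktuple. Qed.

(** Here [a] stands for V^{*k} g. For k = 0 it may be g itself, which lets some coordinates stay
    untouched in [box_diff_tensor]. *)
Let dual_pair k (g a : X -> R) := [/\ intg mu g, intg mu a & forall (h : X -> R) M,
  measurable_fun setT h -> (forall x, `|h x| <= M) ->
  \int[mu]_x (a x * h x) = \int[mu]_x (g x * h (iter k T x))].

Lemma tensor_dual m (k : 'I_m -> nat) (g a : 'I_m -> X -> R) (h : m.-tuple X -> R) M :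
  (forall i, dual_pair (k i) (g i) (a i)) -> measurable_fun setT h -> (forall y, `|h y| <= M) ->
  \int[mu \^ m]_y (tensor a y * h y) =
  \int[mu \^ m]_y (tensor g y * h (pow_map k y)).
Proof.
elim: m k g a h => [|m IH] k g a h ga mh hM.

  apply: eq_Rintegral => x _; congr (_ * h _); last by rewrite tuple0 [RHS]tuple0.
  by rewrite /tensor !big_ord0.
have ig i : intg mu (g i) by have [] := ga i.
have ia i : intg mu (a i) by have [] := ga i.
have [it _] := tensor_intg ig; have [ita _] := tensor_intg ia.
have [it' _] := @tensor_intg _ _ _ mu _ (fun i => g (lift ord0 i)) (fun i => ig _).
have [ita' _] := @tensor_intg _ _ _ mu _ (fun i => a (lift ord0 i)) (fun i => ia _).
have msec (x : X) : measurable_fun setT (fun t => h (tcons (x, t))) by exact: pow_section_measurable.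
have mk : measurable_fun setT (fun y => h (pow_map k y)).
  by apply: (measurableT_comp mh); exact: measurable_pow_map.
(* The last m coordinates are integrated out by induction; the first factor is then paired with the
   bounded function [Phi]. *)
pose Phi (x : X) := \int[mu \^ m]_t (tensor (fun i => g (lift ord0 i)) t * h (tcons (x, pow_map (fun i => k (lift ord0 i)) t))).
have msec' (x : X) : measurable_fun setT (fun t => h (tcons (x, pow_map (fun i => k (lift ord0 i)) t))).
  by apply: (measurableT_comp (msec x)); exact: measurable_pow_map.
have PhiE x : Phi x = \int[mu \^ m]_t (tensor (fun i => a (lift ord0 i)) t * h (tcons (x, t))).
  exact: (esym (@IH (fun i => k (lift ord0 i)) (fun i => g (lift ord0 i)) (fun i => a (lift ord0 i)) (fun t => h (tcons (x, t)))
    (fun i => ga _) (msec x) (fun t => hM _))).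
have iP (x : X) : intg (mu \^ m) (fun t => tensor (fun i => g (lift ord0 i)) t * h (tcons (x, pow_map (fun i => k (lift ord0 i)) t))).
  exact: (intgM_bounded it' (M := M)).
have iQ (x : X) : intg (mu \^ m) (fun t => tensor (fun i => a (lift ord0 i)) t * h (tcons (x, t))).
  exact: (intgM_bounded ita' (M := M)).
(* Measurability comes from Fubini for the same integrand with first factor 1 and first exponent 0,
   whose inner integral is [Phi]. *)
have mPhi : measurable_fun setT Phi.
  have itb : intg (mu \^ m.+1) (fun y => tensor (fun i => if i == ord0 then (fun=> 1) else g i) y *
      h (pow_map (fun i => if i == ord0 then 0%N else k i) y)).
    apply: (intgM_bounded (M := M)) => //.
      by apply: (tensor_intg _).1 => i; case: ifP => _ //; exact: intg_cst.
    by apply: (measurableT_comp mh); exact: measurable_pow_map.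
  have E (x : X) t : tensor (fun i => if i == ord0 then (fun=> 1) else g i) (tcons (x, t)) *
      h (pow_map (fun i => if i == ord0 then 0%N else k i) (tcons (x, t))) =
      tensor (fun i => g (lift ord0 i)) t * h (tcons (x, pow_map (fun i => k (lift ord0 i)) t)).
    by rewrite tensorS/= mul1r pow_mapS.
  have [|i1 _] := pow_Rint itb; first by move=> x; under eq_fun do rewrite E.
  have -> : Phi = (fun x => \int[mu \^ m]_t (tensor (fun i => if i == ord0 then (fun=> 1) else g i) (tcons (x, t)) *
      h (pow_map (fun i => if i == ord0 then 0%N else k i) (tcons (x, t))))).
    by apply/funext => x; under [RHS]eq_Rintegral do rewrite E.
  exact: intg_measurable i1.
have PhiM x : `|Phi x| <= `|M| * \int[mu \^ m]_t `|tensor (fun i => g (lift ord0 i)) t|.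
  apply: le_trans (Rint_norm (iP x)) _; rewrite -RintZ; last exact: intg_norm.
  apply: Rint_le; [exact: intg_norm|by apply: intgZ; exact: intg_norm|].
  move=> t; rewrite normrM mulrC ler_wpM2r//; apply: le_trans (hM _) _; exact: ler_norm.
have L : \int[mu \^ m.+1]_y (tensor a y * h y) =
   \int[mu]_x (a ord0 x * Phi x).
  rewrite (pow_Rint (intgM_bounded ita mh hM) _).2.
    apply: eq_Rintegral => x _; rewrite PhiE -RintZ//.
    by apply: eq_Rintegral => t _; rewrite tensorS mulrA.
  by move=> x; under eq_fun do rewrite tensorS -mulrA; exact: intgZ.
have [_ _ a0] := ga ord0.
rewrite L (a0 _ _ mPhi PhiM).
rewrite (pow_Rint (intgM_bounded it mk (fun y => hM _)) _).2.
  apply: eq_Rintegral => x _; rewrite -RintZ//.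
  by apply: eq_Rintegral => t _; rewrite tensorS pow_mapS mulrA.
by move=> x; under eq_fun do rewrite tensorS pow_mapS -mulrA; exact: intgZ.
Qed.

(** V^* acts on an elementary tensor factor by factor; all computations with V^* on X^m rest on
    this. *)
Lemma adj_tensor m (k : 'I_m -> nat) (g a : 'I_m -> X -> R) :
  (forall i, dual_pair (k i) (g i) (a i)) ->
  adj (mu \^ m) (pow_map k) (tensor g) = tensor a %[ae mu \^ m].
Proof.
move=> ga; apply: adj_unique.
- exact: mp_pow_map.
- by apply: (tensor_intg _).1 => i; have [] := ga i.
- by apply: (tensor_intg _).1 => i; have [] := ga i.
- by move=> h M mh hM; exact: (tensor_dual ga mh hM).
Qed.

End power_dynamics.

(* Integrals of non-measurable functions are lower integrals, so only an inequality survives. *)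
Lemma ge0_le_integral_ae d (Y : measurableType d) (R : realType) (P : probability Y R)
    (a b : Y -> \bar R) : measurable_fun setT a -> (forall y, 0 <= a y)%E ->
  (forall y, 0 <= b y)%E -> a = b %[ae P] -> (\int[P]_y a y <= \int[P]_y b y)%E.
Proof.
move=> ma a0 b0 [N [mN N0 abN]].
pose a' := a \_ (~` N).
have -> : (\int[P]_y a y = \int[P]_y a' y)%E.
  apply: ae_eq_integral => //.
    apply: (measurable_restrictT _ _).1; first exact: measurableC.
    exact: measurable_funTS.
  exists N; split => // y /= H; apply: contrapT => nN; apply: H => _.
  by rewrite /a' patchE mem_set.
have a'0 y : (0 <= a' y)%E by rewrite /a' patchE; case: ifP.
rewrite !ge0_integralTE//; apply: ge_ereal_sup => _ [h /= ha <-].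
apply: ereal_sup_ubound; exists h => // y; apply: le_trans (ha y) _.
rewrite /a' patchE; case: ifPn => // /set_mem /= nN.
suff -> : a y = b y by [].
by apply: contrapT => H; apply: nN; apply: abN => /= /(_ I).
Qed.

(** The approximants [u] in the definition of [proj_norm] equal tensor sums a.e. only and may fail
    to be measurable; the measurable version [U] is no farther from [f]. *)
Lemma Lnorm_le_ae d (Y : measurableType d) (R : realType) (P : probability Y R) N
    (U u f : Y -> R) : U \in Lfun P N%:R%:E -> f \in Lfun P N%:R%:E -> (0 < N)%N -> U = u %[ae P] ->
  ('N[P]_(N%:R%:E)[EFin \o (fun y => U y - f y)%R] <= 'N[P]_(N%:R%:E)[EFin \o (fun y => u y - f y)%R])%E.
Proof.
move=> UL fL N0 Uu; rewrite unlock.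
apply: gt0_ler_poweR; [by rewrite invr_ge0|by rewrite in_itv/= leey integral_ge0|by rewrite in_itv/= leey integral_ge0|].
apply: ge0_le_integral_ae; [|by move=> y; exact: poweR_ge0|by move=> y; exact: poweR_ge0|].
  rewrite (_ : (fun y => _) = EFin \o (fun y => `|U y - f y| `^ N%:R)); last exact/funext.
  apply/measurable_EFinP; apply: (measurableT_comp (f := fun z : R => z `^ N%:R)) => //.
  apply: measurableT_comp => //.
  by apply: measurable_funB; [exact: Lp_measurable UL|exact: Lp_measurable fL].
by apply: filterS Uu => y Uy /(Uy) /= ->.
Qed.

(** * Series of elementary tensors *)

Section projective_series.
Context {disp : measure_display} {R : realType} {X : measurableType disp}.
Variables (mu : probability X R) (N m : nat).
Hypothesis N0 : (0 < N)%N.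
Implicit Types (h : 'I_m -> X -> R) (g : nat -> nat -> 'I_m -> X -> R) (v f : m.-tuple X -> R).

Let all_Lp (g : 'I_m -> X -> R) := forall i, g i \in Lfun mu N%:R%:E.

Definition cross_cost (g : 'I_m -> X -> R) := \prod_(i < m) nrm mu N (g i).

Lemma cross_cost_ge0 h : 0 <= cross_cost h.
Proof. by apply: prodr_ge0 => i _; exact: nrm_ge0. Qed.

Lemma alg_proj_norm_ge0 v : (0 <= alg_proj_norm mu N%:R v)%E.
Proof.
apply: le_ereal_inf_tmp => _ [K [g [_ _ ->]]]; rewrite lee_fin.
by apply: sumr_ge0 => j _; exact: cross_cost_ge0.
Qed.

Lemma alg_proj_norm_le (J : Type) (s : seq J) (G : J -> 'I_m -> X -> R) v :
  (forall a, all_Lp (G a)) -> v = (fun x => \sum_(a <- s) tensor (G a) x) %[ae mu \^ m] ->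
  (alg_proj_norm mu N%:R v <= (\sum_(a <- s) cross_cost (G a))%:E)%E.
Proof.
move=> GL vE; apply: ereal_inf_lbound.
exists (size s), (fun j => G (tnth (in_tuple s) j)); split.
- by move=> j i; exact: GL.
- by apply: filterS vE => x vx /vx ->; rewrite (big_tnth _ _ s).
- by rewrite (big_tnth _ _ s).
Qed.

Lemma alg_proj_norm_lt v (r : R) : (alg_proj_norm mu N%:R v < r%:E)%E ->
  exists (K : nat) (g : nat -> 'I_m -> X -> R), [/\ forall j, all_Lp (g j),
    v = (fun x => \sum_(0 <= j < K) tensor (g j) x) %[ae mu \^ m] &
    \sum_(0 <= j < K) cross_cost (g j) < r].
Proof.
move=> /ereal_inf_lt[_ [K [g [gL vE ->]]]]; rewrite lte_fin => cr.
(* The finite family is prolonged by zeros, to be indexed by natural numbers. *)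
pose g' (j : nat) : 'I_m -> X -> R := if insub j is Some i then g i else fun _ _ => 0.
have g'E (j : 'I_K) : g' j = g j by rewrite /g' valK.
exists K, g'; split.
- by move=> j i; rewrite /g'; case: insubP => [k _ _|_]; [exact: gL|exact: Lp0].
- by apply: filterS vE => x vx /vx ->; rewrite big_mkord; apply: eq_bigr => j _; rewrite g'E.
- rewrite big_mkord; apply: le_lt_trans cr; rewrite le_eqVlt; apply/orP; left; apply/eqP.
  by apply: eq_bigr => j _; rewrite g'E.
Qed.

Definition psum (K : nat -> nat) (g : nat -> nat -> 'I_m -> X -> R) n (x : m.-tuple X) : R :=
  \sum_(0 <= k < n) \sum_(0 <= j < K k) tensor (g k j) x.

Definition pcost (K : nat -> nat) (g : nat -> nat -> 'I_m -> X -> R) n : R :=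
  \sum_(0 <= k < n) \sum_(0 <= j < K k) cross_cost (g k j).

(* [f] is the sum of an absolutely convergent series of elementary tensors, grouped into finite blocks. *)
Definition proj_series K g (c : R) f : Prop :=
  [/\ forall k j, all_Lp (g k j), forall n, pcost K g n <= c, f \in Lfun (mu \^ m) N%:R%:E &
    nrm (mu \^ m) N (fun x => psum K g n x - f x) @[n --> \oo] --> (0:R)].

Lemma psum_Lp K g n : (forall k j, all_Lp (g k j)) -> psum K g n \in Lfun (mu \^ m) N%:R%:E.
Proof.
move=> gL; apply: (Lp_sum _ (F := fun k x => \sum_(0 <= j < K k) tensor (g k j) x)) => // k.
by apply: (Lp_sum _ (F := fun j x => tensor (g k j) x)) => // j; exact: (tensor_Lp N0 (gL k j)).1.
Qed.

Lemma pcost_nd K g : {homo pcost K g : a b / (a <= b)%N >-> a <= b}.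
Proof.
move=> a b ab; rewrite /pcost (@big_cat_nat _ _ _ a 0 b)//= lerDl.
by apply: sumr_ge0 => k _; apply: sumr_ge0 => j _; exact: cross_cost_ge0.
Qed.

Lemma psum_nrm K g n : (forall k j, all_Lp (g k j)) ->
  nrm (mu \^ m) N (psum K g n) <= pcost K g n.
Proof.
move=> gL.
have bL k : (fun x => \sum_(0 <= j < K k) tensor (g k j) x) \in Lfun (mu \^ m) N%:R%:E.
  by apply: (Lp_sum _ (F := fun j x => tensor (g k j) x)) => // j; exact: (tensor_Lp N0 (gL k j)).1.
apply: le_trans (nrm_sum _ (F := fun k x => \sum_(0 <= j < K k) tensor (g k j) x) N0 bL) _.
apply: ler_sum => k _.
apply: le_trans (nrm_sum _ (F := fun j x => tensor (g k j) x) N0 (fun j => (tensor_Lp N0 (gL k j)).1)) _.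
by apply: ler_sum => j _; rewrite (tensor_Lp N0 (gL k j)).2.
Qed.

Lemma proj_series_nrm K g c f : proj_series K g c f -> nrm (mu \^ m) N f <= c.
Proof.
move=> [gL gc fL cv].
have : nrm (mu \^ m) N (psum K g n) @[n --> \oo] --> nrm (mu \^ m) N f.
  by apply: nrm_cvg => // n; exact: psum_Lp.
move=> /cvgn_le; apply => n; apply: le_trans (gc n); exact: psum_nrm.
Qed.

(** Along a fast subsequence the approximants telescope into increments; each is a finite tensor sum
    of nearly optimal cost, so the total stays below c. Later proofs use the projective norm through
    this series. *)
Lemma proj_norm_lt f (c : R) : (proj_norm mu N%:R f < c%:E)%E ->
  exists K g, proj_series K g c f.
Proof.
move=> /ereal_inf_lt[l [fL [u [[ufin ucau] uf ul]]] lc].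
(* The first block costs less than [c1], and the room c - c1 pays for all increments, at most (c -
   c1) 2^-(k+1) each. *)
have [c1 lc1 c1c] : exists2 c1 : R, (l < c1%:E)%E & c1 < c.
  case: l lc {ul} => [r| |]; rewrite ?lte_fin => rc; last by exists (c - 1); rewrite ?ltNyr//; lra.
    by exists ((r + c) / 2); rewrite ?lte_fin; lra.
  by [].
have [n0 _ un0] : \forall n \near \oo, (alg_proj_norm mu N%:R (u n) < c1%:E)%E.
  exact: ul _ (open_ereal_lt' lc1).
pose e k := (c - c1) * (2^-1) ^+ k.+1.
have e0 k : 0 < e k by rewrite /e mulr_gt0 ?subr_gt0// exprn_gt0.
have /choice[M MP] : forall k, exists Nk, forall i j, (Nk <= i)%N -> (Nk <= j)%N ->
  (alg_proj_norm mu N%:R (fun x => u i x - u j x)%R < (e k)%:E)%E by move=> k; exact: ucau.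
(* The maximum keeps [nn] monotone and beyond every Cauchy threshold, [n0] controls the first block,
   and k sends it to infinity. *)
pose nn k := (\max_(i < k.+1) M i + n0 + k)%N.
have nnS k : (nn k <= nn k.+1)%N.
  by rewrite /nn; apply: leq_add; [rewrite leq_add2r [leqRHS]big_ord_recr/= leq_maxl|exact: leqnSn].
have nnM k : (M k <= nn k)%N.
  by rewrite /nn -addnA; apply: leq_trans (leq_addr _ _); rewrite big_ord_recr/= leq_maxr.
pose v k := if k is k'.+1 then (fun x => u (nn k'.+1) x - u (nn k') x) else u (nn 0).
pose r k := if k is k'.+1 then e k' else c1.
have vr k : (alg_proj_norm mu N%:R (v k) < (r k)%:E)%E.
  case: k => [|k] /=.
    by apply: un0; rewrite /= /nn addn0 leq_addl.
  by apply: MP => //; apply: leq_trans (nnS k).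
have /choice[K /choice[g Kg]] : forall k, exists (K : nat) (g : nat -> 'I_m -> X -> R), [/\ forall j, all_Lp (g j),
    v k = (fun x => \sum_(0 <= j < K) tensor (g j) x) %[ae mu \^ m] &
    \sum_(0 <= j < K) cross_cost (g j) < r k].
  by move=> k; exact: alg_proj_norm_lt (vr k).
have gL k j : all_Lp (g k j) by have [] := Kg k.
exists K, g; split => //.
- have rS n : \sum_(0 <= k < n.+1) r k = c1 + (c - c1) * (1 - (2^-1) ^+ n).
    elim: n => [|n IH]; first by rewrite big_nat1 expr0 subrr mulr0 addr0.
    by rewrite big_nat_recr//= IH /e exprS; field.
  move=> n; apply: (@le_trans _ _ (pcost K g n.+1)); first exact: pcost_nd.
  apply: (@le_trans _ _ (\sum_(0 <= k < n.+1) r k)).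
    by apply: ler_sum => k _; have [_ _ /ltW] := Kg k.
  rewrite rS; have : 0 <= (2^-1 : R) ^+ n by rewrite exprn_ge0.
  by move: c1c; nra.
have vU n : psum K g n.+1 = u (nn n) %[ae mu \^ m].
  elim: n => [|n IH].
    by have [_ H _] := Kg 0; apply: filterS H => x Hx /Hx; rewrite /psum big_nat1 => <-.
  have [_ H _] := Kg n.+1; near=> x => _.
  rewrite /psum big_nat_recr//= -/(psum K g n.+1 x) (_ : psum K g n.+1 x = u (nn n) x); last by move: I; near: x.
  have <- : v n.+1 x = \sum_(0 <= j < K n.+1) tensor (g n.+1 j) x by move: I; near: x.
  by rewrite /= addrC subrK.
have nncvg : nn n @[n --> \oo] --> \oo.
  by apply/cvgnyPge => A; exists A => // n /= An; rewrite /nn; apply: leq_trans An (leq_addl _ _).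
have nrm_le_u n : ((nrm (mu \^ m) N (fun x => psum K g n.+1 x - f x))%:E <=
   'N[mu \^ m]_(N%:R%:E)[EFin \o (fun x => u (nn n) x - f x)%R])%E.
  rewrite nrmE; last by apply: LpB => //; exact: psum_Lp.
  by apply: Lnorm_le_ae => //; exact: psum_Lp.
have ufn : ('N[mu \^ m]_(N%:R%:E)[EFin \o (fun x => u (nn n) x - f x)%R])%E @[n --> \oo] --> 0%E.
  exact: (cvg_comp _ _ nncvg uf).
have H : (nrm (mu \^ m) N (fun x => psum K g n.+1 x - f x))%:E @[n --> \oo] --> 0%:E.
  apply: (@squeeze_cvge _ _ _ _ (fun=> 0%E) _ (fun n => 'N[mu \^ m]_(N%:R%:E)[EFin \o (fun x => u (nn n) x - f x)%R]%E)).
  - by apply: nearW => n; rewrite nrm_le_u andbT lee_fin nrm_ge0.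
  - exact: cvg_cst.
  - exact: ufn.
by move: H => /fine_cvgP[_]; rewrite /comp/= -(cvg_shiftS (fun n => nrm (mu \^ m) N (fun x => psum K g n x - f x))).
Unshelve. all: by end_near.
Qed.

(** The sign is put into the factor [i0]: a tensor without factors could not absorb it. *)
Lemma alg_proj_norm_opp (i0 : 'I_m) v : (alg_proj_norm mu N%:R (fun x => (- v x)%R) <= alg_proj_norm mu N%:R v)%E.
Proof.
apply: le_ereal_inf_tmp => _ [K [g [gL vE ->]]].
pose g' (j : 'I_K) i x := (if i == i0 then -1 else 1) * g j i x.
have E1 : \prod_(i < m) (if i == i0 then -1 else 1 : R) = -1.
  by rewrite (bigD1 i0)//= eqxx big1 ?mulr1// => i /negPf ->.
apply: le_trans (alg_proj_norm_le (s := index_enum 'I_K) (G := g') _ _) _.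
- by move=> j i; apply: LpZ.
- apply: filterS vE => x vx _; rewrite vx// -sumrN; apply: eq_bigr => j _.
  by rewrite /tensor big_split/= E1 mulN1r.
- rewrite lee_fin le_eqVlt; apply/orP; left; apply/eqP; apply: eq_bigr => j _.
  apply: eq_bigr => i _; rewrite nrmZ//.
  by case: ifP => _; rewrite ?normrN normr1 mul1r.
Qed.

(** Partial sums are Cauchy for the algebraic norm because their costs converge, so they are
    admissible in the infimum that defines [proj_norm]. *)
Lemma proj_norm_le (i0 : 'I_m) K g c f : proj_series K g c f -> (proj_norm mu N%:R f <= c%:E)%E.
Proof.
move=> [gL gc fL cv].
have diff i j : (i <= j)%N ->
    (alg_proj_norm mu N%:R (fun x => (psum K g j x - psum K g i x)%R) <= (pcost K g j - pcost K g i)%:E)%E.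
  move=> ij; pose s := [seq (k, l) | k <- index_iota i j, l <- index_iota 0 (K k)].
  apply: le_trans (alg_proj_norm_le (s := s) (G := fun a => g a.1 a.2) _ _) _.
  - by move=> a; exact: gL.
  - apply: aeW => x _; rewrite big_allpairs_dep/= /psum (@big_cat_nat _ _ _ i 0 j)//=.
    by rewrite addrAC subrr add0r.
  - rewrite big_allpairs_dep/= /pcost (@big_cat_nat _ _ _ i 0 j)//=.
    by rewrite addrAC subrr add0r.
have diff' i j : (alg_proj_norm mu N%:R (fun x => (psum K g j x - psum K g i x)%R) <= `|pcost K g j - pcost K g i|%:E)%E.
  have [ij|/ltnW ij] := leqP i j.
    by apply: le_trans (diff _ _ ij) _; rewrite lee_fin ler_norm.
  have -> : (fun x => psum K g j x - psum K g i x) = (fun x => - (psum K g i x - psum K g j x)).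
    by apply/funext => x; rewrite opprB.
  apply: le_trans (alg_proj_norm_opp i0 _) _.
  by apply: le_trans (diff _ _ ij) _; rewrite lee_fin distrC ler_norm.
have fin n : (0 <= alg_proj_norm mu N%:R (psum K g n) <= c%:E)%E.
  rewrite alg_proj_norm_ge0/=; have := diff 0 n (leq0n n).
  have -> : (fun x => psum K g n x - psum K g 0 x) = psum K g n.
    by apply/funext => x; rewrite [psum K g 0 x]/psum big_geq// subr0.
  move=> /le_trans; apply; rewrite lee_fin [pcost K g 0]/pcost big_geq// subr0; exact: gc.
have fin' n : alg_proj_norm mu N%:R (psum K g n) \is a fin_num.
  have /andP[a0 ac] := fin n; rewrite ge0_fin_numE//; apply: le_lt_trans ac _; exact: ltry.
pose a n := fine (alg_proj_norm mu N%:R (psum K g n)).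
(* The definition asks for convergent norms; being bounded by c, they converge along a subsequence
   [phi]. *)
have [phi phii cphi] : exists2 phi : nat -> nat, increasing_seq phi & cvgn (a \o phi).
  apply: bolzano_weierstrass; exists c; split; first exact: num_real.
  move=> M cM n _ /=; rewrite /a ger0_norm.
    by apply: le_trans (ltW cM); rewrite -lee_fin fineK//; have /andP[] := fin n.
  by apply: fine_ge0; have /andP[] := fin n.
have phiN n : (n <= phi n)%N.
  elim: n => [//|n IH]; apply: leq_ltn_trans IH _.
  by rewrite ltnNge; have := phii n.+1 n; rewrite leEnat => ->; rewrite ltnn.
have nd : {homo pcost K g : a b / (a <= b)%N >-> a <= b} by exact: pcost_nd.
have pcv : cvgn (pcost K g).
  apply: nondecreasing_is_cvgn => //; exists c => _ [n _ <-]; exact: gc.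
have alim : (alg_proj_norm mu N%:R (psum K g (phi n)) @[n --> \oo] --> (limn (a \o phi))%:E)%E.
  have -> : (fun n => alg_proj_norm mu N%:R (psum K g (phi n))) = EFin \o (a \o phi).
    by apply/funext => n; rewrite /= /a fineK.
  by apply: cvg_EFin => //; exact: nearW.
apply: (@le_trans _ _ (limn (a \o phi))%:E).
  apply: ereal_inf_lbound; split => //; exists (fun n => psum K g (phi n)); split => //.
  - split; first by move=> n; rewrite ltey_eq fin'.
    move=> e e0; have e2 : 0 < e / 2 by rewrite divr_gt0.
    have /cvgrPdist_lt/(_ _ e2)[M _ MP] := pcv.
    exists M => i j Mi Mj; apply: le_lt_trans (diff' _ _) _; rewrite lte_fin.
    have -> : pcost K g (phi i) - pcost K g (phi j) =
       (limn (pcost K g) - pcost K g (phi j)) - (limn (pcost K g) - pcost K g (phi i)) by ring.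
    apply: le_lt_trans (ler_normB _ _) _; rewrite [ltRHS]splitr; apply: ltrD; apply: MP => /=.
      exact: leq_trans (phiN _).
    exact: leq_trans (phiN _).
  - have cv' : (nrm (mu \^ m) N (fun x => psum K g n x - f x))%:E @[n --> \oo] --> 0%:E.
      by apply: cvg_EFin => //; exact: nearW.
    have E n : (nrm (mu \^ m) N (fun x => psum K g n x - f x))%:E =
      'N[mu \^ m]_(N%:R%:E)[EFin \o (fun x => psum K g n x - f x)%R]%E.
      by rewrite nrmE//; apply: LpB => //; exact: psum_Lp.
    rewrite (funext E) in cv'.
    have phicvg : phi n @[n --> \oo] --> \oo.
      by apply/cvgnyPge => A; exists A => // n /= An; exact: leq_trans (phiN n).
    exact: (cvg_comp _ _ phicvg cv').
rewrite lee_fin; apply: limr_le => //; apply: nearW => n /=.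
by rewrite /a -lee_fin fineK//; have /andP[] := fin (phi n).
Qed.

End projective_series.
(** * The diagonal map *)

Section cell_averages.
Context {disp : measure_display} {R : realType} {X : measurableType disp}.
Variable mu : probability X R.
Implicit Types (q : X -> nat) (g : X -> R).

Definition cell q (a : nat) (x : X) : R := if q x == a then 1 else 0.

Definition cell_mass q a := \int[mu]_y cell q a y.

Definition cell_avg q g (x : X) : R := (cell_mass q (q x))^-1 * \int[mu]_y (g y * cell q (q x) y).

(** The label in the common refinement is the code of the vector of labels [q i x]. *)
Lemma cell_refinement (I : finType) (q : I -> X -> nat) : (forall i, fibre_measurable (q i)) ->
  exists q0, fibre_measurable q0 /\ forall i, exists r : nat -> nat, forall x, q i x = r (q0 x).
Proof.
move=> mq; exists (fun x => pickle [ffun i => q i x]); split.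
  move=> a; case E : (unpickle a : option {ffun I -> nat}) => [h|]; last first.
    rewrite (_ : _ @^-1` _ = set0)//; apply/seteqP; split => // x /= qa.
    by move: E; rewrite -qa pickleK.
  have [ha|ha] := eqVneq (pickle h) a; last first.
    rewrite (_ : _ @^-1` _ = set0)//; apply/seteqP; split => // x /= qa.
    by move: E ha; rewrite -qa pickleK => -[->]; rewrite eqxx.
  rewrite (_ : _ @^-1` _ = \bigcap_(i in [set: I]) (q i @^-1` [set h i])).
    by apply: fin_bigcap_measurable; [exact: finite_finset|move=> i _; exact: mq].
  apply/seteqP; split => x /=.
    by move=> qa i _ /=; move: E; rewrite -qa pickleK => -[<-]; rewrite ffunE.
  by move=> H; rewrite -ha; congr pickle; apply/ffunP => i; rewrite ffunE; exact: H.
move=> i; exists (fun a => odflt 0%N (omap (fun h : {ffun I -> nat} => h i) (unpickle a))) => x.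
by rewrite pickleK/= ffunE.
Qed.

Section fixed_partition.
Variables (q : X -> nat) (mq : fibre_measurable q).

Lemma measurable_cell a : measurable_fun setT (cell q a).
Proof. exact: (fibre_measurable_comp (fun b => if b == a then 1 else 0) mq). Qed.

Lemma cell_bounded a x : `|cell q a x| <= 1.
Proof. by rewrite /cell; case: ifP; rewrite ?normr1 ?normr0. Qed.

Lemma cell_intg a : intg mu (cell q a).
Proof. by apply: (@intg_bounded _ _ _ mu _ 1); [exact: measurable_cell|exact: cell_bounded]. Qed.

Lemma cellM_intg a g : intg mu g -> intg mu (fun y => g y * cell q a y).
Proof. by move=> gi; apply: (intgM_bounded gi (M := 1)); [exact: measurable_cell|exact: cell_bounded]. Qed.

Lemma cell_mass_ge0 a : 0 <= cell_mass q a.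
Proof. by apply: Rint_ge0 => x; rewrite /cell; case: ifP. Qed.

(** There are countably many cells, and every cell of mass 0 is negligible. *)
Lemma cell_mass_pos_ae : {ae mu, forall x, 0 < cell_mass q (q x)}.
Proof.
have H a : {ae mu, forall x, cell_mass q a = 0 -> cell q a x = 0}.
  have [a0|/eqP a0] := eqVneq (cell_mass q a) 0; last by apply: aeW => x /a0.
  have c0 x : 0 <= cell q a x by rewrite /cell; case: ifP.
  by apply: filterS (Rint_eq0_ae (cell_intg a) c0 a0) => x Hx _; exact: Hx.
have := ae_foralln H; apply: filterS => x /(_ (q x)) Hx.
rewrite lt_neqAle cell_mass_ge0 andbT; apply/eqP => /esym /Hx.
by rewrite /cell eqxx => /eqP; rewrite oner_eq0.
Qed.

Lemma measurable_cell_avg g : measurable_fun setT (cell_avg q g).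
Proof. exact: (fibre_measurable_comp (fun a => (cell_mass q a)^-1 * \int[mu]_y (g y * cell q a y)) mq). Qed.

(** Jensen's inequality on one cell, obtained from Hoelder against its indicator. *)
Lemma cell_avg_hoelder N g a : (0 < N)%N -> g \in Lfun mu N%:R%:E ->
  cell_mass q a * `|(cell_mass q a)^-1 * \int[mu]_y (g y * cell q a y)| ^+ N <=
  \int[mu]_y (`|g y| ^+ N * cell q a y).
Proof.
move=> N0 gL; have gi := Lp_intg N0 gL; have [mg giN] := (LpP mu g N0).1 gL.
have ca y : 0 <= cell q a y by rewrite /cell; case: ifP.
have [->|a0] := eqVneq (cell_mass q a) 0.
  by rewrite mul0r; apply: Rint_ge0 => y; rewrite mulr_ge0// exprn_ge0.
have apos : 0 < cell_mass q a by rewrite lt_neqAle eq_sym a0 cell_mass_ge0.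
have c1 k y : (0 < k)%N -> `|cell q a y| ^+ k = cell q a y.
  by rewrite /cell; case: k => // k _; case: ifP; rewrite ?normr1 ?normr0 ?expr1n ?expr0n.
have cL : cell q a \in Lfun mu N%:R%:E.
  by apply: (Lp_bounded mu N0 (measurable_cell a)); exact: cell_bounded.
have gcL : (fun y => g y * cell q a y) \in Lfun mu N%:R%:E.
  apply/(LpP mu _ N0); split; first by apply: measurable_funM => //; exact: measurable_cell.
  apply: intg_le giN _.
    apply: measurable_funX; apply: measurableT_comp => //.
    by apply: measurable_funM => //; exact: measurable_cell.
  move=> y; rewrite [leLHS]ger0_norm ?exprn_ge0// [leRHS]ger0_norm ?exprn_ge0//.
  rewrite normrM exprMn c1// ler_piMr ?exprn_ge0//.
  by apply: le_trans (cell_bounded a y); exact: ler_norm.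
have nc : nrm mu N (cell q a) ^+ N = cell_mass q a.
  by rewrite nrm_pow//; apply: eq_Rintegral => y _; rewrite c1.
have ngc : nrm mu N (fun y => g y * cell q a y) ^+ N = \int[mu]_y (`|g y| ^+ N * cell q a y).
  by rewrite nrm_pow//; apply: eq_Rintegral => y _; rewrite normrM exprMn c1.
have ab : (N.-1 + 1)%N = N by rewrite addn1 prednK.
have [] := @hoelder_pow2 _ _ _ mu N.-1 1 (cell q a) (fun y => g y * cell q a y).
- by rewrite ab.
- by rewrite ab.
- by rewrite ab.
rewrite ab => _ H.
have H2 : `|\int[mu]_y (g y * cell q a y)| <= nrm mu N (cell q a) ^+ N.-1 * nrm mu N (fun y => g y * cell q a y).
  apply: le_trans (Rint_norm (cellM_intg a gi)) _.
  rewrite expr1 in H; apply: le_trans H; rewrite le_eqVlt; apply/orP; left; apply/eqP.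
  apply: eq_Rintegral => y _; rewrite /cell expr1; case: ifP; rewrite ?normr1 ?expr1n ?mul1r ?mulr0 ?normr0 ?mulr0//.
rewrite normrM normfV (ger0_norm (cell_mass_ge0 a)) exprMn mulrA.
rewrite -ngc; set s := nrm mu N _ in H2 nc; set u := nrm mu N _ in H2 *.
apply: (@le_trans _ _ (cell_mass q a * (cell_mass q a)^-1 ^+ N * (s ^+ N.-1 * u) ^+ N)).
  apply: ler_wpM2l; first by rewrite mulr_ge0 ?exprn_ge0 ?invr_ge0 ?cell_mass_ge0.
  by rewrite ler_pXn2r ?nnegrE// mulr_ge0 ?exprn_ge0 ?nrm_ge0.
rewrite exprMn -exprM mulnC exprM nc; move: (cell_mass q a) a0 => w w0.
case: (N) N0 => // n _ /=.
have e1 : w^-1 ^+ n * w ^+ n = 1 by rewrite -exprMn mulVf ?expr1n.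
rewrite [w^-1 ^+ n.+1]exprS; set U := u ^+ n.+1.
have -> : w * (w^-1 * w^-1 ^+ n) * (w ^+ n * U) = (w * w^-1) * (w^-1 ^+ n * w ^+ n) * U by ring.
by rewrite e1 divff// !mul1r.
Qed.

(** The inequality [cell_avg_hoelder] is summed over finitely many cells, through [h n], and Fatou
    passes to all of them. *)
Lemma cell_avg_Lp N g : (0 < N)%N -> g \in Lfun mu N%:R%:E ->
  cell_avg q g \in Lfun mu N%:R%:E /\ nrm mu N (cell_avg q g) <= nrm mu N g.
Proof.
move=> N0 gL; have [mg giN] := (LpP mu g N0).1 gL.
pose c a := (cell_mass q a)^-1 * \int[mu]_y (g y * cell q a y).
pose h n x := if (q x < n)%N then c (q x) else 0.
have mh n : measurable_fun setT (h n).
  exact: (fibre_measurable_comp (fun a => if (a < n)%N then c a else 0) mq).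
have hE k n x : (0 < k)%N -> `|h n x| ^+ k = \sum_(0 <= a < n) (`|c a| ^+ k * cell q a x).
  move=> k0; rewrite big_mkord /h; case: ifPn => qn.
    rewrite (bigD1 (Ordinal qn))//= /cell eqxx mulr1 big1 ?addr0// => i.
    by rewrite -val_eqE/= eq_sym => /negPf ->; rewrite mulr0.
  rewrite normr0 expr0n gtn_eqF//= big1// => i _; rewrite /cell.
  by case: eqP => [qi|_]; rewrite ?mulr0//; move: qn; rewrite qi ltn_ord.
have ic a k : intg mu (fun x => `|c a| ^+ k * cell q a x) by apply: intgZ; exact: cell_intg.
have hL n : h n \in Lfun mu N%:R%:E.
  apply/(LpP mu _ N0); split => //; under eq_fun do rewrite hE//.
  exact: (intg_sum _ (F := fun a x => `|c a| ^+ N * cell q a x)).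
have hn n : nrm mu N (h n) <= nrm mu N g.
  rewrite -(ler_pXn2r N0) ?nnegrE ?nrm_ge0// !nrm_pow//.
  under eq_Rintegral do rewrite hE//.
  rewrite (Rint_sum _ (F := fun a x => `|c a| ^+ N * cell q a x))//.
  apply: (@le_trans _ _ (\sum_(0 <= a < n) \int[mu]_y (`|g y| ^+ N * cell q a y))).
    apply: ler_sum => a _; rewrite RintZ; last exact: cell_intg.
    by rewrite mulrC; exact: cell_avg_hoelder.
  rewrite -(Rint_sum _ (F := fun a y => `|g y| ^+ N * cell q a y)); last by move=> a; exact: cellM_intg.
  apply: Rint_le => //; first by apply: (intg_sum _ (F := fun a y => `|g y| ^+ N * cell q a y)) => a; exact: cellM_intg.
  move=> y; rewrite -mulr_sumr ler_piMr ?exprn_ge0// big_mkord.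
  have [qn|qn] := ltnP (q y) n.
    rewrite (bigD1 (Ordinal qn))//= /cell eqxx big1 ?addr0// => i.
    by rewrite -val_eqE/= eq_sym => /negPf ->.
  rewrite big1 ?ler01// => i _; rewrite /cell; case: eqP => // qi.
  by move: qn; rewrite qi leqNgt ltn_ord.
apply: (Lp_fatou N0 (nrm_ge0 _ _ _) hL (measurable_cell_avg g) _ hn).
apply: aeW => x; apply: cvg_near_cst; exists (q x).+1 => // n /= qn.
by rewrite /h qn.
Qed.

Lemma cell_avg_close g (e : R) : intg mu g -> 0 <= e ->
  (forall x y, q x = q y -> `|g y - g x| <= e) ->
  {ae mu, forall x, `|cell_avg q g x - g x| <= e}.
Proof.
move=> gi e0 ge; apply: filterS cell_mass_pos_ae => x w0.
have -> : cell_avg q g x - g x = (cell_mass q (q x))^-1 * \int[mu]_y ((g y - g x) * cell q (q x) y).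
  rewrite /cell_avg; have -> : \int[mu]_y ((g y - g x) * cell q (q x) y) =
     \int[mu]_y (g y * cell q (q x) y) - g x * cell_mass q (q x).
    under eq_Rintegral do rewrite mulrBl.
    rewrite RintB; [|exact: cellM_intg|by apply: intgZ; exact: cell_intg].
    by rewrite RintZ//; exact: cell_intg.
  by rewrite mulrBr [_^-1 * (_ * _)]mulrC mulfK// gt_eqF.
have igx : intg mu (fun y => (g y - g x) * cell q (q x) y).
  by apply: cellM_intg; apply: intgB => //; exact: intg_cst.
rewrite normrM normfV (gtr0_norm w0) mulrC ler_pdivrMr//.
apply: le_trans (Rint_norm igx) _; rewrite -RintZ; last exact: cell_intg.
apply: Rint_le; [exact: intg_norm|by apply: intgZ; exact: cell_intg|].
move=> y; rewrite normrM /cell; case: eqP => [qy|_].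
  by rewrite normr1 !mulr1; exact: ge.
by rewrite normr0 !mulr0.
Qed.

End fixed_partition.

Section diagonal.
Variables (m : nat) (m0 : (0 < m)%N).
Local Notation N := (2 * m)%N.
Implicit Types (f : m.-tuple X -> R) (h : X -> R).

Let N0 : (0 < N)%N. Proof. by rewrite muln_gt0. Qed.
Let two0 : (0 < 2)%N := isT.

(** The mean of f over the m-th power of the cell of x. It depends on the a.e. class of f only,
    whereas restriction to the diagonal, in general a null set, does not. *)
Definition diag_avg q f (x : X) : R :=
  (cell_mass q (q x))^-1 ^+ m * \int[mu \^ m]_y (f y * tensor (fun _ => cell q (q x)) y).

Lemma cell_tensor_bounded q a y : `|tensor (fun _ : 'I_m => cell q a) y| <= 1.
Proof.
rewrite /tensor normr_prod; apply: prodr_ile1 => i _.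
by rewrite normr_ge0 cell_bounded.
Qed.

Lemma cell_tensor_intg q a f : fibre_measurable q -> intg (mu \^ m) f ->
  intg (mu \^ m) (fun y => f y * tensor (fun _ => cell q a) y).
Proof.
move=> mq fi; apply: (intgM_bounded fi (M := 1)); last exact: cell_tensor_bounded.
by apply: measurable_tensor => i; exact: measurable_cell.
Qed.

Lemma measurable_diag_avg q f : fibre_measurable q -> measurable_fun setT (diag_avg q f).
Proof.
exact: (fibre_measurable_comp (fun a => (cell_mass q a)^-1 ^+ m *
  \int[mu \^ m]_y (f y * tensor (fun _ => cell q a) y))).
Qed.

Lemma diag_avg_lin q a b f f' x : fibre_measurable q -> intg (mu \^ m) f -> intg (mu \^ m) f' ->
  diag_avg q (fun y => a * f y + b * f' y) x = a * diag_avg q f x + b * diag_avg q f' x.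
Proof.
move=> mq fi fi'; rewrite /diag_avg.
have -> : \int[mu \^ m]_y ((a * f y + b * f' y) * tensor (fun _ => cell q (q x)) y) =
    a * \int[mu \^ m]_y (f y * tensor (fun _ => cell q (q x)) y) +
    b * \int[mu \^ m]_y (f' y * tensor (fun _ => cell q (q x)) y).
  under eq_Rintegral do rewrite mulrDl -!mulrA.
  by rewrite RintD ?RintZ//; do ?apply: intgZ; exact: cell_tensor_intg.
by ring.
Qed.

Lemma diag_avg_tensor q (g : 'I_m -> X -> R) x : fibre_measurable q -> (forall i, intg mu (g i)) ->
  diag_avg q (tensor g) x = \prod_i cell_avg q (g i) x.
Proof.
move=> mq gi; rewrite /diag_avg /cell_avg big_split/= prodr_const card_ord; congr (_ * _).
have gci i : intg mu (fun y => g i y * cell q (q x) y) by exact: cellM_intg.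
rewrite -(tensor_intg gci).2.
by apply: eq_Rintegral => y _; rewrite /tensor -big_split.
Qed.

Lemma diag_prod_L2 (g : 'I_m -> X -> R) : (forall i, g i \in Lfun mu N%:R%:E) ->
  (fun x => \prod_i g i x) \in Lfun mu 2%:R%:E /\
  nrm mu 2 (fun x => \prod_i g i x) <= cross_cost mu N g.
Proof. exact: hoelder_prod2. Qed.

Lemma diag_avg_sum q (I : Type) (s : seq I) (F : I -> m.-tuple X -> R) x : fibre_measurable q ->
  (forall i, intg (mu \^ m) (F i)) ->
  diag_avg q (fun y => \sum_(i <- s) F i y) x = \sum_(i <- s) diag_avg q (F i) x.
Proof.
move=> mq Fi; rewrite /diag_avg -mulr_sumr; congr (_ * _).
rewrite -(Rint_sum s (F := fun i y => F i y * tensor (fun _ => cell q (q x)) y)); last by move=> i; exact: cell_tensor_intg.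
by apply: eq_Rintegral => y _; rewrite mulr_suml.
Qed.

(** For a tensor the cell average is a product of one-dimensional averages, which contract L_{2m};
    so the cost bounds the partial sums, and Fatou passes to f. The bound is uniform in the
    partition. *)
Lemma diag_avg_series q K (g : nat -> nat -> 'I_m -> X -> R) c f : fibre_measurable q -> proj_series mu N K g c f ->
  diag_avg q f \in Lfun mu 2%:R%:E /\ nrm mu 2 (diag_avg q f) <= c.
Proof.
move=> mq [gL gc fL cv].
have gi k j i : intg mu (g k j i) by apply: (Lp_intg N0); exact: gL.
have ti k j : intg (mu \^ m) (tensor (g k j)) by exact: (tensor_intg (gi k j)).1.
have psi n : intg (mu \^ m) (psum K g n) by apply: (Lp_intg N0); exact: psum_Lp.
have fi : intg (mu \^ m) f by exact: (Lp_intg N0).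
have E n x : diag_avg q (psum K g n) x = \sum_(0 <= k < n) \sum_(0 <= j < K k) \prod_i cell_avg q (g k j i) x.
  rewrite (@diag_avg_sum _ _ _ (fun k y => \sum_(0 <= j < K k) tensor (g k j) y))//; last first.
    by move=> k; exact: (intg_sum _ (F := fun j y => tensor (g k j) y)).
  apply: eq_bigr => k _; rewrite diag_avg_sum//.
  by apply: eq_bigr => j _; rewrite diag_avg_tensor.
have cL k j i : cell_avg q (g k j i) \in Lfun mu N%:R%:E by exact: (cell_avg_Lp mq N0 (gL k j i)).1.
have pL k j : (fun x => \prod_i cell_avg q (g k j i) x) \in Lfun mu 2%:R%:E by exact: (diag_prod_L2 (cL k j)).1.
have bL k : (fun x => \sum_(0 <= j < K k) \prod_i cell_avg q (g k j i) x) \in Lfun mu 2%:R%:E.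
  exact: (Lp_sum _ (F := fun j x => \prod_i cell_avg q (g k j i) x)).
have c0 : 0 <= c by apply: le_trans (gc 0); rewrite /pcost big_geq.
have dL n : diag_avg q (psum K g n) \in Lfun mu 2%:R%:E.
  rewrite (funext (E n)).
  exact: (Lp_sum _ (F := fun k x => \sum_(0 <= j < K k) \prod_i cell_avg q (g k j i) x)).
have dn n : nrm mu 2 (diag_avg q (psum K g n)) <= c.
  apply: le_trans (gc n); rewrite (funext (E n)).
  apply: le_trans (nrm_sum _ (F := fun k x => \sum_(0 <= j < K k) \prod_i cell_avg q (g k j i) x) two0 bL) _.
  apply: ler_sum => k _.
  apply: le_trans (nrm_sum _ (F := fun j x => \prod_i cell_avg q (g k j i) x) two0 (pL k)) _.
  apply: ler_sum => j _; apply: le_trans (diag_prod_L2 (cL k j)).2 _.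
  by apply: ler_prod => i _; rewrite nrm_ge0/=; exact: (cell_avg_Lp mq N0 (gL k j i)).2.
apply: (Lp_fatou two0 c0 dL (measurable_diag_avg f mq) _ dn).
apply: aeW => x; apply: cvgM; first exact: cvg_cst.
apply/cvgrPdist_le => e e0; move/cvgrPdist_le : cv => /(_ _ e0); apply: filterS => n.
rewrite sub0r normrN ger0_norm ?nrm_ge0//; apply: le_trans.
have di : intg (mu \^ m) (fun y => psum K g n y - f y) by exact: intgB.
have dLp : (fun y => psum K g n y - f y) \in Lfun (mu \^ m) N%:R%:E by apply: LpB => //; exact: psum_Lp.
apply: le_trans (Lp_incl (M := 1) _ dLp).2; last by rewrite N0.
rewrite -Rint_le_nrm1// distrC -RintB; [|exact: cell_tensor_intg..].
apply: le_trans (Rint_norm _) _; first by apply: intgB; exact: cell_tensor_intg.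
apply: Rint_le; [by apply: intg_norm; apply: intgB; exact: cell_tensor_intg|exact: intg_norm|].
move=> y; rewrite -mulrBl normrM ler_piMr//; exact: cell_tensor_bounded.
Qed.

(** A new factor multiplies the previous error by at most 1 + |b i| and adds e times the product of
    the b's; the factor 2 covers both. *)
Lemma prod_dist_le (I : Type) (s : seq I) (a b : I -> R) (e : R) : 0 <= e <= 1 ->
  (forall i, `|a i - b i| <= e) ->
  `|\prod_(i <- s) a i - \prod_(i <- s) b i| <= e * \prod_(i <- s) (2 * (1 + `|b i|)).
Proof.
move=> /andP[e0 e1] ab; elim: s => [|i s IH].
  by rewrite !big_nil subrr normr0 mulr1.
rewrite !big_cons; set A := \prod_(j <- s) a j in IH *; set B := \prod_(j <- s) b j in IH *.
set C := \prod_(j <- s) _ in IH *.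
have BC : `|B| <= C.
  rewrite /B /C normr_prod; elim: s {IH A B C} => [|j s IH]; first by rewrite !big_nil.
  by rewrite !big_cons; apply: ler_pM => //; [apply: prodr_ge0 => k _|have := normr_ge0 (b j); lra].
have C0 : 0 <= C by apply: le_trans BC.
have -> : a i * A - b i * B = a i * (A - B) + (a i - b i) * B by ring.
apply: le_trans (ler_normD _ _) _; rewrite !normrM.
have ai : `|a i| <= 1 + `|b i|.
  have -> : a i = (a i - b i) + b i by ring.
  by apply: le_trans (ler_normD _ _) _; have := ab i; lra.
apply: (@le_trans _ _ ((1 + `|b i|) * (e * C) + e * C)).
  by apply: lerD; apply: ler_pM.
have := normr_ge0 (b i); have : 0 <= e * C by rewrite mulr_ge0.
by nra.
Qed.

(** Each factor is discretized to precision del / 2, so it oscillates by at most del on the cells of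
    the common refinement and of every finer partition. *)
Lemma diag_avg_tensor_close (g : 'I_m -> X -> R) (e : R) : 0 < e ->
  (forall i, g i \in Lfun mu N%:R%:E) ->
  exists q, fibre_measurable q /\ forall q' (r : nat -> nat), fibre_measurable q' ->
    (forall x, q x = r (q' x)) ->
    nrm mu 2 (fun x => diag_avg q' (tensor g) x - \prod_i g i x) <= e.
Proof.
move=> e0 gL.
pose B := nrm mu 2 (fun x => \prod_(i < m) (2 * (1 + `|g i x|))).
have BL : (fun x => \prod_(i < m) (2 * (1 + `|g i x|))) \in Lfun mu 2%:R%:E.
  apply: (diag_prod_L2 (g := fun i x => 2 * (1 + `|g i x|)) _).1 => i.
  apply: LpZ => //; apply: LpD => //; first exact: Lp_cst.
  by apply: (nrm_le_ae N0 (gL i) _ _).1; [apply: measurableT_comp => //; exact: Lp_measurable (gL i)|apply: aeW => x; rewrite normr_id].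
have B0 : 0 <= B := nrm_ge0 _ _ _.
(* The bound 1 is the one [prod_dist_le] asks for, and e / (1 + B) brings the final error down to
   e. *)
pose del := Num.min 1 (e / (1 + B)).
have del0 : 0 < del by rewrite lt_min ltr01 divr_gt0//; lra.
have del2 : 0 < del / 2 by rewrite divr_gt0.
have /choice[qc qcP] : forall i, exists qc : (X -> nat) * (nat -> R), fibre_measurable qc.1 /\
    forall x, `|g i x - qc.2 (qc.1 x)| <= del / 2.
  move=> i; have [q [c H]] := discretize del2 (Lp_measurable (gL i)).
  by exists (q, c).
have [q [mq qr]] := cell_refinement (fun i => (qcP i).1).
exists q; split => // q' r mq' qq'.
have gi i : intg mu (g i) by exact: Lp_intg N0 (gL i).
have close i : {ae mu, forall x, `|cell_avg q' (g i) x - g i x| <= del}.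
  apply: cell_avg_close => //; first exact: ltW.
  move=> x y xy; have [ri rq] := qr i.
  have E : (qc i).1 x = (qc i).1 y by rewrite !rq !qq' xy.
  have -> : g i y - g i x = (g i y - (qc i).2 ((qc i).1 y)) - (g i x - (qc i).2 ((qc i).1 x)).
    by rewrite E; ring.
  apply: le_trans (ler_normB _ _) _; rewrite [leRHS]splitr.
  by apply: lerD; exact: (qcP i).2.
have all_close : {ae mu, forall x, forall i, `|cell_avg q' (g i) x - g i x| <= del}.
  exact: filter_forall close.
have DL : diag_avg q' (tensor g) \in Lfun mu 2%:R%:E.
  rewrite (_ : diag_avg q' (tensor g) = fun x => \prod_i cell_avg q' (g i) x).
    by apply: (diag_prod_L2 _).1 => i; exact: (cell_avg_Lp mq' N0 (gL i)).1.
  by apply/funext => x; rewrite diag_avg_tensor.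
have PL := (diag_prod_L2 gL).1.
have bnd : {ae mu, forall x, `|diag_avg q' (tensor g) x - \prod_i g i x| <=
    `|del * \prod_(i < m) (2 * (1 + `|g i x|))|}.
  apply: filterS all_close => x Hx; rewrite diag_avg_tensor//.
  apply: le_trans (ler_norm _); apply: prod_dist_le => //.
  by rewrite ltW//= ge_min lexx.
have [_ H] := nrm_le_ae two0 (LpZ del two0 BL) (Lp_measurable (LpB two0 DL PL)) bnd.
apply: le_trans H _; rewrite nrmZ// gtr0_norm// -/B.
apply: (@le_trans _ _ (e / (1 + B) * B)); first by apply: ler_wpM2r => //; rewrite ge_min lexx orbT.
rewrite mulrAC ler_pdivrMr; last by lra.
by rewrite ler_pM2l//; lra.
Qed.

Lemma proj_series_intg K (g : nat -> nat -> 'I_m -> X -> R) c f : proj_series mu N K g c f -> intg (mu \^ m) f.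
Proof. by move=> [_ _ fL _]; exact: Lp_intg N0 fL. Qed.

(** The costs of the partial sums increase to a finite limit, so what remains after many blocks is
    cheap. *)
Lemma proj_series_tail K (g : nat -> nat -> 'I_m -> X -> R) c f (e : R) :
  proj_series mu N K g c f -> 0 < e -> \forall n \near \oo,
  proj_series mu N (fun k => K (n + k)%N) (fun k => g (n + k)%N) e (fun x => f x - psum K g n x).
Proof.
move=> [gL gc fL cv] e0.
have pcv : cvgn (pcost mu N K g).
  by apply: nondecreasing_is_cvgn; [exact: pcost_nd|exists c => _ [n _ <-]].
have bound n : pcost mu N K g n <= limn (pcost mu N K g).
  by apply: nondecreasing_cvgn_le => //; exact: pcost_nd.
have [n0 _ Hn0] := (cvgrPdist_lt _ _).1 pcv e e0; exists n0 => // n /= n0n.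
have shift (F : nat -> R) n1 : \sum_(0 <= k < n1) F (n + k)%N = \sum_(0 <= k < n + n1) F k - \sum_(0 <= k < n) F k.
  elim: n1 => [|n1 IH]; first by rewrite big_geq// addn0 subrr.
  by rewrite addnS !big_nat_recr//= IH addrAC.
have pE n1 : psum (fun k => K (n + k)%N) (fun k => g (n + k)%N) n1 = fun x => psum K g (n + n1)%N x - psum K g n x.
  by apply/funext => x; rewrite /psum -shift.
have cE n1 : pcost mu N (fun k => K (n + k)%N) (fun k => g (n + k)%N) n1 = pcost mu N K g (n + n1)%N - pcost mu N K g n.
  by rewrite /pcost -shift.
split.
- by move=> k j; exact: gL.
- move=> n1; rewrite cE; apply: (@le_trans _ _ (limn (pcost mu N K g) - pcost mu N K g n)).
    by rewrite lerD2r.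
  by apply: le_trans (ler_norm _) _; apply: ltW; exact: Hn0.
- by apply: LpB => //; exact: psum_Lp.
- have := cvg_comp _ _ (@cvg_addnr n) cv; rewrite /comp.
  rewrite (_ : (fun n1 => nrm _ _ (fun x => psum K g (n1 + n)%N x - f x)) = (fun n1 => nrm (mu \^ m) N
     (fun x => psum (fun k => K (n + k)%N) (fun k => g (n + k)%N) n1 x - (f x - psum K g n x))))//.
  apply/funext => n1 /=; congr (nrm _ _ _); apply/funext => x.
  by rewrite pE [(n1 + n)%N]addnC; ring.
Qed.

(* The diagonal of [f], which is only defined a.e., is the limit of the cell averages of [f]
   over the diagonal cells, along refining partitions. *)
Definition is_diagonal f h := [/\ intg (mu \^ m) f, h \in Lfun mu 2%:R%:E,
  forall q, fibre_measurable q -> diag_avg q f \in Lfun mu 2%:R%:E &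
  forall e : R, 0 < e -> exists q, fibre_measurable q /\ forall q' (r : nat -> nat),
    fibre_measurable q' -> (forall x, q x = r (q' x)) ->
    nrm mu 2 (fun x => diag_avg q' f x - h x) <= e].

Lemma is_diagonal_lin a b f f' h h' : is_diagonal f h -> is_diagonal f' h' ->
  is_diagonal (fun y => a * f y + b * f' y) (fun x => a * h x + b * h' x).
Proof.
move=> [fi hL fq fh] [fi' hL' fq' fh'].
have E q : fibre_measurable q -> diag_avg q (fun y => a * f y + b * f' y) =
    fun x => a * diag_avg q f x + b * diag_avg q f' x.
  by move=> mq; apply/funext => x; exact: diag_avg_lin.
split.
- by apply: intgD; exact: intgZ.
- by apply: LpD => //; exact: LpZ.
- by move=> q mq; rewrite E//; apply: LpD => //; apply: LpZ => //; [exact: fq|exact: fq'].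
move=> e e0; pose M := `|a| + `|b| + 1.
have M0 : 0 < M by rewrite /M; have := normr_ge0 a; have := normr_ge0 b; lra.
have eM : 0 < e / M by exact: divr_gt0.
have [q1 [mq1 H1]] := fh _ eM; have [q2 [mq2 H2]] := fh' _ eM.
have [q0 [mq0 qr]] := @cell_refinement bool (fun b : bool => if b then q1 else q2) (ltac:(by case)).
have [r1 E1] := qr true; have [r2 E2] := qr false.
exists q0; split => // q' r mq' qq'.
have {}H1 := H1 q' (r1 \o r) mq' (fun x => etrans (E1 x) (congr1 r1 (qq' x))).
have {}H2 := H2 q' (r2 \o r) mq' (fun x => etrans (E2 x) (congr1 r2 (qq' x))).
have L1 := LpB two0 (fq _ mq') hL; have L2 := LpB two0 (fq' _ mq') hL'.
rewrite E// (_ : (fun x => _) = fun x => a * (diag_avg q' f x - h x) + b * (diag_avg q' f' x - h' x)); last first.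
  by apply/funext => x; ring.
apply: le_trans (nrmD two0 (LpZ a two0 L1) (LpZ b two0 L2)) _.
rewrite !nrmZ//; apply: (@le_trans _ _ (`|a| * (e / M) + `|b| * (e / M))).
  by apply: lerD; apply: ler_wpM2l.
rewrite -mulrDl mulrA ler_pdivrMr// mulrC; apply: ler_wpM2l; first exact: ltW.
by rewrite /M; lra.
Qed.

(** By linearity h - h' is a diagonal of f - f, all of whose averages vanish. *)
Lemma is_diagonal_unique f h h' : is_diagonal f h -> is_diagonal f h' -> h = h' %[ae mu].
Proof.
move=> H H'; have [_ hL fq fh] := is_diagonal_lin 1 (-1) H H'.
have [i1 L1 _ _] := H; have [_ L2 _ _] := H'.
have Z q x : fibre_measurable q -> diag_avg q (fun y => 1 * f y + (-1) * f y) x = 0.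
  by move=> mq; rewrite diag_avg_lin//; ring.
suff n0 : nrm mu 2 (fun x => 1 * h x + (-1) * h' x) = 0.
  have := nrm_eq0 two0 hL n0; apply: filterS => x /(_ I) hx _.
  by apply/eqP; rewrite -subr_eq0 -hx; apply/eqP; ring.
apply/eqP; rewrite eq_le nrm_ge0 andbT; apply/ler_addgt0Pl => e e0; rewrite addr0.
have [q [mq Hq]] := fh e e0; have := Hq q id mq (fun=> erefl).
congr (_ <= _); rewrite -[RHS]nrmN//; congr (nrm _ _ _); apply/funext => x.
by rewrite Z// sub0r.
Qed.

Lemma is_diagonal_tensor (g : 'I_m -> X -> R) : (forall i, g i \in Lfun mu N%:R%:E) ->
  is_diagonal (tensor g) (fun x => \prod_i g i x).
Proof.
move=> gL; have gi i : intg mu (g i) by exact: Lp_intg N0 (gL i).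
split; [exact: (tensor_intg gi).1|exact: (diag_prod_L2 gL).1| |by move=> e e0; exact: diag_avg_tensor_close].
move=> q mq; rewrite (_ : diag_avg q (tensor g) = fun x => \prod_i cell_avg q (g i) x).
  by apply: (diag_prod_L2 _).1 => i; exact: (cell_avg_Lp mq N0 (gL i)).1.
by apply/funext => x; rewrite diag_avg_tensor.
Qed.

Lemma is_diagonal0 : is_diagonal (fun=> 0) (fun=> 0).
Proof.
have L : forall i : 'I_m, (fun=> 0 : R) \in Lfun mu N%:R%:E by move=> i; exact: Lp0.
have := is_diagonal_lin 0 0 (is_diagonal_tensor L) (is_diagonal_tensor L).
by congr is_diagonal; apply/funext => x; rewrite !mul0r addr0.
Qed.

Lemma is_diagonal_sum (I : Type) (s : seq I) (F : I -> m.-tuple X -> R) (G : I -> X -> R) :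
  (forall i, is_diagonal (F i) (G i)) ->
  is_diagonal (fun y => \sum_(i <- s) F i y) (fun x => \sum_(i <- s) G i x).
Proof.
move=> FG; elim: s => [|i s IH].
  by under eq_fun do rewrite big_nil; under [X in is_diagonal _ X]eq_fun do rewrite big_nil; exact: is_diagonal0.
have := is_diagonal_lin 1 1 (FG i) IH.
by congr is_diagonal; apply/funext => x; rewrite big_cons !mul1r.
Qed.

Definition diag_psum (K : nat -> nat) (g : nat -> nat -> 'I_m -> X -> R) n (x : X) : R :=
  \sum_(0 <= k < n) \sum_(0 <= j < K k) \prod_(i < m) g k j i x.

Lemma is_diagonal_psum K (g : nat -> nat -> 'I_m -> X -> R) n : (forall k j i, g k j i \in Lfun mu N%:R%:E) ->
  is_diagonal (psum K g n) (diag_psum K g n).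
Proof.
move=> gL; apply: (is_diagonal_sum _ (F := fun k y => \sum_(0 <= j < K k) tensor (g k j) y)
  (G := fun k x => \sum_(0 <= j < K k) \prod_i g k j i x)) => k.
apply: (is_diagonal_sum _ (F := fun j y => tensor (g k j) y) (G := fun j x => \prod_i g k j i x)) => j.
exact: is_diagonal_tensor.
Qed.

(** Three errors: the tail inside the averages, the averages of a finite tensor sum, and the tail of
    the diagonal series. The first is uniform in the partition, so the series is cut before the
    partition is chosen. *)
Lemma is_diagonal_series K (g : nat -> nat -> 'I_m -> X -> R) c f : proj_series mu N K g c f ->
  exists h, is_diagonal f h /\ nrm mu 2 h <= c.
Proof.
move=> fs; have [gL gc fL cv] := fs.
have pL k j := (diag_prod_L2 (gL k j)).1.
pose v k x := \sum_(0 <= j < K k) \prod_i g k j i x.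
have vL k : v k \in Lfun mu 2%:R%:E by exact: (Lp_sum _ (F := fun j x => \prod_i g k j i x)).
have vc n : \sum_(0 <= k < n) nrm mu 2 (v k) <= c.
  apply: le_trans (gc n); apply: ler_sum => k _.
  apply: le_trans (nrm_sum _ (F := fun j x => \prod_i g k j i x) two0 (pL k)) _.
  by apply: ler_sum => j _; exact: (diag_prod_L2 (gL k j)).2.
have [h [hL hc _ vh]] := Lp_series_cvg two0 vL vc.
exists h; split => //; split => //.
- exact: proj_series_intg fs.
- by move=> q mq; exact: (diag_avg_series mq fs).1.
move=> e e0; have e3 : 0 < e / 3 by rewrite divr_gt0.
have ev1 := proj_series_tail fs e3.
have ev2 : \forall n \near \oo, `|0 - nrm mu 2 (fun x => diag_psum K g n x - h x)| < e / 3.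
  exact: (cvgrPdist_lt _ _).1 vh _ e3.
near \oo => n.
have fs' : proj_series mu N (fun k => K (n + k)%N) (fun k => g (n + k)%N) (e / 3) (fun x => f x - psum K g n x) by near: n.
have : `|0 - nrm mu 2 (fun x => diag_psum K g n x - h x)| < e / 3 by near: n.
rewrite sub0r normrN ger0_norm ?nrm_ge0// => hn.
have [i1 L1 fq1 H1] := is_diagonal_psum K n gL.
have [q [mq Hq]] := H1 _ e3; exists q; split => // q' r mq' qq'.
have [L2 n2] := diag_avg_series mq' fs'.
have E : (fun x => diag_avg q' f x - h x) = (fun x => diag_avg q' (fun y => f y - psum K g n y) x +
    ((diag_avg q' (psum K g n) x - diag_psum K g n x) + (diag_psum K g n x - h x))).
  apply/funext => x.
  have -> : diag_avg q' (fun y => f y - psum K g n y) x = diag_avg q' (fun y => 1 * f y + (-1) * psum K g n y) x.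
    by congr diag_avg; apply/funext => y; ring.
  by rewrite diag_avg_lin//; [ring|exact: proj_series_intg fs].
have L3 := LpB two0 (fq1 _ mq') L1; have L4 := LpB two0 L1 hL.
rewrite E; apply: le_trans (nrmD two0 L2 (LpD two0 L3 L4)) _.
have := nrmD two0 L3 L4; have := Hq q' r mq' qq'; lra.
Unshelve. all: by end_near.
Qed.

Lemma diag_exponent : (N%:R / m%:R)%:E = 2%:R%:E :> \bar R.
Proof. by congr (_%:E); rewrite natrM mulfK// pnatr_eq0 -lt0n. Qed.

Lemma Lproj_series f : Lproj mu N%:R f -> exists K (g : nat -> nat -> 'I_m -> X -> R) c, proj_series mu N K g c f.
Proof.
rewrite /Lproj => H.
have [c Hc] : exists c : R, (proj_norm mu N%:R f < c%:E)%E.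
  case E : (proj_norm mu N%:R f) H => [r| |]//= _; last by exists 0; rewrite ltNyr.
  by exists (r + 1); rewrite lte_fin ltrDl.
by have [K [g Kg]] := proj_norm_lt N0 Hc; exists K, g, c.
Qed.

(** The diagonal is chosen by [is_diagonal], a property of f alone and not of a series for f; the
    norm bound can then use a series of cost within e of the norm, another one for each e. *)
Lemma diag_map_exists : exists D, is_diag_map mu N%:R (m := m) D.
Proof.
pose D f := xget (fun _ => 0) [set h | is_diagonal f h].
have DE f h : is_diagonal f h -> is_diagonal f (D f).
  by move=> fh; rewrite /D; case: xgetP => [h' -> //|/(_ h)/(_ fh)].
have DL f : Lproj mu N%:R f -> is_diagonal f (D f).
  by move=> /Lproj_series[K [g [c /is_diagonal_series[h [fh _]]]]]; exact: DE fh.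
have DE' f h : is_diagonal f h -> D f = h %[ae mu].
  by move=> fh; exact: is_diagonal_unique (DE _ _ fh) fh.
exists D; split.
- by move=> f /DL[_ hL _ _]; rewrite diag_exponent.
- move=> a f g /DL fD /DL gD; apply: DE'.
  have := is_diagonal_lin a 1 fD gD.
  by congr is_diagonal; apply/funext => x; rewrite mul1r.
- move=> f fP; rewrite diag_exponent.
  have [_ hL _ _] := DL _ fP; rewrite -nrmE//.
  apply/lee_addgt0Pr => e e0.
  have pf : (0 <= proj_norm mu N%:R f)%E.
    apply: le_ereal_inf_tmp => l [_ [u [_ _ ul]]].
    rewrite -(cvg_lim _ ul)//; apply: lime_ge; first by apply/cvg_ex; exists l.
    by apply: nearW => n; exact: alg_proj_norm_ge0.
  have fin : proj_norm mu N%:R f \is a fin_num by rewrite ge0_fin_numE.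
  have Hc : (proj_norm mu N%:R f < (fine (proj_norm mu N%:R f) + e)%:E)%E.
    by rewrite -{1}(fineK fin) lte_fin ltrDl.
  have [K [g Kg]] := proj_norm_lt N0 Hc.
  have [h [fh hc]] := is_diagonal_series Kg.
  rewrite -{1}(fineK fin) -EFinD lee_fin; apply: le_trans hc.
  have [_ hL' _ _] := fh.
  by rewrite (nrm_ae two0 (Lp_measurable hL) (Lp_measurable hL') (DE' _ _ fh)).
- by move=> g gL; apply: DE'; exact: is_diagonal_tensor.
Qed.

Lemma diag_mapP : is_diag_map mu N%:R (diag_map mu N%:R (m := m)).
Proof.
have [D DP] := diag_map_exists; rewrite /diag_map.
by case: xgetP => [D' -> //|/(_ D)/(_ DP)].
Qed.

End diagonal.
End cell_averages.

(** * Linearity of the projective space and continuity of the diagonal map *)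

Section projective_closure.
Context {disp : measure_display} {R : realType} {X : measurableType disp}.
Variables (mu : probability X R) (m : nat) (m0 : (0 < m)%N).
Local Notation N := (2 * m)%N.
Implicit Types (f : m.-tuple X -> R) (g : nat -> nat -> 'I_m -> X -> R).

Let N0 : (0 < N)%N. Proof. by rewrite muln_gt0. Qed.
Let two0 : (0 < 2)%N := isT.
Let i0 : 'I_m := Ordinal m0.

Lemma proj_series_Lproj K g c f : proj_series mu N K g c f -> Lproj mu N%:R f.
Proof. by move=> /(proj_norm_le N0 i0) H; apply: le_lt_trans H _; exact: ltry. Qed.

Lemma Lproj_Lp f : Lproj mu N%:R f -> f \in Lfun (mu \^ m) N%:R%:E.
Proof. by move=> /(Lproj_series m0)[K [g [c []]]]. Qed.

(** The two series are merged block by block, and the scalar is put into the factor [i0]. *)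
Lemma Lproj_lin a f f' : Lproj mu N%:R f -> Lproj mu N%:R f' ->
  Lproj mu N%:R (fun x => a * f x + f' x).
Proof.
move=> /(Lproj_series m0)[K [g [c [gL gc fL cv]]]] /(Lproj_series m0)[K' [g' [c' [gL' gc' fL' cv']]]].
pose sc (h : 'I_m -> X -> R) i x := (if i == i0 then a else 1) * h i x.
pose K2 k := (K k + K' k)%N.
pose g2 k j := if (j < K k)%N then sc (g k j) else g' k (j - K k)%N.
have scE h : tensor (sc h) = fun x => a * tensor h x.
  apply/funext => x; rewrite /tensor big_split/=; congr (_ * _).
  by rewrite (bigD1 i0)//= ?eqxx big1 ?mulr1// => i /negPf ->.
have scL h : (forall i, h i \in Lfun mu N%:R%:E) -> forall i, sc h i \in Lfun mu N%:R%:E.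
  by move=> hL i; apply: LpZ.
have scC h : (forall i, h i \in Lfun mu N%:R%:E) -> cross_cost mu N (sc h) = `|a| * cross_cost mu N h.
  move=> hL; rewrite /cross_cost (eq_bigr (fun i => `|if i == i0 then a else 1| * nrm mu N (h i))); last by move=> i _; rewrite nrmZ.
  rewrite big_split/=; congr (_ * _).
  by rewrite (bigD1 i0)//= ?eqxx big1 ?mulr1// => i /negPf ->; rewrite normr1.
have split2 (F : ('I_m -> X -> R) -> R) k : \sum_(0 <= j < K2 k) F (g2 k j) =
    \sum_(0 <= j < K k) F (sc (g k j)) + \sum_(0 <= j < K' k) F (g' k j).
  rewrite /K2 (@big_cat_nat _ _ _ (K k) 0 (K k + K' k))//= ?leq_addr//; congr (_ + _).
    by apply: eq_big_nat => j /= jK; rewrite /g2 jK.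
  rewrite -{1}[K k]add0n big_addn addKn; apply: eq_big_nat => j _.
  by rewrite /g2 ltnNge leq_addl/= addnK.
apply: (@proj_series_Lproj K2 g2 (`|a| * c + c')); split.
- by move=> k j; rewrite /g2; case: ifP => _; [exact: scL|exact: gL'].
- move=> n; rewrite /pcost; under eq_bigr do rewrite (split2 (fun h => cross_cost mu N h)).
  rewrite big_split/=; apply: lerD; last exact: gc'.
  apply: (@le_trans _ _ (`|a| * pcost mu N K g n)); last by apply: ler_wpM2l.
  rewrite /pcost mulr_sumr; apply: ler_sum => k _; rewrite mulr_sumr.
  by apply: ler_sum => j _; rewrite scC.
- by apply: LpD => //; exact: LpZ.
- have E n x : psum K2 g2 n x - (a * f x + f' x) = a * (psum K g n x - f x) + (psum K' g' n x - f' x).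
    rewrite /psum; under eq_bigr do rewrite (split2 (fun h => tensor h x)).
    rewrite big_split/= (eq_bigr (fun k => a * \sum_(0 <= j < K k) tensor (g k j) x)); last first.
      by move=> k _; rewrite mulr_sumr; apply: eq_bigr => j _; rewrite scE.
    by rewrite -mulr_sumr; ring.
  have dL n := LpB N0 (psum_Lp N0 K n gL) fL; have dL' n := LpB N0 (psum_Lp N0 K' n gL') fL'.
  apply: (@squeeze_cvgr _ _ _ _ (fun=> 0) (fun n => `|a| * nrm (mu \^ m) N (fun x => psum K g n x - f x) +
      nrm (mu \^ m) N (fun x => psum K' g' n x - f' x))); last 2 first.
  + exact: cvg_cst.
  + rewrite -[X in _ --> X](addr0 0) -{1}(mulr0 `|a|).
    by apply: cvgD => //; apply: cvgM => //; exact: cvg_cst.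
  apply: nearW => n; rewrite nrm_ge0/= (funext (E n)) -nrmZ//.
  by apply: nrmD => //; exact: LpZ.
Qed.

Lemma Lproj_tensor (h : 'I_m -> X -> R) : (forall i, h i \in Lfun mu N%:R%:E) -> Lproj mu N%:R (tensor h).
Proof.
move=> hL; apply: (@proj_series_Lproj (fun k => k == 0%N) (fun _ _ => h) (cross_cost mu N h)).
have E (F : R) n : \sum_(0 <= k < n) \sum_(0 <= j < (k == 0%N)) F = (0 < n)%:R * F.
  case: n => [|n]; first by rewrite big_geq// mul0r.
  rewrite big_nat_recl//= big_nat1 big1 ?addr0 ?mul1r// => i _.
  by rewrite big_geq.
split => //.
- move=> n; rewrite /pcost E; case: n => [|n]; rewrite ?mul0r ?mul1r//.
  exact: cross_cost_ge0.
- exact: (tensor_Lp N0 hL).1.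
- apply: cvg_near_cst; exists 1%N => // -[|n] //= _.
  have -> : (fun x => psum (fun k => k == 0%N) (fun _ _ => h) n.+1 x - tensor h x) = fun=> 0.
    by apply/funext => x; rewrite /psum E mul1r subrr.
  exact: nrm0.
Qed.

Lemma Lproj0 : Lproj mu N%:R (fun _ : m.-tuple X => 0 : R).
Proof.
have T : Lproj mu N%:R (tensor (fun _ : 'I_m => (fun=> 0 : R))) by apply: Lproj_tensor => i; exact: Lp0.
have := Lproj_lin (-1) T T; congr (Lproj _ _); apply/funext => x; ring.
Qed.

Local Notation D := (diag_map mu N%:R (m := m)).

Lemma diag_map_L2 f : Lproj mu N%:R f -> D f \in Lfun mu 2%:R%:E.
Proof. by have [H _ _ _] := diag_mapP mu m0 => /H; rewrite (diag_exponent m0). Qed.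

Lemma diag_map_lin a f f' : Lproj mu N%:R f -> Lproj mu N%:R f' ->
  D (fun x => a * f x + f' x) = (fun x => a * D f x + D f' x) %[ae mu].
Proof. by have [_ H _ _] := diag_mapP mu m0; exact: H. Qed.

Lemma diag_map_nrm K g c f : proj_series mu N K g c f -> nrm mu 2 (D f) <= c.
Proof.
move=> fs; have fP := proj_series_Lproj fs.
have [_ _ H _] := diag_mapP mu m0; have := H _ fP.
rewrite (diag_exponent m0) -nrmE ?diag_map_L2// -lee_fin => /le_trans; apply.
exact: (proj_norm_le N0 i0 fs).
Qed.

Lemma diag_map_sum (J : Type) (s : seq J) (F : J -> m.-tuple X -> R) (G : J -> X -> R) :
  (forall i, Lproj mu N%:R (F i)) -> (forall i, D (F i) = G i %[ae mu]) ->
  Lproj mu N%:R (fun y => \sum_(i <- s) F i y) /\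
  D (fun y => \sum_(i <- s) F i y) = (fun x => \sum_(i <- s) G i x) %[ae mu].
Proof.
move=> FP FG; elim: s => [|i s [sP sG]].
  under eq_fun do rewrite big_nil; split; first exact: Lproj0.
  have := diag_map_lin (-1) Lproj0 Lproj0.
  rewrite (_ : (fun x => -1 * 0 + 0) = fun=> 0); last by apply/funext => x; rewrite mulr0 addr0.
  by apply: filterS => x /(_ I) -> _; rewrite big_nil mulN1r addNr.
have E : (fun y => \sum_(j <- i :: s) F j y) = fun y => 1 * F i y + \sum_(j <- s) F j y.
  by apply/funext => y; rewrite big_cons mul1r.
rewrite E; split; first exact: Lproj_lin.
have H := diag_map_lin 1 (FP i) sP.
apply: filterS3 H (FG i) sG => x /(_ I) -> /(_ I) -> /(_ I) -> _.
by rewrite big_cons mul1r.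
Qed.

(** The tail is a series of small cost, which bounds its diagonal; so diagonals are computed term by
    term. *)
Lemma diag_map_series K g c f : proj_series mu N K g c f ->
  nrm mu 2 (fun x => D f x - diag_psum K g n x) @[n --> \oo] --> (0:R).
Proof.
move=> fs; have [gL gc fL cv] := fs.
have fP := proj_series_Lproj fs.
have pP n : Lproj mu N%:R (psum K g n) /\ D (psum K g n) = diag_psum K g n %[ae mu].
  have T j k : D (tensor (g k j)) = (fun x => \prod_i g k j i x) %[ae mu].
    by have [_ _ _] := diag_mapP mu m0; apply; exact: gL.
  apply: (diag_map_sum _ (F := fun k y => \sum_(0 <= j < K k) tensor (g k j) y)
    (G := fun k x => \sum_(0 <= j < K k) \prod_i g k j i x)) => k.
    by apply: (diag_map_sum _ (F := fun j y => tensor (g k j) y) (G := fun j x => \prod_i g k j i x) _ _).1 => // j; exact: Lproj_tensor.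
  by apply: (diag_map_sum _ (F := fun j y => tensor (g k j) y) (G := fun j x => \prod_i g k j i x) _ _).2 => // j; exact: Lproj_tensor.
have dL n : diag_psum K g n \in Lfun mu 2%:R%:E.
  by have [_ ? _ _] := is_diagonal_psum m0 K n gL.
apply/cvgr0Pnorm_le => e e0; have := proj_series_tail m0 fs e0; apply: filterS => n fs'.
rewrite ger0_norm ?nrm_ge0//; apply: le_trans (diag_map_nrm fs').
rewrite le_eqVlt; apply/orP; left; apply/eqP; apply: nrm_ae => //.
- by apply: Lp_measurable (LpB two0 (diag_map_L2 fP) (dL n)).
- by apply: Lp_measurable (diag_map_L2 (proj_series_Lproj fs')).
have [pn En] := pP n; have := diag_map_lin (-1) pn fP.
rewrite (_ : (fun x => -1 * psum K g n x + f x) = fun x => f x - psum K g n x); last by apply/funext => x; ring.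
by apply: filterS2 En => x /(_ I) H1 /(_ I) -> _; rewrite H1; ring.
Qed.

End projective_closure.
Lemma cvg0_sum (R : realType) (J : Type) (s : seq J) (F : J -> nat -> R) :
  (forall k, F k r @[r --> \oo] --> (0:R)) -> \sum_(k <- s) F k r @[r --> \oo] --> (0:R).
Proof.
move=> F0; elim: s => [|k s IH]; first by under eq_fun do rewrite big_nil; exact: cvg_cst.
rewrite (_ : (fun r => _) = fun r => F k r + \sum_(j <- s) F j r); last by apply/funext => r; rewrite big_cons.
by rewrite -[X in _ --> X](addr0 0); exact: cvgD.
Qed.

(** * The product of the operators I - V_i^* on tensor series *)

Section box_difference.
Context {disp : measure_display} {R : realType} {X : measurableType disp}.
Variables (mu : probability X R) (T : X -> X).
Hypothesis mpT : measure_preserving mu T.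
Variables (m : nat) (m0 : (0 < m)%N).
Local Notation N := (2 * m)%N.
Implicit Types (f : m.-tuple X -> R) (h : 'I_m -> X -> R) (g : nat -> nat -> 'I_m -> X -> R).

Let N0 : (0 < N)%N. Proof. by rewrite muln_gt0. Qed.
Let two0 : (0 < 2)%N := isT.

Definition cobd (u : X -> R) (x : X) : R := u x - adj mu T u x.

Definition box_adj (A : {set 'I_m}) f := adj (mu \^ m) (pow_map T (fun i => (i \in A) : nat)) f.

(* The product over [i] of the operators [I - V_i^*], expanded. *)
Definition box_diff f (y : m.-tuple X) : R := \sum_(A : {set 'I_m}) (-1) ^+ #|A| * box_adj A f y.

Lemma cobd_Lp M u : (0 < M)%N -> u \in Lfun mu M%:R%:E ->
  cobd u \in Lfun mu M%:R%:E /\ nrm mu M (cobd u) <= 2 * nrm mu M u.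
Proof.
move=> M0 uL; have [aL an] := adj_Lp mpT M0 uL; split; first exact: LpB.
by apply: le_trans (nrmB M0 uL aL) _; rewrite mulrDl mul1r lerD2l.
Qed.

Lemma box_adj_Lp M A f : (0 < M)%N -> f \in Lfun (mu \^ m) M%:R%:E ->
  box_adj A f \in Lfun (mu \^ m) M%:R%:E /\ nrm (mu \^ m) M (box_adj A f) <= nrm (mu \^ m) M f.
Proof. by move=> M0 fL; apply: adj_Lp => //; exact: mp_pow_map. Qed.

Lemma box_diff_Lp M f : (0 < M)%N -> f \in Lfun (mu \^ m) M%:R%:E ->
  box_diff f \in Lfun (mu \^ m) M%:R%:E /\
  nrm (mu \^ m) M (box_diff f) <= #|{: {set 'I_m}}|%:R * nrm (mu \^ m) M f.
Proof.
move=> M0 fL; have aL (A : {set 'I_m}) := LpZ ((-1) ^+ #|A|) M0 (box_adj_Lp A M0 fL).1.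
split; first exact: (Lp_sum _ (F := fun (A : {set 'I_m}) y => (-1) ^+ #|A| * box_adj A f y)).
apply: le_trans (nrm_sum _ (F := fun (A : {set 'I_m}) y => (-1) ^+ #|A| * box_adj A f y) M0 aL) _.
rewrite mulr_natl -sumr_const; apply: ler_sum => A _.
rewrite nrmZ//; last exact: (box_adj_Lp A M0 fL).1.
by rewrite normrX normrN1 expr1n mul1r; exact: (box_adj_Lp A M0 fL).2.
Qed.

Lemma box_diff_congr f F : (forall A, box_adj A f = F A %[ae mu \^ m]) ->
  box_diff f = (fun y => \sum_(A : {set 'I_m}) (-1) ^+ #|A| * F A y) %[ae mu \^ m].
Proof.
move=> fF; have : {ae mu \^ m, forall y, forall A, box_adj A f y = F A y}.
  by apply: filter_forall => A; apply: filterS (fF A) => y /(_ I).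
by apply: filterS => y H _; apply: eq_bigr => A _; rewrite H.
Qed.

Lemma box_diffB f f' : intg (mu \^ m) f -> intg (mu \^ m) f' ->
  box_diff (fun y => f y - f' y) = (fun y => box_diff f y - box_diff f' y) %[ae mu \^ m].
Proof.
move=> fi fi'.
apply: filterS (box_diff_congr (fun A : {set 'I_m} => adjB (mp_pow_map mpT (fun i => (i \in A) : nat)) fi fi')) => y /(_ I) -> _.
by rewrite /box_diff -sumrB; apply: eq_bigr => A _; rewrite mulrBr.
Qed.

Lemma box_diff_sum (J : Type) (s : seq J) (F : J -> m.-tuple X -> R) : (forall i, intg (mu \^ m) (F i)) ->
  box_diff (fun y => \sum_(i <- s) F i y) = (fun y => \sum_(i <- s) box_diff (F i) y) %[ae mu \^ m].
Proof.
move=> Fi.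
apply: filterS (box_diff_congr (fun A => adj_sum (mp_pow_map mpT (fun i => (i \in A) : nat)) s Fi)) => y /(_ I) -> _.
by rewrite /box_diff exchange_big/=; apply: eq_bigr => A _; rewrite mulr_sumr.
Qed.

Let ae_trans (F G H : m.-tuple X -> R) : F = G %[ae mu \^ m] -> G = H %[ae mu \^ m] -> F = H %[ae mu \^ m].
Proof. by apply: filterS2 => y FG GH /[dup] /FG -> /GH. Qed.

Lemma ae_sum_eq (J : eqType) (s : seq J) (F G : J -> m.-tuple X -> R) : (forall i, F i = G i %[ae mu \^ m]) ->
  (fun y => \sum_(i <- s) F i y) = (fun y => \sum_(i <- s) G i y) %[ae mu \^ m].
Proof.
move=> FG; elim: s => [|i s IH]; first by apply: aeW => y _; rewrite !big_nil.
by apply: filterS2 (FG i) IH => y /(_ Logic.I) H /(_ Logic.I) H' _; rewrite !big_cons H H'.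
Qed.

(** Distributivity for the product of the h_i - V^* h_i: choosing V^* on the coordinates of A gives
    the term of A. *)
Lemma box_diff_tensor h : (forall i, intg mu (h i)) ->
  box_diff (tensor h) = tensor (fun i => cobd (h i)) %[ae mu \^ m].
Proof.
move=> hi.
have H A : box_adj A (tensor h) = tensor (fun i => if i \in A then adj mu T (h i) else h i) %[ae mu \^ m].
  apply: adj_tensor => // i; case: (i \in A); split => //.
  - exact: adj_intg.
  - by move=> u M mu' uM; rewrite (adj_dual mpT (hi i) mu' uM).
apply: filterS (box_diff_congr H) => y /(_ I) -> _.
pose a i := - adj mu T (h i) (tnth y i); pose b i := h i (tnth y i).
rewrite (_ : tensor (fun i => cobd (h i)) y = \prod_i (a i + b i)); last first.
  by apply: eq_bigr => i _; rewrite addrC.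
rewrite bigA_distr; apply: eq_bigr => A _.
rewrite (eq_bigr (fun i => (if i \in A then -1 else 1) * (if i \in A then adj mu T (h i) else h i) (tnth y i))).
  by rewrite big_split/=; congr (_ * _); rewrite -big_mkcond prodr_const.
by move=> i _; rewrite /a /b; case: ifP => _; rewrite ?mulN1r ?mul1r.
Qed.

(** The operator acts term by term; each factor I - V^* at most doubles a norm, whence 2^m. *)
Lemma box_diff_series K g c s f : proj_series mu N K g c s -> measurable_fun setT f ->
  f = box_diff s %[ae mu \^ m] ->
  proj_series mu N K (fun k j i => cobd (g k j i)) (2 ^+ m * c) f.
Proof.
move=> [gL gc sL cv] mf fs.
have cL k j i := (cobd_Lp N0 (gL k j i)).1.
have gi k j i : intg mu (g k j i) := Lp_intg N0 (gL k j i).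
have ti k j : intg (mu \^ m) (tensor (g k j)) := (tensor_intg (gi k j)).1.
have fL : f \in Lfun (mu \^ m) N%:R%:E.
  apply: (Lp_ae N0 (box_diff_Lp N0 sL).1) => //.
  by apply: filterS fs => y H /H.
split => //.
- move=> n; apply: (@le_trans _ _ (2 ^+ m * pcost mu N K g n)); last by apply: ler_wpM2l.
  rewrite /pcost mulr_sumr; apply: ler_sum => k _; rewrite mulr_sumr; apply: ler_sum => j _.
  have -> : 2 ^+ m = \prod_(i < m) (2 : R) by rewrite prodr_const card_ord.
  rewrite /cross_cost -big_split/=.
  by apply: ler_prod => i _; rewrite nrm_ge0/=; exact: (cobd_Lp N0 (gL k j i)).2.
have E n : (fun y => psum K (fun k j i => cobd (g k j i)) n y - f y) =
    box_diff (fun y => psum K g n y - s y) %[ae mu \^ m].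
  have pi := Lp_intg N0 (psum_Lp N0 K n gL); have si := Lp_intg N0 sL.
  have H1 := box_diffB pi si.
  have H2 : box_diff (psum K g n) = psum K (fun k j i => cobd (g k j i)) n %[ae mu \^ m].
    have bi k : intg (mu \^ m) (fun y => \sum_(0 <= j < K k) tensor (g k j) y) by exact: intg_sum.
    apply: ae_trans (box_diff_sum (index_iota 0 n) bi) _.
    apply: ae_sum_eq => k; apply: ae_trans (box_diff_sum (index_iota 0 (K k)) (ti k)) _.
    by apply: ae_sum_eq => j; exact: box_diff_tensor.
  by apply: filterS3 H1 H2 fs => y /(_ I) A1 /(_ I) A2 /(_ I) A3 _; rewrite A1 A2 A3.
have dL n := LpB N0 (psum_Lp N0 K n gL) sL.
apply: (@squeeze_cvgr _ _ _ _ (fun=> 0) (fun n => #|{: {set 'I_m}}|%:R * nrm (mu \^ m) N (fun y => psum K g n y - s y))); last 2 first.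
- exact: cvg_cst.
- by rewrite -[X in _ --> X](mulr0 #|{: {set 'I_m}}|%:R); apply: cvgM => //; exact: cvg_cst.
apply: nearW => n; rewrite nrm_ge0/= (nrm_ae N0 _ _ (E n)).
- exact: (box_diff_Lp N0 (dL n)).2.
- by apply: Lp_measurable (LpB N0 (psum_Lp N0 K n cL) fL).
- exact: Lp_measurable (box_diff_Lp N0 (dL n)).1.
Qed.

Lemma koopman_series K g c f (k : 'I_m -> nat) : proj_series mu N K g c f ->
  proj_series mu N K (fun q j i x => g q j i (iter (k i) T x)) c (koopman T k f).
Proof.
move=> [gL gc fL cv].
have gk q j i := mp_Lp (mp_iter (k i) mpT) N0 (gL q j i).
have pE n y : psum K (fun q j i x => g q j i (iter (k i) T x)) n y = psum K g n (pow_map T k y).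
  apply: eq_bigr => q _; apply: eq_bigr => j _; by rewrite tensor_pow_map.
split.
- by move=> q j i; exact: (gk q j i).1.
- move=> n; apply: le_trans (gc n); rewrite le_eqVlt; apply/orP; left; apply/eqP.
  by apply: eq_bigr => q _; apply: eq_bigr => j _; apply: eq_bigr => i _; rewrite (gk q j i).2.
- exact: (mp_Lp (mp_pow_map mpT k) N0 fL).1.
- have dL n := LpB N0 (psum_Lp N0 K n gL) fL.
  rewrite (_ : (fun n => _) = fun n => nrm (mu \^ m) N (fun y => psum K g n y - f y))//.
  apply/funext => n; rewrite -(mp_Lp (mp_pow_map mpT k) N0 (dL n)).2.
  by congr (nrm _ _ _); apply/funext => y; rewrite pE.
Qed.

Local Notation D := (diag_map mu N%:R (m := m)).

Definition diag_sum n f (x : X) : R :=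
  \sum_(k : {ffun 'I_m -> 'I_n}) D (koopman T (fun i => k i : nat) f) x.

(** By distributivity, summing the products of g_i(T^{k_i} x) over the cube of indices k gives the
    product of the Birkhoff sums of the g_i. *)
Lemma diag_sum_series K g c f n : proj_series mu N K g c f ->
  diag_sum n f \in Lfun mu 2%:R%:E /\
  nrm mu 2 (fun x => diag_sum n f x - \sum_(0 <= q < r) \sum_(0 <= j < K q) \prod_i bsum T (g q j i) n x)
    @[r --> \oo] --> (0:R).
Proof.
move=> fs; have ks (k : {ffun 'I_m -> 'I_n}) := koopman_series (fun i => k i : nat) fs.
have DL k := diag_map_L2 m0 (proj_series_Lproj m0 (ks k)).
have pL (k : {ffun 'I_m -> 'I_n}) r : diag_psum K (fun q j i x => g q j i (iter (k i) T x)) r \in Lfun mu 2%:R%:E.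
  by have [kL _ _ _] := ks k; have [_ ? _ _] := is_diagonal_psum m0 K r kL.
split; first exact: (Lp_sum _ (F := fun k : {ffun 'I_m -> 'I_n} => D (koopman T (fun i => k i : nat) f))).
have E r x : diag_sum n f x - \sum_(0 <= q < r) \sum_(0 <= j < K q) \prod_i bsum T (g q j i) n x =
   \sum_(k : {ffun 'I_m -> 'I_n}) (D (koopman T (fun i => k i : nat) f) x -
     diag_psum K (fun q j i x => g q j i (iter (k i) T x)) r x).
  rewrite sumrB; congr (_ - _); rewrite /diag_psum exchange_big/=; apply: eq_bigr => q _.
  rewrite exchange_big/=; apply: eq_bigr => j _.
  by rewrite -(bigA_distr_bigA (fun i (a : 'I_n) => g q j i (iter a T x))); apply: eq_bigr => i _; rewrite /bsum big_mkord.
apply: (@squeeze_cvgr _ _ _ _ (fun=> 0) (fun r => \sum_(k : {ffun 'I_m -> 'I_n})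
   nrm mu 2 (fun x => D (koopman T (fun i => k i : nat) f) x - diag_psum K (fun q j i x => g q j i (iter (k i) T x)) r x))); last 2 first.
- exact: cvg_cst.
- apply: (cvg0_sum _ (F := fun (k : {ffun 'I_m -> 'I_n}) r =>
     nrm mu 2 (fun x => D (koopman T (fun i => k i : nat) f) x - diag_psum K (fun q j i x => g q j i (iter (k i) T x)) r x))) => k.
  exact: (diag_map_series m0 (ks k)).
apply: nearW => r; rewrite nrm_ge0/= (funext (E r)).
apply: (nrm_sum _ (F := fun (k : {ffun 'I_m -> 'I_n}) x => D (koopman T (fun i => k i : nat) f) x -
     diag_psum K (fun q j i x => g q j i (iter (k i) T x)) r x)) => // k.
exact: LpB.
Qed.

(** Hoelder splits every term into m Birkhoff sums of functions u - V^* u, each bounded by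
    [bsum_sqrt_bound]. *)
Lemma diag_sum_bound K g c s f n : (0 < n)%N -> proj_series mu N K g c s ->
  measurable_fun setT f -> f = box_diff s %[ae mu \^ m] ->
  nrm mu 2 (diag_sum n f) <= ((2 ^+ m * 2 + 2) * Num.sqrt n%:R) ^+ m * c.
Proof.
move=> n0 ss mf fs; have [gL gc _ _] := ss.
have [SL cv] := diag_sum_series n (box_diff_series ss mf fs).
pose W r x := \sum_(0 <= q < r) \sum_(0 <= j < K q) \prod_i bsum T (cobd (g q j i)) n x.
have bL q j i : bsum T (cobd (g q j i)) n \in Lfun mu N%:R%:E.
  by apply: bsum_Lp => //; exact: (cobd_Lp N0 (gL q j i)).1.
have pL q j := diag_prod_L2 m0 (bL q j).
have kL q : (fun x => \sum_(0 <= j < K q) \prod_i bsum T (cobd (g q j i)) n x) \in Lfun mu 2%:R%:E.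
  by apply: (Lp_sum _ (F := fun j x => \prod_i bsum T (cobd (g q j i)) n x)) => // j; exact: (pL q j).1.
have WL r : W r \in Lfun mu 2%:R%:E.
  exact: (Lp_sum _ (F := fun q x => \sum_(0 <= j < K q) \prod_i bsum T (cobd (g q j i)) n x)).
set C := (2 ^+ m * 2 + 2) * Num.sqrt n%:R.
have C0 : 0 <= C by rewrite /C mulr_ge0// ?sqrtr_ge0// addr_ge0// mulr_ge0// exprn_ge0.
have Wc r : nrm mu 2 (W r) <= C ^+ m * c.
  apply: (@le_trans _ _ (C ^+ m * pcost mu N K g r)); last by apply: ler_wpM2l; rewrite ?exprn_ge0.
  apply: le_trans (nrm_sum _ (F := fun q x => \sum_(0 <= j < K q) \prod_i bsum T (cobd (g q j i)) n x) two0 kL) _.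
  rewrite /pcost mulr_sumr; apply: ler_sum => q _.
  apply: le_trans (nrm_sum _ (F := fun j x => \prod_i bsum T (cobd (g q j i)) n x) two0 (fun j => (pL q j).1)) _.
  rewrite mulr_sumr; apply: ler_sum => j _; apply: le_trans (pL q j).2 _.
  have -> : C ^+ m = \prod_(i < m) C by rewrite prodr_const card_ord.
  rewrite /cross_cost -big_split/=.
  by apply: ler_prod => i _; rewrite nrm_ge0/=; exact: bsum_sqrt_bound.
have : nrm mu 2 (W r) @[r --> \oo] --> nrm mu 2 (diag_sum n f).
  by apply: nrm_cvg => //; rewrite (funext (fun r => nrmBC mu 2 (W r) (diag_sum n f))).
by move=> /cvgn_le; apply.
Qed.

End box_difference.

(** * Recovering a function from the sum of its series *)

Section inclusion_exclusion.
Variables (R : comNzRingType) (m M : nat) (F : ('I_m -> nat) -> R).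

(** The side is M + 2 off A and M + 1 on A: once the coordinates of A are shifted by one, all boxes
    end at the same corner. The outer successor shows that no side is 0. *)
Definition shifted_box (A : {set 'I_m}) (i : 'I_m) : nat := (M.+1 - (i \in A)).+1.

Let to_box A (k : {ffun 'I_m -> 'I_M.+2}) : {dffun forall i, 'I_(shifted_box A i)} :=
  finfun (fun i => inord (k i - (i \in A)) : 'I_(shifted_box A i)).
Let of_box A (k : {dffun forall i, 'I_(shifted_box A i)}) : {ffun 'I_m -> 'I_M.+2} :=
  [ffun i => inord (k i + (i \in A))].

Let shift_bound (A : {set 'I_m}) (j : {ffun 'I_m -> 'I_M.+2}) i : (j i - (i \in A) < shifted_box A i)%N.
Proof. by rewrite /shifted_box ltnS leq_sub2r// -ltnS ltn_ord. Qed.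

(** The shifted box of A consists of the points j of the large cube with j_i > 0 on A. The
    alternating sum gives j the weight of the product of 1 - [j_i > 0], which is 0 except at the
    origin. *)
Lemma inclusion_exclusion :
  \sum_(A : {set 'I_m}) (-1) ^+ #|A| *
    \sum_(k : {dffun forall i, 'I_(shifted_box A i)}) F (fun i => k i + (i \in A))%N = F (fun=> 0%N).
Proof.
pose c (j : {ffun 'I_m -> 'I_M.+2}) i : R := if (0 < j i)%N then -1 else 0.
have E1 (A : {set 'I_m}) : (-1) ^+ #|A| * \sum_(k : {dffun forall i, 'I_(shifted_box A i)}) F (fun i => k i + (i \in A))%N =
    \sum_(j : {ffun 'I_m -> 'I_M.+2}) F (fun i => j i) * \prod_i (if i \in A then c j i else 1).
  rewrite (reindex_onto (to_box A) (@of_box A)); last first.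
    move=> k _; apply/ffunP => i; rewrite /to_box !ffunE; apply: val_inj => /=.
    have ki := ltn_ord (k i); rewrite {2}/shifted_box ltnS in ki.
    have b1 : ((i \in A) <= M.+1)%N by case: (i \in A).
    have kb : (k i + (i \in A) < M.+2)%N by rewrite ltnS -(subnK b1) leq_add2r.
    by rewrite [X in inord (X - _)]inordK// addnK inordK.
  rewrite big_mkcond mulr_sumr; apply: eq_bigr => j _.
  have toE i : to_box A j i = (j i - (i \in A))%N :> nat by rewrite /to_box ffunE inordK.
  have ofE i : of_box (to_box A j) i = inord (j i - (i \in A) + (i \in A)) by rewrite /of_box ffunE toE.
  case: ifPn => [/eqP jE|jE].
    have pos i : i \in A -> (0 < j i)%N.
      move=> iA; rewrite -{1}jE ofE iA/= inordK ?addn1//.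
      by rewrite ltnS; have := ltn_ord (j i); case: (nat_of_ord (j i)) => // v; rewrite subn1/= ltnS.
    have -> : (fun i => to_box A j i + (i \in A))%N = (fun i => j i : nat).
      by apply/funext => i; rewrite toE subnK//; case iA : (i \in A) => //; exact: pos.
    rewrite mulrC; congr (_ * _); rewrite -big_mkcond/= -prodr_const.
    by apply: eq_bigr => i iA; rewrite /c pos.
  have [i iA ji] : exists2 i, i \in A & j i = 0%N :> nat.
    apply: contrapT => H; move/eqP : jE; apply; apply/ffunP => i; rewrite ofE.
    apply: val_inj => /=; case iA : (i \in A) => /=; last by rewrite addn0 subn0 inord_val.
    have j0 : (0 < j i)%N by rewrite lt0n; apply/eqP => ji; apply: H; exists i.
    by rewrite subnK// inord_val.
  by rewrite mulr0 (bigD1 i)//= iA /c ji ltnn mul0r mulr0.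
rewrite (eq_bigr _ (fun A _ => E1 A)) exchange_big/=.
rewrite (bigD1 [ffun=> ord0])//= [X in _ + X]big1 ?addr0.
  rewrite -mulr_sumr -bigA_distr big1 ?mulr1.
    by congr F; apply/funext => i; rewrite ffunE.
  by move=> i _; rewrite /c ffunE/= add0r.
move=> j j0; rewrite -mulr_sumr -bigA_distr.
have [i ji] : exists i, (0 < j i)%N.
  apply: contrapT => H; move/eqP : j0; apply; apply/ffunP => i; rewrite ffunE; apply: val_inj => /=.
  by apply/eqP; rewrite -leqn0 leqNgt; apply/negP => ji; apply: H; exists i.
by rewrite (bigD1 i)//= /c ji addNr mul0r mulr0.
Qed.

End inclusion_exclusion.

Section box_series.
Context {disp : measure_display} {R : realType} {X : measurableType disp}.
Variables (mu : probability X R) (T : X -> X).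
Hypothesis mpT : measure_preserving mu T.
Variables (m : nat) (m0 : (0 < m)%N).
Local Notation N := (2 * m)%N.
Implicit Types (f : m.-tuple X -> R).

Let N0 : (0 < N)%N. Proof. by rewrite muln_gt0. Qed.

Lemma adj_pow_map0 f : intg (mu \^ m) f -> adj (mu \^ m) (pow_map T (fun=> 0%N)) f = f %[ae mu \^ m].
Proof. by move=> fi; rewrite pow_map0; exact: (adj_comp (mp_id (mu \^ m)) fi). Qed.

Lemma adj_pow_map_comp k l f : intg (mu \^ m) f ->
  adj (mu \^ m) (pow_map T l) (adj (mu \^ m) (pow_map T k) f) =
  adj (mu \^ m) (pow_map T (fun i => k i + l i)%N) f %[ae mu \^ m].
Proof.
move=> fi; have := adj_adj (mp_pow_map mpT l) (mp_pow_map mpT k) fi.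
rewrite pow_map_comp.
by have -> : (fun i => l i + k i)%N = (fun i => k i + l i)%N by apply/funext => i; rewrite addnC.
Qed.

Lemma box_sum_Lp (n : 'I_m -> nat) f : f \in Lfun (mu \^ m) N%:R%:E ->
  box_sum mu T n f \in Lfun (mu \^ m) N%:R%:E.
Proof.
move=> fL; apply: (Lp_sum _ (F := fun (k : {dffun forall i : 'I_m, 'I_(n i)}) x =>
  koopman_preadjoint mu T (fun i => k i : nat) f x)) => // k.
by have [] := adj_Lp (mp_pow_map mpT (fun i => k i : nat)) N0 fL.
Qed.

(** V^* on the coordinates of A shifts the box sum by one there, which is the situation of
    [inclusion_exclusion]; the origin contributes f. *)
Lemma box_identity M f : intg (mu \^ m) f ->
  f = (fun y => \sum_(A : {set 'I_m}) (-1) ^+ #|A| * box_adj mu T A (box_sum mu T (shifted_box M A) f) y)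
    %[ae mu \^ m].
Proof.
move=> fi.
have H (A : {set 'I_m}) : box_adj mu T A (box_sum mu T (shifted_box M A) f) =
    (fun y => \sum_(k : {dffun forall i, 'I_(shifted_box M A i)})
      adj (mu \^ m) (pow_map T (fun i => k i + (i \in A))%N) f y) %[ae mu \^ m].
  have ki (k : {dffun forall i, 'I_(shifted_box M A i)}) :
    intg (mu \^ m) (adj (mu \^ m) (pow_map T (fun i => k i : nat)) f).
    by apply: adj_intg => //; exact: mp_pow_map.
  have H1 := adj_sum (mp_pow_map mpT (fun i => (i \in A) : nat)) (index_enum _) ki.
  have H2 := ae_sum_eq (index_enum _) (fun k : {dffun forall i, 'I_(shifted_box M A i)} =>
    adj_pow_map_comp (fun i => k i : nat) (fun i => (i \in A) : nat) fi).
  by apply: filterS2 H1 H2 => y /(_ I) A1 /(_ I) A2 _; exact: etrans A1 A2.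
have : {ae mu \^ m, forall y, forall A : {set 'I_m}, box_adj mu T A (box_sum mu T (shifted_box M A) f) y =
    \sum_(k : {dffun forall i, 'I_(shifted_box M A i)})
      adj (mu \^ m) (pow_map T (fun i => k i + (i \in A))%N) f y}.
  by apply: filter_forall => A; apply: filterS (H A) => y /(_ I).
apply: filterS2 (adj_pow_map0 fi) => y /(_ I) f0 Hy _.
rewrite -f0 -(inclusion_exclusion M (fun k => adj (mu \^ m) (pow_map T k) f y)).
by apply: eq_bigr => A _; rewrite Hy.
Qed.

Lemma proj_norm_nrm f (e : R) : (proj_norm mu N%:R f < e%:E)%E -> nrm (mu \^ m) N f <= e.
Proof. by move=> /(proj_norm_lt N0)[K [g /(proj_series_nrm N0)]]. Qed.

(** All boxes in [box_identity] have large sides, so their sums are close to the same [s]. The sides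
    differ from one coordinate to another, which is where convergence with independent sides is
    used. *)
Lemma box_limit f s : f \in Lfun (mu \^ m) N%:R%:E -> Lproj mu N%:R s ->
  (forall eps : R, 0 < eps -> exists M : nat, forall n : 'I_m -> nat, (forall i, (M <= n i)%N) ->
    (proj_norm mu N%:R (fun x => box_sum mu T n f x - s x)%R < eps%:E)%E) ->
  f = box_diff mu T s %[ae mu \^ m].
Proof.
move=> fL /(Lproj_Lp m0) sL H.
have fi := Lp_intg N0 fL; have si := Lp_intg N0 sL.
have [dL _] := box_diff_Lp mpT N0 sL.
suff n0 : nrm (mu \^ m) N (fun y => f y - box_diff mu T s y) = 0.
  have := nrm_eq0 N0 (LpB N0 fL dL) n0.
  by apply: filterS => y /(_ I) /eqP + _; rewrite subr_eq0 => /eqP.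
apply/eqP; rewrite eq_le nrm_ge0 andbT; apply/ler_addgt0Pl => e e0; rewrite addr0.
pose C : R := #|{: {set 'I_m}}|%:R + 1.
have C0 : 0 < C by rewrite /C ltr_wpDl.
have [M HM] := H (e / C) (divr_gt0 e0 C0).
pose b A := box_sum mu T (shifted_box M.+1 A) f.
have bL A : b A \in Lfun (mu \^ m) N%:R%:E by exact: box_sum_Lp.
have bn A : nrm (mu \^ m) N (fun y => b A y - s y) <= e / C.
  apply: proj_norm_nrm; apply: HM => i; rewrite /shifted_box.
  by case: (i \in A); rewrite ?subn1 ?subn0/= ltnW// ltnW.
have aL (A : {set 'I_m}) := box_adj_Lp mpT A N0 (LpB N0 (bL A) sL).
have E : (fun y => f y - box_diff mu T s y) =
    (fun y => \sum_(A : {set 'I_m}) (-1) ^+ #|A| * box_adj mu T A (fun y => b A y - s y) y) %[ae mu \^ m].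
  have : {ae mu \^ m, forall y, forall A : {set 'I_m}, box_adj mu T A (fun y => b A y - s y) y =
      box_adj mu T A (b A) y - box_adj mu T A s y}.
    apply: filter_forall => A.
    have := adjB (mp_pow_map mpT (fun i => (i \in A) : nat)) (Lp_intg N0 (bL A)) si.
    by apply: filterS => y /(_ I).
  apply: filterS2 (box_identity M.+1 fi) => y /(_ I) H1 H2 _.
  rewrite {1}H1 /box_diff -sumrB; apply: eq_bigr => A _.
  by rewrite H2 mulrBr.
have zL (A : {set 'I_m}) := LpZ ((-1) ^+ #|A|) N0 (aL A).1.
have SL := Lp_sum (index_enum _) (F := fun (A : {set 'I_m}) y => (-1) ^+ #|A| * box_adj mu T A (fun y => b A y - s y) y) N0 zL.
rewrite (nrm_ae N0 _ _ E); [|exact: Lp_measurable (LpB N0 fL dL)|exact: Lp_measurable SL].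
apply: le_trans (nrm_sum (index_enum _) (F := fun (A : {set 'I_m}) y => (-1) ^+ #|A| * box_adj mu T A (fun y => b A y - s y) y) N0 zL) _.
apply: (@le_trans _ _ (\sum_(A : {set 'I_m}) e / C)).
  apply: ler_sum => A _; rewrite nrmZ//; last exact: (aL A).1.
  by rewrite normrX normrN1 expr1n mul1r; apply: le_trans (aL A).2 (bn A).
rewrite sumr_const -mulr_natl mulrA ler_pdivrMr// mulrC; apply: ler_wpM2l; first exact: ltW.
by rewrite /C lerDl.
Qed.

End box_series.

(** * The case of one variable *)

Section one_dimensional.
Context {disp : measure_display} {R : realType} {X : measurableType disp}.
Variables (mu : probability X R) (T : X -> X).
Hypothesis mpT : measure_preserving mu T.
Implicit Types (f s : 1.-tuple X -> R).

Let one0 : (0 < 1)%N := isT.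
Let two0 : (0 < 2)%N := isT.

Definition one_tuple (x : X) : 1.-tuple X := tcons (x, [tuple]).

Lemma tnth_one_tuple x i : tnth (one_tuple x) i = x.
Proof. by rewrite (ord1 i). Qed.

Lemma pow_map_one_tuple k x : pow_map T k (one_tuple x) = one_tuple (iter (k ord0) T x).
Proof. by apply: eq_from_tnth => i; rewrite tnth_mktuple !tnth_one_tuple (ord1 i). Qed.

Lemma Rint_one_tuple f : intg (mu \^ 1) f ->
  intg mu (f \o one_tuple) /\ \int[mu \^ 1]_y f y = \int[mu]_x f (one_tuple x).
Proof.
move=> fi.
have E x (t : 0.-tuple X) : f (tcons (x, t)) = f (one_tuple x) by rewrite (tuple0 t).
have si x : intg (mu \^ 0) (fun t => f (tcons (x, t))).
  by under eq_fun do rewrite E; exact: intg_cst.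
have [i1 ->] := pow_Rint fi si.
have E2 x : \int[mu \^ 0]_t f (tcons (x, t)) = f (one_tuple x).
  by under eq_Rintegral do rewrite E; rewrite Rint_cst.
have E3 : (fun x => \int[mu \^ 0]_t f (tcons (x, t))) = f \o one_tuple by exact/funext.
by split; [rewrite -E3|apply: eq_Rintegral => x _; exact: E2].
Qed.

Lemma measurable_one_tuple : measurable_fun setT one_tuple.
Proof.
apply/measurable_fun_tnthP => i; rewrite (_ : _ \o _ = id); first exact: measurable_id.
by apply/funext => x /=; rewrite tnth_one_tuple.
Qed.

Lemma Lp_one_tuple N f : (0 < N)%N -> f \in Lfun (mu \^ 1) N%:R%:E ->
  (f \o one_tuple) \in Lfun mu N%:R%:E /\ nrm mu N (f \o one_tuple) = nrm (mu \^ 1) N f.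
Proof.
move=> N0 fL; have [mf fi] := (LpP _ _ N0).1 fL.
have [i1 e1] := Rint_one_tuple fi.
have L : (f \o one_tuple) \in Lfun mu N%:R%:E.
  apply/LpP => //; split; last exact: i1.
  by apply: measurableT_comp => //; exact: measurable_one_tuple.
split => //; apply: (@pexpIrn _ N) => //; rewrite ?nnegrE ?nrm_ge0//.
by rewrite !nrm_pow// e1.
Qed.

Lemma one_tuple_ae f f' : f \in Lfun (mu \^ 1) 1%:R%:E -> f' \in Lfun (mu \^ 1) 1%:R%:E ->
  f = f' %[ae mu \^ 1] -> f \o one_tuple = f' \o one_tuple %[ae mu].
Proof.
move=> fL fL' ff'; have dL := LpB one0 fL fL'.
have [dL' dn] := Lp_one_tuple one0 dL.
have n0 : nrm mu 1 ((fun y => f y - f' y) \o one_tuple) = 0.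
  rewrite dn (nrm_ae one0 (g := fun=> 0)) ?nrm0//; first exact: Lp_measurable dL.
  by apply: filterS ff' => y /(_ I) -> _; rewrite subrr.
by apply: filterS (nrm_eq0 one0 dL' n0) => x /(_ I) /eqP /= + _; rewrite subr_eq0 => /eqP.
Qed.

Local Notation D := (diag_map mu 2%:R (m := 1)).

(** Both sides agree on finite tensor sums and are limits along the series of f. *)
Lemma diag_map_one_tuple f : Lproj mu 2%:R f -> D f = f \o one_tuple %[ae mu].
Proof.
move=> fP; have [K [g [c fs]]] := Lproj_series (m := 1) one0 fP.
have DL := diag_map_L2 (m := 1) one0 fP.
have [gL gc fL cv] := fs.
have [fL' _] := Lp_one_tuple two0 fL.
have dE r : diag_psum K g r = psum K g r \o one_tuple.
  apply/funext => x; apply: eq_bigr => k _; apply: eq_bigr => j _; apply: eq_bigr => i _.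
  by rewrite tnth_one_tuple.
have c1 := diag_map_series (m := 1) one0 fs.
have pL r := LpB two0 (psum_Lp two0 K r gL) fL.
suff n0 : nrm mu 2 (fun x => D f x - (f \o one_tuple) x) = 0.
  have := nrm_eq0 two0 (LpB two0 DL fL') n0.
  by apply: filterS => x /(_ I) /eqP + _; rewrite subr_eq0 => /eqP.
have lim : nrm mu 2 (fun x => D f x - diag_psum K g r x) +
    nrm (mu \^ 1) 2 (fun y => psum K g r y - f y) @[r --> \oo] --> (0:R).
  by rewrite -[X in _ --> X](addr0 0); exact: cvgD.
apply/eqP; rewrite eq_le nrm_ge0 andbT; apply: (cvgn_ge lim) => //; apply: nearW => r.
rewrite -(Lp_one_tuple two0 (pL r)).2 dE.
have pL' := (Lp_one_tuple two0 (psum_Lp two0 K r gL)).1.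
apply: le_trans (nrmD two0 (LpB two0 DL pL') (LpB two0 pL' fL')).
rewrite le_eqVlt; apply/orP; left; apply/eqP; congr (nrm _ _ _).
by apply/funext => x /=; ring.
Qed.

Lemma diag_sum_one_tuple f n : Lproj mu 2%:R f ->
  diag_sum mu T (m := 1) n f = bsum T (f \o one_tuple) n %[ae mu].
Proof.
move=> fP.
have [K [g [c fs]]] := Lproj_series (m := 1) one0 fP.
have : {ae mu, forall x, forall k : {ffun 'I_1 -> 'I_n},
    D (koopman T (fun i => k i : nat) f) x = f (one_tuple (iter (k ord0) T x))}.
  apply: filter_forall => k.
  have kP := proj_series_Lproj (m := 1) one0 (koopman_series mpT one0 (fun i => k i : nat) fs).
  apply: filterS (diag_map_one_tuple kP) => x /(_ I) ->.
  by congr f; exact: pow_map_one_tuple.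
apply: filterS => x Hx _; rewrite /diag_sum (eq_bigr _ (fun k _ => Hx k)) /bsum big_mkord.
transitivity (\sum_(k : {ffun 'I_1 -> 'I_n}) \prod_(i < 1) f (one_tuple (iter (k i) T x))).
  by apply: eq_bigr => k _; rewrite big_ord1.
by rewrite -(bigA_distr_bigA (fun (i : 'I_1) (j : 'I_n) => f (one_tuple (iter j T x)))) big_ord1.
Qed.

Lemma adj_one_tuple s : intg (mu \^ 1) s ->
  adj (mu \^ 1) (pow_map T (fun=> 1%N)) s \o one_tuple = adj mu T (s \o one_tuple) %[ae mu].
Proof.
move=> si; have mp1 := mp_pow_map mpT (fun _ : 'I_1 => 1%N).
have ai := adj_intg mp1 si.
apply: ae_eq_sym; apply: adj_unique => //; [exact: (Rint_one_tuple si).1|exact: (Rint_one_tuple ai).1|].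
move=> h M mh hM.
have mh' : measurable_fun setT (fun y : 1.-tuple X => h (tnth y ord0)).
  by apply: (measurableT_comp mh); exact: measurable_tnth.
have := adj_dual mp1 si mh' (fun y => hM _).
have i1 := intgM_bounded ai mh' (fun y => hM _).
rewrite (Rint_one_tuple i1).2.
have i2 : intg (mu \^ 1) (fun y => s y * h (tnth (pow_map T (fun=> 1%N) y) ord0)).
  apply: (intgM_bounded (M := M) si); last by [].
  exact: (measurableT_comp mh' (measurable_pow_map mpT _)).
rewrite (Rint_one_tuple i2).2 /comp.
by under [RHS]eq_Rintegral do rewrite pow_map_one_tuple tnth_one_tuple; under eq_Rintegral do rewrite tnth_one_tuple.
Qed.

Lemma box_diff_one s : intg (mu \^ 1) s ->
  box_diff mu T s = (fun y => s y - adj (mu \^ 1) (pow_map T (fun=> 1%N)) s y) %[ae mu \^ 1].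
Proof.
move=> si; apply: filterS (adj_pow_map0 T si) => y /(_ I) s0 _.
rewrite /box_diff (bigD1 finset.set0)//= cards0 expr0 mul1r (bigD1 [set: 'I_1]%SET)/=; last first.
  by apply/eqP => /setP/(_ ord0); rewrite !inE.
rewrite big1 ?addr0; last first.
  move=> A /andP[/eqP A0 /eqP A1]; exfalso.
  case A2 : (ord0 \in A); [apply: A1|apply: A0]; apply/setP => i; rewrite (ord1 i) A2 !inE//.
rewrite cardsT card_ord expr1 mulN1r /box_adj.
have -> : (fun i : 'I_1 => (i \in finset.set0) : nat) = fun=> 0%N by apply/funext => i; rewrite inE.
have -> : (fun i : 'I_1 => (i \in [set: 'I_1]%SET) : nat) = fun=> 1%N by apply/funext => i; rewrite inE.
by rewrite s0.
Qed.

(** The function [L2_series] is an arbitrary choice, but its norm is the limit of the norms of the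
    partial sums. *)
Lemma L2_series_unique (u : nat -> 1.-tuple X -> R) s : s \in Lfun (mu \^ 1) 2%:R%:E ->
  (forall k, u k \in Lfun (mu \^ 1) 2%:R%:E) ->
  nrm (mu \^ 1) 2 (fun y => \sum_(0 <= k < n) u k y - s y) @[n --> \oo] --> (0:R) ->
  nrm (mu \^ 1) 2 (L2_series mu u) = nrm (mu \^ 1) 2 s.
Proof.
move=> sL uL us.
have SL n : (fun y => \sum_(0 <= k < n) u k y) \in Lfun (mu \^ 1) 2%:R%:E.
  exact: (Lp_sum _ (F := u)).
pose Q := [set s : 1.-tuple X -> R | s \in Lfun (mu \^ 1) 2%:E /\
    'N[mu \^ 1]_(2%:E)[EFin \o (fun x => \sum_(0 <= k < n) u k x - s x)%R]%E
      @[n --> \oo] --> 0%E].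
have Qs : Q s.
  split => //.
  rewrite (_ : (fun n => _) = fun n => (nrm (mu \^ 1) 2 (fun y => \sum_(0 <= k < n) u k y - s y))%:E).
    by apply: cvg_EFin => //; exact: nearW.
  by apply/funext => n; rewrite nrmE//; exact: LpB.
have [tL tn] : Q (L2_series mu u) by rewrite /L2_series; case: xgetP => [t -> //|/(_ s)/(_ Qs)].
have tn' : nrm (mu \^ 1) 2 (fun y => \sum_(0 <= k < n) u k y - L2_series mu u y) @[n --> \oo] --> (0:R).
  exact: (fine_cvg tn).
have l1 := nrm_cvg two0 SL sL us; have l2 := nrm_cvg two0 SL tL tn'.
exact: (cvg_unique _ l2 l1).
Qed.

Lemma box_sum_one n f y : box_sum mu T (fun _ : 'I_1 => n) f y =
  \sum_(0 <= k < n) koopman_preadjoint mu T (fun=> k) f y.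
Proof.
rewrite /box_sum big_mkord.
transitivity (\sum_(k : {ffun 'I_1 -> 'I_n}) \prod_(i < 1) koopman_preadjoint mu T (fun=> k i : nat) f y); last first.
  by rewrite -(bigA_distr_bigA (fun (i : 'I_1) (j : 'I_n) => koopman_preadjoint mu T (fun=> j : nat) f y)) big_ord1.
apply: eq_bigr => k _; rewrite big_ord1.
by congr (koopman_preadjoint _ _ _ _ _); apply/funext => i; rewrite (ord1 i).
Qed.

(** V V^* u is the orthogonal projection of u onto functions of T x and has the norm of V^* u. This
    identifies [sigma2] with the variance of the martingale difference, hence its sign. *)
Lemma adj_pythagoras u : u \in Lfun mu 2%:R%:E ->
  \int[mu]_x ((u x - adj mu T u (T x)) ^+ 2) = nrm mu 2 u ^+ 2 - nrm mu 2 (adj mu T u) ^+ 2.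
Proof.
move=> uL; have [aL _] := adj_Lp mpT two0 uL; have [aTL aTn] := mp_Lp mpT two0 aL.
have ui := Lp_intg two0 uL.
have i1 := L2_mul uL aTL; have i2 := L2_mul aL aL.
have E x : (u x - adj mu T u (T x)) ^+ 2 = u x * u x - 2 * (u x * adj mu T u (T x)) + adj mu T u (T x) * adj mu T u (T x).
  by ring.
under eq_Rintegral do rewrite E.
have j1 := L2_mul uL uL; have j2 := L2_mul aTL aTL.
move: j1 i1 j2 => [j1 _] [i1 _] [j2 _].
have z1 := intgZ 2 i1.
rewrite (RintD (intgB j1 z1) j2) (RintB j1 z1) (RintZ _ i1).
rewrite -(adj_dual_intg mpT ui (Lp_measurable aL) i2.1 i1).
rewrite (mp_Rint mpT i2.1) !nrm2E//.
under [in RHS]eq_Rintegral do rewrite expr2.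
under [X in _ = _ - X]eq_Rintegral do rewrite expr2.
by ring.
Qed.

(** The second series lacks the term k = 0, which is f = s - V^* s; so its sum is V^* s. *)
Lemma L2_series_box f s : f \in Lfun (mu \^ 1) 2%:R%:E -> s \in Lfun (mu \^ 1) 2%:R%:E ->
  f = box_diff mu T s %[ae mu \^ 1] ->
  nrm (mu \^ 1) 2 (fun y => box_sum mu T (fun=> n) f y - s y) @[n --> \oo] --> (0:R) ->
  nrm (mu \^ 1) 2 (L2_series mu (fun k => koopman_preadjoint mu T (fun=> k) f)) = nrm mu 2 (s \o one_tuple) /\
  nrm (mu \^ 1) 2 (L2_series mu (fun k => koopman_preadjoint mu T (fun=> k.+1) f)) =
    nrm mu 2 (adj mu T (s \o one_tuple)).
Proof.
move=> fL sL fs cv; pose W k := koopman_preadjoint mu T (fun _ : 'I_1 => k) f.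
have WL k : W k \in Lfun (mu \^ 1) 2%:R%:E := (adj_Lp (mp_pow_map mpT (fun=> k)) two0 fL).1.
have si := Lp_intg two0 sL.
have cv' : nrm (mu \^ 1) 2 (fun y => \sum_(0 <= k < n) W k y - s y) @[n --> \oo] --> (0:R).
  rewrite (_ : (fun n => _) = fun n => nrm (mu \^ 1) 2 (fun y => box_sum mu T (fun=> n) f y - s y))//.
  by apply/funext => n; congr (nrm _ _ _); apply/funext => y; rewrite box_sum_one.
pose a := adj (mu \^ 1) (pow_map T (fun=> 1%N)) s.
have aL : a \in Lfun (mu \^ 1) 2%:R%:E := (adj_Lp (mp_pow_map mpT (fun=> 1%N)) two0 sL).1.
have W0 : {ae mu \^ 1, forall y, W 0 y = s y - a y}.
  apply: filterS3 (adj_pow_map0 T (Lp_intg two0 fL)) fs (box_diff_one si) => y /(_ I) H1 /(_ I) H2 /(_ I) H3.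
  by rewrite -H3 -H2; exact: H1.
split.
  by rewrite (L2_series_unique sL WL cv') (Lp_one_tuple two0 sL).2.
rewrite (L2_series_unique (s := a) (u := fun k => W k.+1)) => //.
  rewrite -(Lp_one_tuple two0 aL).2; apply: nrm_ae => //.
  - exact: Lp_measurable (Lp_one_tuple two0 aL).1.
  - by apply: Lp_measurable (adj_Lp mpT two0 (Lp_one_tuple two0 sL).1).1.
  - exact: adj_one_tuple.
have := cvg_comp _ _ (@cvg_addnr 1) cv'; rewrite /comp.
rewrite (_ : (fun n => nrm _ _ (fun y => \sum_(0 <= k < n + 1) _ - _)) =
  fun n => nrm (mu \^ 1) 2 (fun y => \sum_(0 <= k < n) W k.+1 y - a y))//.
apply/funext => n; apply: nrm_ae => //.
- by apply: Lp_measurable (LpB two0 (Lp_sum _ (F := W) two0 WL) sL).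
- by apply: Lp_measurable (LpB two0 (Lp_sum _ (F := fun k => W k.+1) two0 _) aL).
by apply: filterS W0 => y H _; rewrite addn1 big_nat_recl//= H; ring.
Qed.

End one_dimensional.
(** * Limit of the von Mises statistics *)

Section weak_limit.
Context d (X : measurableType d) (R : realType).
Variables (mu : probability X R) (T : X -> X).
Hypothesis exT : exact_map mu T.
Variable e0 : X -> R.
Hypothesis eL : e0 \in Lfun mu 2%:R%:E.
Hypothesis ae0 : adj mu T e0 = (fun=> 0) %[ae mu].
Variables (Z : nat -> X -> R) (c B : R).
Hypothesis c0 : 0 <= c.
Hypothesis ZL : forall n, Z n \in Lfun mu 2%:R%:E.
Local Notation approx n := (fun x => c / Num.sqrt n%:R * bsum T e0 n x).
Hypothesis Zr : forall n, (0 < n)%N -> nrm mu 2 (fun x => Z n x - approx n x) <= B / Num.sqrt n%:R.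

Let two0 : (0 < 2)%N := isT.
Let mpT : measure_preserving mu T := exT.1.
Let var : R := \int[mu]_x (e0 x ^+ 2).

Let aL n : approx n \in Lfun mu 2%:R%:E.
Proof. by apply: LpZ => //; exact: bsum_Lp. Qed.

Let an n : (0 < n)%N -> nrm mu 2 (approx n) = c * Num.sqrt var.
Proof.
move=> n0; rewrite nrmZ//; last exact: bsum_Lp.
have v0 : 0 <= var by apply: Rint_ge0 => x; exact: sqr_ge0.
have -> : nrm mu 2 (bsum T e0 n) = Num.sqrt n%:R * Num.sqrt var.
  rewrite -sqrtrM// -(martingale_var exT eL ae0) sqrtr_sqr ger0_norm//; exact: nrm_ge0.
have s0 : Num.sqrt n%:R != 0 :> R by rewrite sqrtr_eq0 -ltNge ltr0n.
by rewrite ger0_norm ?divr_ge0 ?sqrtr_ge0//; field.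
Qed.

Let B0 : 0 <= B.
Proof. by have := le_trans (nrm_ge0 _ _ _) (Zr (isT : (0 < 1)%N)); rewrite sqrtr1 divr1. Qed.

Let rem_cvg : nrm mu 2 (fun x => Z n.+1 x - approx n.+1 x) @[n --> \oo] --> (0:R).
Proof.
have s0 : (Num.sqrt n.+1%:R)^-1 @[n --> \oo] --> (0:R).
  have := @cvg_comp _ _ _ (fun n => n.+1%:R^-1 : R) Num.sqrt _ _ _ (@cvg_harmonic R) (@sqrt_continuous R 0).
  rewrite sqrtr0 (_ : Num.sqrt \o _ = fun n => (Num.sqrt n.+1%:R)^-1)//.
  by apply/funext => n /=; rewrite sqrtrV.
apply: (@squeeze_cvgr _ _ _ _ (fun=> 0) (fun n => B * (Num.sqrt n.+1%:R)^-1)); last 2 first.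
- exact: cvg_cst.
- by rewrite -[X in _ --> X](mulr0 B); apply: cvgM => //; exact: cvg_cst.
by apply: nearW => n; rewrite nrm_ge0 Zr.
Qed.

(** For n > 0 the martingale approximation has norm exactly c sqrt var, and [Z n] differs from it by
    O(1 / sqrt n) in norm. *)
Lemma weak_limit_second_moment :
  nrm mu 2 (Z n) ^+ 2 @[n --> \oo] --> c ^+ 2 * var.
Proof.
have v0 : 0 <= var by apply: Rint_ge0 => x; exact: sqr_ge0.
rewrite -cvg_shiftS (_ : c ^+ 2 * var = (c * Num.sqrt var) ^+ 2); last by rewrite exprMn sqr_sqrtr.
apply: cvgn_exp; apply/cvgrPdist_le => e e_gt0.
have /cvgr0Pnorm_le/(_ _ e_gt0) := rem_cvg; apply: filterS => n.
rewrite ger0_norm ?nrm_ge0//; apply: le_trans.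
rewrite distrC -(an (isT : (0 < n.+1)%N)).
exact: nrm_dist.
Qed.

(** The approximation satisfies the central limit theorem; cosines being 1-Lipschitz, an L_2 error
    tending to 0 does not change the limit of the characteristic functions. *)
Lemma weak_limit : cvg_in_distribution mu Z (centered_gaussian (c ^+ 2 * var)).
Proof.
have v0 : 0 <= var by apply: Rint_ge0 => x; exact: sqr_ge0.
split; first by move=> n; exact: Lp_measurable (ZL n).
(* The index is shifted because the approximation is controlled for n > 0 only. *)
move=> phi cphi [M phiM]; rewrite -cvg_shiftS /=.
(* Bounded second moments supply the tightness required by the continuity theorem. *)
have Zb n : nrm mu 2 (Z n.+1) <= c * Num.sqrt var + B.
  have h1 := nrm_dist two0 (ZL n.+1) (aL n.+1).
  have h2 := Zr (isT : (0 < n.+1)%N).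
  rewrite (an (isT : (0 < n.+1)%N)) in h1.
  have s1 : 1 <= Num.sqrt n.+1%:R :> R.
    have : Num.sqrt 1 <= Num.sqrt n.+1%:R :> R by rewrite ler_sqrt ?ler1n.
    by rewrite sqrtr1.
  have h3 : B / Num.sqrt n.+1%:R <= B.
    by rewrite ler_pdivrMr ?(lt_le_trans ltr01)//; apply: ler_peMr.
  by have := le_trans (ler_norm _) h1; lra.
apply: (@levy_bounded_continuous _ _ _ mu _ (fun n => Z n.+1) ((c * Num.sqrt var + B) ^+ 2) _ _ _ _ phi M) => //.
- by move=> n; exact: Lp_measurable (ZL n.+1).
- by move=> n; have := (L2_mul (ZL n.+1) (ZL n.+1)).1.
- move=> n; rewrite -nrm2E// ler_pXn2r ?nnegrE ?nrm_ge0//.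
  by rewrite addr_ge0// mulr_ge0// sqrtr_ge0.
move=> t th.
have -> : \int[centered_gaussian (c ^+ 2 * var)]_y cos (t * y - th) =
    expR (- ((t * c) ^+ 2 * var / 2)) * cos th.
  (* The Dirac measure obeys the same formula, as the exponent is then 0. *)
  rewrite /centered_gaussian; have [cv0|cv0] := eqVneq (c ^+ 2 * var) 0.
    rewrite /Rintegral integral_dirac//; last first.
      apply/measurable_EFinP; apply: (measurableT_comp (f := cos)).
        by apply: continuous_measurable_fun; exact: continuous_cos.
      by apply: measurable_funB => //; exact: measurable_funM.
    rewrite diracT mul1e/= mulr0 sub0r cosN exprMn -(mulrA _ (c ^+ 2)) cv0 mulr0 mul0r oppr0 expR0.
    by rewrite mul1r.
  have s0 : Num.sqrt (c ^+ 2 * var) != 0.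
    by rewrite sqrtr_eq0 -ltNge lt_neqAle eq_sym cv0 mulr_ge0// sqr_ge0.
  rewrite normal_cos// sqr_sqrtr; last by rewrite mulr_ge0// sqr_ge0.
  by rewrite exprMn !mulrA.
have mcosu (u : X -> R) : measurable_fun setT u -> intg mu (fun x => cos (t * u x - th)).
  move=> mu'; apply: (@intg_bounded _ _ _ mu _ 1); last by move=> x; rewrite ler_norml cos_geN1 cos_le1.
  apply: (measurableT_comp (f := cos)).
    by apply: continuous_measurable_fun; exact: continuous_cos.
  by apply: measurable_funB => //; exact: measurable_funM.
have c1 := @martingale_clt_char _ _ _ mu T exT e0 eL ae0 (t * c) th.
have c2 : \int[mu]_x cos (t * approx n.+1 x - th) @[n --> \oo] --> expR (- ((t * c) ^+ 2 * var / 2)) * cos th.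
  move: c1; rewrite -cvg_shiftS; apply: cvg_trans; apply: near_eq_cvg; apply: nearW => n /=.
  by apply: eq_Rintegral => x _; rewrite !mulrA.
apply/cvgrPdist_le => e e_gt0; have e2 : 0 < e / 2 by rewrite divr_gt0.
have t0 : 0 < `|t| + 1 by rewrite ltr_wpDl.
have ev1 : \forall n \near \oo, `|expR (- ((t * c) ^+ 2 * var / 2)) * cos th -
    \int[mu]_x cos (t * approx n.+1 x - th)| <= e / 2 by exact: (cvgrPdist_le _ _).1 c2 _ e2.
have ev2 : \forall n \near \oo, `|nrm mu 2 (fun x => Z n.+1 x - approx n.+1 x)| <= e / 2 / (`|t| + 1).
  exact: (cvgr0Pnorm_le _).1 rem_cvg _ (divr_gt0 e2 t0).
near=> n.
have h1 : `|expR (- ((t * c) ^+ 2 * var / 2)) * cos th - \int[mu]_x cos (t * approx n.+1 x - th)| <= e / 2 by near: n.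
have h2 : `|nrm mu 2 (fun x => Z n.+1 x - approx n.+1 x)| <= e / 2 / (`|t| + 1) by near: n.
rewrite ger0_norm ?nrm_ge0// in h2.
have dL := LpB two0 (ZL n.+1) (aL n.+1).
have h3 : `|\int[mu]_x cos (t * approx n.+1 x - th) - \int[mu]_x cos (t * Z n.+1 x - th)| <= e / 2.
  have i1 := mcosu _ (Lp_measurable (aL n.+1)); have i2 := mcosu _ (Lp_measurable (ZL n.+1)).
  rewrite -RintB//; apply: le_trans (Rint_norm (intgB i1 i2)) _.
  apply: (@le_trans _ _ (\int[mu]_x (`|t| * `|Z n.+1 x - approx n.+1 x|))).
    apply: Rint_le; [by apply: intg_norm; exact: intgB|by apply: intgZ; apply: intg_norm; exact: (Lp_intg two0)|].
    move=> x; apply: le_trans (cos_lip _ _) _; rewrite -normrM distrC le_eqVlt; apply/orP; left; apply/eqP.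
    by congr `|_|; ring.
  rewrite RintZ; last by apply: intg_norm; exact: (Lp_intg two0).
  rewrite Rint_le_nrm1; last exact: (Lp_intg two0).
  have h4 := (Lp_incl (isT : (0 < 1 <= 2)%N) dL).2.
  apply: (@le_trans _ _ ((`|t| + 1) * (e / 2 / (`|t| + 1)))); last by rewrite mulrC divfK// gt_eqF.
  apply: ler_pM => //; rewrite ?nrm_ge0 ?lerDl//; exact: le_trans h4 h2.
have -> : expR (- ((t * c) ^+ 2 * var / 2)) * cos th - \int[mu]_x cos (t * Z n.+1 x - th) =
  (expR (- ((t * c) ^+ 2 * var / 2)) * cos th - \int[mu]_x cos (t * approx n.+1 x - th)) +
  (\int[mu]_x cos (t * approx n.+1 x - th) - \int[mu]_x cos (t * Z n.+1 x - th)) by ring.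
by apply: le_trans (ler_normD _ _) _; lra.
Unshelve. all: by end_near.
Qed.

End weak_limit.

(** * Decomposition of the von Mises sum *)

Section restriction_sum.
Variables (R : comNzRingType) (d n : nat) (S : {set 'I_d}) (G : {ffun 'I_#|S| -> 'I_n} -> R).

Let restr (k : {ffun 'I_d -> 'I_n}) : {ffun 'I_#|S| -> 'I_n} := [ffun i => k (enum_val i)].

(** The extensions of an index on S are counted as a product over coordinates: one choice on S and n
    choices off S. *)
Lemma sum_restriction : \sum_k G (restr k) = n%:R ^+ (d - #|S|) * \sum_k G k.
Proof.
rewrite (partition_big restr xpredT)//= mulr_sumr; apply: eq_bigr => k' _.
rewrite (eq_bigr (fun=> 1 * G k')); last by move=> k /eqP ->; rewrite mul1r.
rewrite -mulr_suml; congr (_ * _).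
pose Q (l : 'I_d) : pred 'I_n := fun j => [forall i : 'I_#|S|, (enum_val i == l) ==> (j == k' i)].
rewrite (eq_bigl (fun k => k \in family Q)); last first.
  move=> k; apply/eqP/familyP => [E l|H].
    by apply/forallP => i; apply/implyP => /eqP <-; rewrite -E ffunE.
  apply/ffunP => i; rewrite ffunE; have /forallP/(_ i) := H (enum_val i).
  by rewrite eqxx => /eqP.
rewrite (eq_bigr (fun k : {ffun 'I_d -> 'I_n} => \prod_(l < d) 1)); last by move=> k _; rewrite big1.
rewrite -(bigA_distr_big_dep Q (fun _ _ => 1)).
rewrite (eq_bigr (fun l => if l \in S then 1 else n%:R)); last first.
  move=> l _; case: ifPn => lS.
    rewrite (big_pred1 (k' (enum_rank_in lS l)))// => j; apply/forallP/eqP => [H|-> i].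
      by have := H (enum_rank_in lS l); rewrite enum_rankK_in// eqxx => /eqP.
    by apply/implyP => /eqP il; apply/eqP; congr (k' _); apply: enum_val_inj; rewrite il enum_rankK_in.
  rewrite (eq_bigl xpredT); last first.
    move=> j; apply/forallP => i; apply/implyP => /eqP il.
    by move: lS; rewrite -il enum_valP.
  by rewrite sumr_const card_ord.
rewrite (bigID (fun l => l \in S))/= big1 ?mul1r; last by move=> l ->.
rewrite (eq_bigr (fun=> n%:R)); last by move=> l /negPf ->.
rewrite prodr_const; congr (_ ^+ _).
have E := cardC (mem S); rewrite card_ord in E.
have Sd : (#|S| <= d)%N by have := max_card (mem S); rewrite card_ord.
by apply: (@addnI #|S|); rewrite subnKC.
Qed.

End restriction_sum.

Section von_mises_decomposition.
Context {disp : measure_display} {R : realType} {X : measurableType disp}.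
Variables (mu : probability X R) (T : X -> X).
Hypothesis exT : exact_map mu T.

Let mpT : measure_preserving mu T := exT.1.
Let two0 : (0 < 2)%N := isT.

Lemma diag_sum_Lp m (f : m.-tuple X -> R) n : (0 < m)%N -> Lproj mu (2 * m)%:R f ->
  diag_sum mu T n f \in Lfun mu 2%:R%:E.
Proof.
move=> m0 /(Lproj_series m0)[K [g [c fs]]].
exact: (diag_sum_series mpT m0 n fs).1.
Qed.

Lemma box_series_diff m (f : m.-tuple X -> R) : (0 < m)%N -> Lproj mu (2 * m)%:R f ->
  box_series_cvg mu T (2 * m)%:R f ->
  exists s, [/\ Lproj mu (2 * m)%:R s, f = box_diff mu T s %[ae mu \^ m] &
    forall eps : R, 0 < eps -> exists M : nat, forall n : 'I_m -> nat, (forall i, (M <= n i)%N) ->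
      (proj_norm mu (2 * m)%:R (fun x => box_sum mu T n f x - s x)%R < eps%:E)%E].
Proof.
move=> m0 fP [s [sP H]]; exists s; split => //.
exact: (box_limit mpT m0 (Lproj_Lp m0 fP) sP H).
Qed.

Lemma diag_sum_sqrt_bound m (f : m.-tuple X -> R) : (0 < m)%N -> Lproj mu (2 * m)%:R f ->
  box_series_cvg mu T (2 * m)%:R f ->
  exists2 B : R, 0 <= B & forall n, (0 < n)%N ->
    nrm mu 2 (diag_sum mu T n f) <= B * Num.sqrt n%:R ^+ m.
Proof.
move=> m0 fP /(box_series_diff m0 fP)[s [sP fs _]].
have [K [g [c ss]]] := Lproj_series m0 sP.
have mf := Lp_measurable (Lproj_Lp m0 fP).
pose B : R := (2 ^+ m * 2 + 2) ^+ m * c.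
have bound n : (0 < n)%N -> nrm mu 2 (diag_sum mu T n f) <= B * Num.sqrt n%:R ^+ m.
  move=> n0; have := diag_sum_bound mpT m0 n0 ss mf fs.
  by rewrite exprMn mulrAC.
exists B => //; have [_ gc _ _] := ss; rewrite /B mulr_ge0//.
by apply: le_trans (gc 0); rewrite /pcost big_geq.
Qed.

(** Here [u] is the sum of the series, read on X through one-tuples; its norms are those that enter
    [sigma2]. *)
Lemma diag_sum_linear_term (f : 1.-tuple X -> R) : Lproj mu 2%:R f -> box_series_cvg mu T 2%:R f ->
  exists u, [/\ u \in Lfun mu 2%:R%:E,
    forall n, diag_sum mu T n f = bsum T (fun x => u x - adj mu T u x) n %[ae mu],
    nrm (mu \^ 1) 2 (L2_series mu (fun k => koopman_preadjoint mu T (fun=> k) f)) = nrm mu 2 u &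
    nrm (mu \^ 1) 2 (L2_series mu (fun k => koopman_preadjoint mu T (fun=> k.+1) f)) =
      nrm mu 2 (adj mu T u)].
Proof.
move=> fP /(box_series_diff (m := 1) isT fP)[s [sP fs H]].
have fL := Lproj_Lp (m := 1) isT fP; have sL := Lproj_Lp (m := 1) isT sP.
have si := Lp_intg two0 sL.
have cv : nrm (mu \^ 1) 2 (fun y => box_sum mu T (fun=> n) f y - s y) @[n --> \oo] --> (0:R).
  apply/cvgr0Pnorm_le => e e0; have [M HM] := H e e0.
  exists M => // n /= Mn; rewrite ger0_norm ?nrm_ge0//.
  exact: (proj_norm_nrm (m := 1) isT (HM (fun=> n) (fun=> Mn))).
have [E1 E2] := L2_series_box mpT fL sL fs cv.
exists (s \o one_tuple); split => //; first exact: (Lp_one_tuple two0 sL).1.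
move=> n.
have fu : f \o one_tuple = (fun x => (s \o one_tuple) x - adj mu T (s \o one_tuple) x) %[ae mu].
  have aL := (adj_Lp (mp_pow_map mpT (fun _ : 'I_1 => 1%N)) two0 sL).1.
  have fsa : f = (fun y => s y - adj (mu \^ 1) (pow_map T (fun=> 1%N)) s y) %[ae mu \^ 1].
    by apply: filterS2 fs (box_diff_one T si) => y /(_ I) -> /(_ I).
  have L1 (v : 1.-tuple X -> R) : v \in Lfun (mu \^ 1) 2%:R%:E -> v \in Lfun (mu \^ 1) 1%:R%:E.
    by move=> vL; exact: (Lp_incl (M := 1) _ vL).1.
  have := one_tuple_ae (L1 _ fL) (L1 _ (LpB two0 sL aL)) fsa.
  by apply: filterS2 (adj_one_tuple mpT si) => x /(_ I) /= H1 /(_ I) /= -> _; rewrite -H1.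
have all_k : {ae mu, forall x, forall k, (f \o one_tuple) (iter k T x) =
    (s \o one_tuple) (iter k T x) - adj mu T (s \o one_tuple) (iter k T x)}.
  apply: ae_foralln => k.
  have fu' : {ae mu, forall x, (f \o one_tuple) x = (s \o one_tuple) x - adj mu T (s \o one_tuple) x}.
    by apply: filterS fu => x /(_ I).
  exact: (mp_ae (mp_iter k mpT) fu').
apply: filterS2 (diag_sum_one_tuple mpT n fP) all_k => x /(_ I) -> Hx _.
by apply: eq_bigr => k _; exact: Hx.
Qed.

Variables (d : nat) (f : d.-tuple X -> R).
Hypothesis d0 : (0 < d)%N.
Hypothesis hR : forall m : nat, (1 <= m <= d)%N ->
  Lproj mu (2 * m)%:R (hoeffding mu m f) /\ box_series_cvg mu T (2 * m)%:R (hoeffding mu m f).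

Let Psi m n := diag_sum mu T n (hoeffding mu m f).

Let cardS (S : {set 'I_d}) : (#|S| <= d)%N.
Proof. by have := max_card (mem S); rewrite card_ord. Qed.

Let PsiL m n : (1 <= m <= d)%N -> Psi m n \in Lfun mu 2%:R%:E.
Proof. by move=> md; apply: diag_sum_Lp; [case/andP: md|exact: (hR md).1]. Qed.

(** The coordinates off S are free and give n^(d - |S|); divided by n^(d - 1/2) this is sqrt n /
    n^|S|. *)
Lemma von_misesE n x : (0 < n)%N ->
  von_mises mu T f n x = \sum_(S : {set 'I_d} | (0 < #|S|)%N) Num.sqrt n%:R / n%:R ^+ #|S| * Psi #|S| n x.
Proof.
move=> n0; have nR : (n%:R : R) != 0 by rewrite pnatr_eq0 -lt0n.
have sn : Num.sqrt n%:R != 0 :> R by rewrite sqrtr_eq0 -ltNge ltr0n.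
rewrite /von_mises /diag_centered exchange_big/= mulr_sumr; apply: eq_bigr => S _.
have -> : \sum_(k : {ffun 'I_d -> 'I_n}) diag_map mu (2 * #|S|)%:R
    (koopman T (fun i : 'I_#|S| => k (enum_val i) : nat) (hoeffding mu #|S| f)) x =
    n%:R ^+ (d - #|S|) * Psi #|S| n x.
  rewrite -[RHS](sum_restriction (fun k : {ffun 'I_#|S| -> 'I_n} =>
    diag_map mu (2 * #|S|)%:R (koopman T (fun i => k i : nat) (hoeffding mu #|S| f)) x)).
  apply: eq_bigr => k _.
  rewrite [X in koopman T X](_ : _ = fun i : 'I_#|S| => [ffun i0 : 'I_#|S| => k (enum_val i0)] i : nat)//.
  by apply/funext => i; rewrite ffunE.
rewrite powRB ?nR ?implybT// powR_mulrn// powR12_sqrt// -{1}(subnKC (cardS S)) exprD.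
have nd : n%:R ^+ (d - #|S|) != 0 :> R by rewrite expf_neq0.
have nS : n%:R ^+ #|S| != 0 :> R by rewrite expf_neq0.
by field; rewrite sn nd nS.
Qed.

Lemma von_mises_Lp n : von_mises mu T f n \in Lfun mu 2%:R%:E.
Proof.
apply: LpZ => //; apply: (Lp_sum _ (F := fun (k : {ffun 'I_d -> 'I_n}) x => diag_centered mu T f (fun i => k i : nat) x)) => // k.
pose F (S : {set 'I_d}) x : R := if (0 < #|S|)%N then diag_map mu (2 * #|S|)%:R
  (koopman T (fun i : 'I_#|S| => k (enum_val i) : nat) (hoeffding mu #|S| f)) x else 0.
rewrite (_ : diag_centered mu T f _ = fun x => \sum_(S : {set 'I_d}) F S x); last first.
  by apply/funext => x; rewrite /diag_centered big_mkcond.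
apply: (Lp_sum _ (F := F)) => // S; rewrite /F; case: ltnP => [S0|_]; last exact: Lp0.
have [RP _] := hR (introT andP (conj S0 (cardS S))).
have [K [g [c fs]]] := Lproj_series S0 RP.
have H := diag_map_L2 S0 (proj_series_Lproj S0 (koopman_series mpT S0 (fun i : 'I_#|S| => k (enum_val i) : nat) fs)).
exact: H.
Qed.

(** Sets of two or more elements contribute O(1 / sqrt n) by [diag_sum_sqrt_bound]. The d singletons
    give the same sum, which differs from the martingale by the end values of a coboundary. *)
Lemma von_mises_approximation : exists u : X -> R, [/\ u \in Lfun mu 2%:R%:E,
  sigma2 mu T f = nrm mu 2 u ^+ 2 - nrm mu 2 (adj mu T u) ^+ 2 &
  exists B : R, forall n, (0 < n)%N ->
    nrm mu 2 (fun x => von_mises mu T f n x -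
      d%:R / Num.sqrt n%:R * bsum T (fun x => u x - adj mu T u (T x)) n x) <= B / Num.sqrt n%:R].
Proof.
have [P1 b1] := hR (introT andP (conj (isT : (1 <= 1)%N) d0)).
have [u [uL uE n1 n2]] := diag_sum_linear_term P1 b1.
exists u; split => //.
  by rewrite /sigma2 -n1 -n2.
(* The value 0 outside the range 1..d only makes the choice total. *)
have /choice[b bP] : forall m, exists b : R, 0 <= b /\ ((1 <= m <= d)%N -> forall n, (0 < n)%N ->
    nrm mu 2 (Psi m n) <= b * Num.sqrt n%:R ^+ m).
  move=> m; case md : (1 <= m <= d)%N; last by exists 0.
  have [mP mb] := hR md; have /andP[m0 _] := md.
  by have [B B0 HB] := diag_sum_sqrt_bound m0 mP mb; exists B.
have [aL an] := adj_Lp mpT two0 uL.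
pose a := adj mu T u.
pose rest n x : R := \sum_(S : {set 'I_d}) if (1 < #|S|)%N then Num.sqrt n%:R / n%:R ^+ #|S| * Psi #|S| n x else 0.
pose B := \sum_(S : {set 'I_d}) b #|S|.
exists (B + d%:R * (nrm mu 2 a + nrm mu 2 a)) => n n0.
have s1 : 1 <= Num.sqrt n%:R :> R.
  have : Num.sqrt 1 <= Num.sqrt n%:R :> R by rewrite ler_sqrt ?ler1n.
  by rewrite sqrtr1.
have s0 : 0 < Num.sqrt n%:R :> R by exact: lt_le_trans s1.
have nE : n%:R = Num.sqrt n%:R ^+ 2 :> R by rewrite sqr_sqrtr.
have termL (S : {set 'I_d}) : (fun x => if (1 < #|S|)%N then Num.sqrt n%:R / n%:R ^+ #|S| * Psi #|S| n x else 0) \in Lfun mu 2%:R%:E /\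
    nrm mu 2 (fun x => if (1 < #|S|)%N then Num.sqrt n%:R / n%:R ^+ #|S| * Psi #|S| n x else 0) <= b #|S| / Num.sqrt n%:R.
  have bS := (bP #|S|).1; case: ltnP => S1; last first.
    by split; [exact: Lp0|rewrite nrm0// divr_ge0// ltW].
  have Sd : (1 <= #|S| <= d)%N by rewrite ltnW/= ?cardS.
  split; first by apply: LpZ => //; exact: PsiL.
  rewrite nrmZ//; last exact: PsiL.
  rewrite ger0_norm; last by rewrite divr_ge0 ?sqrtr_ge0 ?exprn_ge0.
  apply: (@le_trans _ _ (Num.sqrt n%:R / n%:R ^+ #|S| * (b #|S| * Num.sqrt n%:R ^+ #|S|))).
    by apply: ler_wpM2l; [rewrite divr_ge0 ?sqrtr_ge0 ?exprn_ge0|exact: (bP #|S|).2].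
  rewrite {2}nE -exprM mulnC exprM; set r := Num.sqrt n%:R in s1 s0 *.
  have rS : r ^+ #|S| != 0 by rewrite expf_neq0// gt_eqF.
  (* With r = sqrt n the term is b r^(1 - |S|), at most b / r since |S| >= 2. *)
  have -> : r / (r ^+ #|S|) ^+ 2 * (b #|S| * r ^+ #|S|) = b #|S| * (r / r ^+ #|S|) by field.
  apply: ler_wpM2l => //; rewrite ler_pdivrMr ?exprn_gt0// mulrC ler_pdivlMr// -expr2.
  by rewrite ler_weXn2l.
have restL : rest n \in Lfun mu 2%:R%:E.
  by apply: (Lp_sum _ (F := fun (S : {set 'I_d}) x => if (1 < #|S|)%N then Num.sqrt n%:R / n%:R ^+ #|S| * Psi #|S| n x else 0)) => // S; exact: (termL S).1.
have restn : nrm mu 2 (rest n) <= B / Num.sqrt n%:R.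
  apply: le_trans (nrm_sum _ (F := fun (S : {set 'I_d}) x => if (1 < #|S|)%N then Num.sqrt n%:R / n%:R ^+ #|S| * Psi #|S| n x else 0) two0 (fun S => (termL S).1)) _.
  by rewrite /B mulr_suml; apply: ler_sum => S _; exact: (termL S).2.
have vE x : von_mises mu T f n x = d%:R / Num.sqrt n%:R * Psi 1 n x + rest n x.
  rewrite von_misesE// (bigID (fun S : {set 'I_d} => #|S| == 1%N))/=; congr (_ + _).
    rewrite (eq_bigr (fun=> (Num.sqrt n%:R)^-1 * Psi 1 n x)).
      rewrite (eq_bigl (fun S : {set 'I_d} => S \in finset (fun A : {set 'I_d} => #|A| == 1%N))); last first.
        by move=> S; rewrite inE; case: eqP => [->|]; rewrite ?andbF.
      by rewrite sumr_const card_draws card_ord bin1 -mulr_natl; ring.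
    move=> S /andP[_ /eqP ->]; congr (_ * _).
    by rewrite expr1 {2}nE expr2 invfM mulrA divff ?gt_eqF// mul1r.
  rewrite /rest [RHS]big_mkcond/= [LHS]big_mkcond/=; apply: eq_bigr => S _.
  by case: #|S| => [|[|k]].
have [aTL aTn] := mp_Lp (mp_iter n mpT) two0 aL.
pose err x := d%:R / Num.sqrt n%:R * (a (iter n T x) - a x).
have errL : err \in Lfun mu 2%:R%:E by apply: LpZ => //; exact: LpB.
have errn : nrm mu 2 err <= d%:R * (nrm mu 2 a + nrm mu 2 a) / Num.sqrt n%:R.
  rewrite nrmZ//; last exact: LpB.
  rewrite ger0_norm; last by rewrite divr_ge0// ltW.
  rewrite mulrAC; apply: ler_wpM2r; first by rewrite invr_ge0 ltW.
  apply: ler_wpM2l => //; apply: le_trans (nrmB two0 aTL aL) _.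
  by rewrite /a aTn.
have E : (fun x => von_mises mu T f n x - d%:R / Num.sqrt n%:R * bsum T (fun x => u x - adj mu T u (T x)) n x) =
    (fun x => rest n x + err x) %[ae mu].
  apply: filterS (uE n) => x /(_ I) Hx _.
  by rewrite vE /Psi Hx bsum_cobound /err /a; ring.
have e0L : (fun x => u x - adj mu T u (T x)) \in Lfun mu 2%:R%:E.
  by apply: LpB => //; exact: (mp_Lp mpT two0 aL).1.
rewrite (nrm_ae two0 _ _ E); last 2 first.
- by apply: Lp_measurable (LpB two0 (von_mises_Lp n) (LpZ _ two0 (bsum_Lp mpT n two0 e0L))).
- exact: Lp_measurable (LpD two0 restL errL).
apply: le_trans (nrmD two0 restL errL) _.
by rewrite mulrDl; apply: lerD.
Qed.

End von_mises_decomposition.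

Theorem mainTheorem3 (R : realType) (disp : measure_display)
    (X : measurableType disp) (mu : probability X R) (T : X -> X)
    (d : nat) (f : d.-tuple X -> R)
    (hd : (1 <= d)%N)
    (hX : standard_space mu)
    (hT : exact_map mu T)
    (hf : f \in Lfun (mu \^ d) 2%:E)
    (hfsym : symmetric_fun mu f)
    (hR : forall m : nat, (1 <= m <= d)%N ->
       [/\ Lproj mu (2 * m)%:R (hoeffding mu m f),
           symmetric_fun mu (hoeffding mu m f) &
           box_series_cvg mu T (2 * m)%:R (hoeffding mu m f)]) :
  [/\ 0 <= sigma2 mu T f,
      cvg_in_distribution mu (von_mises mu T f)
        (centered_gaussian (d%:R ^+ 2 * sigma2 mu T f)) &
      ('E_mu[(fun x => von_mises mu T f n x ^+ 2)%R])%E @[n --> \oo] -->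
        (d%:R ^+ 2 * sigma2 mu T f)%:E].
Proof.
have two0 : (0 < 2)%N by [].
have hR' m : (1 <= m <= d)%N ->
    Lproj mu (2 * m)%:R (hoeffding mu m f) /\ box_series_cvg mu T (2 * m)%:R (hoeffding mu m f).
  by move=> /hR[].
have [u [uL sE [B uB]]] := von_mises_approximation hT hd hR'.
have mpT := hT.1; have [aL _] := adj_Lp mpT two0 uL.
have [aTL _] := mp_Lp mpT two0 aL.
(* The martingale difference is u - V V^* u: it is killed by V^*, and its variance is [sigma2] by
   [adj_pythagoras]. *)
have eL := LpB two0 uL aTL.
have ae0 := adj_cobound mpT (Lp_intg two0 uL).
have varE := adj_pythagoras mpT uL; rewrite -sE in varE.
have ZL n := von_mises_Lp hT hR' n.
split.
- by rewrite -varE; apply: Rint_ge0 => x; exact: sqr_ge0.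
- by rewrite -varE; exact: (weak_limit hT eL ae0 (ler0n _ d) ZL uB).
- have := weak_limit_second_moment hT eL ae0 (ler0n _ d) ZL uB.
  rewrite varE => H.
  rewrite (_ : (fun n => _) = fun n => (nrm mu 2 (von_mises mu T f n) ^+ 2)%:E).
    by apply: cvg_EFin => //; exact: nearW.
  apply/funext => n; rewrite unlock nrm2E// EFin_Rint//.
  by have := (L2_mul (ZL n) (ZL n)).1.
Qed.
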